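(* Consider unital inclusions of C$^*$-algebras $A\supseteq D\subseteq B$ with $A$ and $B$ finite dimensional. Let $A*_DB$ be the corresponding full amalgamated free product C$^*$-algebra. Then $A*_DB$ is residually finite dimensional if and only if there are faithful tracial states $\tau_A$ on $A$ and $\tau_B$ on $B$ whose restrictions to $D$ agree.
   Context: A C$^*$-algebra is residually finite dimensional if it has a separating family of finite dimensional $*$-representations. Given C$^*$-algebras $A,B,D$ with injective $*$-homomorphisms $\phi_A:D\to A$ and $\phi_B:D\to B$, the full amalgamated free product $A*_DB$ is the C$^*$-algebra equipped with injective $*$-homomorphisms $\sigma_A:A\to A*_DB$ and $\sigma_B:B\to A*_DB$ such that $\sigma_A\circ\phi_A=\sigma_B\circ\phi_B$, $A*_DB$ is generated by $\sigma_A(A)\cup\sigma_B(B)$, and whenever $\mathfrak{C}$ is a C$^*$-algebra and $\pi_A:A\to\mathfrak{C}$, $\pi_B:B\to\mathfrak{C}$ are $*$-homomorphisms with $\pi_A\circ\phi_A=\pi_B\circ\phi_B$, there is a $*$-homomorphism $\pi:A*_DB\to\mathfrak{C}$ with $\pi\circ\sigma_A=\pi_A$ and $\pi\circ\sigma_B=\pi_B$. *)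

(* Defs.v *)
From HB Require Import structures.
From mathcomp Require Import all_boot all_order all_algebra.
From mathcomp Require Import all_classical all_reals all_analysis.
From mathcomp Require Import complex.

Set Implicit Arguments.
Unset Strict Implicit.
Unset Printing Implicit Defensive.

Import Order.TTheory GRing.Theory Num.Theory.
Import numFieldNormedType.Exports.

Local Open Scope classical_set_scope.
Local Open Scope ring_scope.
Local Open Scope complex_scope.

Reserved Notation "a ** b" (at level 40, left associativity).

(* The ring structures of MathComp are unital, whereas C*-algebras (notably
   the targets in the universal property of the amalgamated free product) need
   not be: the product is therefore introduced on top of the module structure. *)
HB.mixin Record Lmodule_isStarAlgebra (K : numClosedFieldType) A
    of GRing.Lmodule K A := {
  smul : A -> A -> A;
  star : A -> A;
  smulA : associative smul;
  smulDl : left_distributive smul +%R;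
  smulDr : right_distributive smul +%R;
  smulZl : forall (k : K) (a b : A), smul (k *: a) b = k *: smul a b;
  smulZr : forall (k : K) (a b : A), smul a (k *: b) = k *: smul a b;
  starK : involutive star;
  starD : {morph star : a b / a + b};
  starZ : forall (k : K) (a : A), star (k *: a) = Num.conj k *: star a;
  starM : forall a b : A, star (smul a b) = smul (star b) (star a)
}.

#[short(type="starAlgType")]
HB.structure Definition StarAlgebra (K : numClosedFieldType) :=
  {A of GRing.Lmodule K A & Lmodule_isStarAlgebra K A}.

Notation "a ** b" := (smul a b) : ring_scope.

(* The norm of a normed module over R[i] takes its values in R[i]. *)
HB.mixin Record StarAlgebra_isCStar (R : realType) A
    of StarAlgebra R[i] A & CompleteNormedModule R[i] A := {
  normr_smul : forall a b : A, `|a ** b| <= `|a| * `|b|;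
  cstar_identity : forall a : A, `|star a ** a| = `|a| ^+ 2
}.

#[short(type="cstarAlgType")]
HB.structure Definition CStarAlgebra (R : realType) :=
  {A of StarAlgebra R[i] A & CompleteNormedModule R[i] A
      & StarAlgebra_isCStar R A}.

(* Units are nonzero, as for nzRingType: the zero algebra has no state. *)
HB.mixin Record CStarAlgebra_isUnital (R : realType) A of CStarAlgebra R A := {
  sone : A;
  smul1l : left_id sone (smul : A -> A -> A);
  smul1r : right_id sone (smul : A -> A -> A);
  sone_neq0 : sone != 0
}.

#[short(type="unitalCStarAlgType")]
HB.structure Definition UnitalCStarAlgebra (R : realType) :=
  {A of CStarAlgebra R A & CStarAlgebra_isUnital R A}.

Definition star_hom (K : numClosedFieldType) (A B : starAlgType K)
    (f : A -> B) : Prop :=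
  [/\ linear f,
      forall a b, f (a ** b) = f a ** f b
    & forall a, f (star a) = star (f a)].

Definition unital_inclusion (R : realType) (D A : unitalCStarAlgType R)
    (phi : D -> A) : Prop :=
  [/\ star_hom phi, injective phi & phi sone = sone].

Definition finite_dimensional (K : fieldType) (V : lmodType K) : Prop :=
  exists (n : nat) (e : 'I_n -> V),
    forall v, exists c : 'I_n -> K, v = \sum_(i < n) c i *: e i.

(* 'M[K]_n, with the conjugate transpose as involution, is the *-algebra of
   all operators on the Hilbert space K^n. *)
Section MatrixStarAlgebra.
Variables (K : numClosedFieldType) (n : nat).
Implicit Types A B : 'M[K]_n.

Definition mxstar A : 'M[K]_n := map_mx Num.conj A^T.

Fact mxstarK : involutive mxstar.
Proof. by move=> A; apply/matrixP => i j; rewrite !mxE conjCK. Qed.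

Fact mxstarD : {morph mxstar : A B / A + B}.
Proof. by move=> A B; apply/matrixP => i j; rewrite !mxE rmorphD. Qed.

Fact mxstarZ (k : K) A : mxstar (k *: A) = Num.conj k *: mxstar A.
Proof. by apply/matrixP => i j; rewrite !mxE rmorphM. Qed.

Fact mxstarM A B : mxstar (A *m B) = mxstar B *m mxstar A.
Proof. by rewrite /mxstar trmx_mul map_mxM. Qed.

HB.instance Definition _ := Lmodule_isStarAlgebra.Build K 'M[K]_n
  (@mulmxA _ n n n n) (@mulmxDl _ n n n) (@mulmxDr _ n n n)
  (fun k A B => esym (scalemxAl k A B)) (fun k A B => esym (scalemxAr k A B))
  mxstarK mxstarD mxstarZ mxstarM.
End MatrixStarAlgebra.

Definition residually_finite_dimensional (R : realType) (P : cstarAlgType R)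
    : Prop :=
  exists (I : Type) (n : I -> nat) (rho : forall i, P -> 'M[R[i]]_(n i)),
    (forall i, star_hom (rho i)) /\
    (forall x : P, x != 0 -> exists i, rho i x != 0).

Definition star_subalgebra (K : numClosedFieldType) (A : starAlgType K)
    (S : set A) : Prop :=
  [/\ S 0,
      forall a b, S a -> S b -> S (a + b),
      forall (k : K) a, S a -> S (k *: a),
      forall a b, S a -> S b -> S (a ** b)
    & forall a, S a -> S (star a)].

Definition cstar_generates (R : realType) (A : cstarAlgType R) (G : set A)
    : Prop :=
  forall S : set A, star_subalgebra S -> closed S -> G `<=` S -> S = setT.

Definition is_amalgamated_free_product (R : realType)
    (A B D P : cstarAlgType R) (phiA : D -> A) (phiB : D -> B)
    (sigmaA : A -> P) (sigmaB : B -> P) : Prop :=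
  [/\ star_hom sigmaA /\ injective sigmaA,
      star_hom sigmaB /\ injective sigmaB,
      sigmaA \o phiA =1 sigmaB \o phiB,
      cstar_generates (range sigmaA `|` range sigmaB)
    & forall (C : cstarAlgType R) (piA : A -> C) (piB : B -> C),
        star_hom piA -> star_hom piB -> piA \o phiA =1 piB \o phiB ->
        exists pi : P -> C,
          [/\ star_hom pi, pi \o sigmaA =1 piA & pi \o sigmaB =1 piB]].

(* In the order of R[i], 0 <= z means that z is real and nonnegative. *)
Definition tracial_state (R : realType) (A : unitalCStarAlgType R)
    (tau : A -> R[i]) : Prop :=
  [/\ scalar tau,
      forall a, 0 <= tau (star a ** a),
      tau sone = 1
    & forall a b, tau (a ** b) = tau (b ** a)].

Definition faithful (R : realType) (A : unitalCStarAlgType R)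
    (tau : A -> R[i]) : Prop :=
  forall a, tau (star a ** a) = 0 -> a = 0.

(* Main.v *)
(* If [P = A *_D B] is residually finite dimensional, finitely many
   finite-dimensional representations are jointly injective on the images of
   [A] and [B], and the sum of their traces restricts to both traces.

   Conversely, given the traces, coordinates diagonalising [tauA] in the
   regular representation of [A] write [tauA] as a positive combination of
   traces of finite-dimensional representations, and similarly [tauB].  Their
   agreement on [D] is a family of integer linear relations between the real
   weights, because the spectral multiplicities of elements of [D] are integers;
   so the weights can be replaced by positive integers.  This gives
   representations [alpha] of [A] and [beta] of [B] of the same finite dimension,
   containing the regular representations, whose restrictions to [D] have the
   same trace, hence are unitarily equivalent.

   Every GNS space of [P] then embeds [A]-isometrically into a multiple of
   [alpha] and [B]-isometrically into a multiple of [beta].  Restricted to the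
   span of the words of bounded length, these two embeddings differ by a
   finite-rank partial isometry commuting with [D], which Halmos's 2x2 dilation
   turns into a unitary commuting with [D].  Conjugating by it glues [alpha] and
   [beta] to a finite-dimensional representation of [P] that reproduces the
   given vector state exactly on words of bounded length. *)

(* In general no finite-dimensional subspace of a GNS space is invariant under both [A] and [B], so
   a representation of [P] cannot simply be compressed: the universal property asks for genuine
   representations of [A] and [B] that agree on [D]. The traces supply a finite-dimensional
   reservoir in which this agreement holds from the start, and since it contains the regular
   representations, its multiples have room for any finite set of GNS vectors. Doubling the space
   avoids any comparison of the multiplicities of [D] on the complements of the two embedded spaces.
   The GNS space itself is never built: only the semidefinite form [F (star y ** z)] on spans of
   finitely many words occurs. What has to be built is the state [F]. For an abstract C*-algebra
   this rests on the positivity of [star y ** y], which is derived from square roots and norm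
   estimates instead of spectra. Vector states are reproduced exactly only on words, while an
   element of [P] is merely a limit of combinations of words; hence the quantitative estimate at the
   end. *)
Require Import Defs.
From HB Require Import structures.
From mathcomp Require Import all_boot all_order all_algebra.
From mathcomp Require Import all_classical all_reals all_analysis.
From mathcomp Require Import complex mxtens ring lra.

Set Implicit Arguments.
Unset Strict Implicit.
Unset Printing Implicit Defensive.

Import Order.TTheory GRing.Theory Num.Theory.
Import numFieldNormedType.Exports.

Local Open Scope classical_set_scope.
Local Open Scope ring_scope.

(* Trivial square-zero extension of K by V: it turns identities between
   linear combinations in V into identities in a commutative ring. *)
Section SquareZeroExtension.
Variables (K : comNzRingType) (V : lmodType K).

Definition sqzero := (K * V)%type.
HB.instance Definition _ := GRing.Zmodule.on sqzero.

Definition sqzero_mul (u v : sqzero) : sqzero :=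
  (u.1 * v.1, u.1 *: v.2 + v.1 *: u.2).

Fact sqzero_mulA : associative sqzero_mul.
Proof.
move=> u v w; rewrite /sqzero_mul /=; congr (_, _); first exact: mulrA.
rewrite !scalerDr !scalerA addrA; congr (_ + _ *: _ + _ *: _); exact: mulrC.
Qed.

Fact sqzero_mulC : commutative sqzero_mul.
Proof. by move=> u v; rewrite /sqzero_mul mulrC addrC. Qed.

Fact sqzero_mul1 : left_id ((1, 0) : sqzero) sqzero_mul.
Proof.
by case=> k v; rewrite /sqzero_mul /= mul1r scale1r scaler0 addr0.
Qed.

Fact sqzero_mulD : left_distributive sqzero_mul +%R.
Proof.
move=> u v w; rewrite /sqzero_mul /= mulrDl scalerDl scalerDr.
by congr (_, _); rewrite addrACA.
Qed.

Fact sqzero_1neq0 : ((1, 0) : sqzero) != 0.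
Proof. by rewrite -pair_eqE /= oner_eq0. Qed.

HB.instance Definition _ := GRing.Zmodule_isComNzRing.Build sqzero
  sqzero_mulA sqzero_mulC sqzero_mul1 sqzero_mulD sqzero_1neq0.

Definition sqz_scalar (k : K) : sqzero := (k, 0).
Definition sqz_vec (v : V) : sqzero := (0, v).

Fact sqz_scalar_additive : zmod_morphism sqz_scalar.
Proof. by move=> k l; rewrite /sqz_scalar -[RHS]/(k - l, 0 - 0) subr0. Qed.
Fact sqz_scalar_monoid : monoid_morphism sqz_scalar.
Proof.
split=> // k l; rewrite /sqz_scalar.
by rewrite -[RHS]/(k * l, k *: 0 + l *: 0) !scaler0 addr0.
Qed.
HB.instance Definition _ :=
  GRing.isZmodMorphism.Build K sqzero sqz_scalar sqz_scalar_additive.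
HB.instance Definition _ :=
  GRing.isMonoidMorphism.Build K sqzero sqz_scalar sqz_scalar_monoid.

Lemma sqz_vec_inj : injective sqz_vec. Proof. by move=> u v []. Qed.
Lemma sqz_vec0 : sqz_vec 0 = 0. Proof. by []. Qed.
Lemma sqz_vecD u v : sqz_vec (u + v) = sqz_vec u + sqz_vec v.
Proof. by rewrite -[RHS]/(0 + 0, u + v) addr0. Qed.
Lemma sqz_vecN u : sqz_vec (- u) = - sqz_vec u.
Proof. by rewrite -[RHS]/(- 0, - u) oppr0. Qed.
Lemma sqz_vecMn u n : sqz_vec (u *+ n) = sqz_vec u *+ n.
Proof. by elim: n => // n ih; rewrite !mulrS sqz_vecD ih. Qed.
Lemma sqz_vecZ k u : sqz_vec (k *: u) = sqz_scalar k * sqz_vec u.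
Proof.
by rewrite -[RHS]/(k * 0, k *: u + 0 *: 0) mulr0 scaler0 addr0.
Qed.

Definition sqz_vecE := (sqz_vec0, sqz_vecD, sqz_vecN, sqz_vecMn, sqz_vecZ).
End SquareZeroExtension.

Ltac module := apply: sqz_vec_inj; rewrite !sqz_vecE; ring.


(** * Positivity in C*-algebras *)

Section StarAlgebraTheory.
Variables (K : numClosedFieldType) (A : starAlgType K).
Implicit Types (a b : A) (k : K).

Lemma smul0l b : 0 ** b = 0 :> A.
Proof. by rewrite -(scale0r (0 : A)) smulZl !scale0r. Qed.

Lemma smul0r b : b ** 0 = 0 :> A.
Proof. by rewrite -(scale0r (0 : A)) smulZr !scale0r. Qed.

Lemma smulNl a b : (- a) ** b = - (a ** b).
Proof. by rewrite -scaleN1r smulZl scaleN1r. Qed.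

Lemma smulNr a b : a ** (- b) = - (a ** b).
Proof. by rewrite -scaleN1r smulZr scaleN1r. Qed.

Lemma smulBl a b c : (a - b) ** c = a ** c - b ** c.
Proof. by rewrite smulDl smulNl. Qed.

Lemma smulBr a b c : a ** (b - c) = a ** b - a ** c.
Proof. by rewrite smulDr smulNr. Qed.

Lemma smul_suml I (r : seq I) (Q : pred I) (F : I -> A) b :
  (\sum_(i <- r | Q i) F i) ** b = \sum_(i <- r | Q i) F i ** b.
Proof. by elim/big_rec2: _ => [|i x y _ <-]; rewrite ?smul0l ?smulDl. Qed.

Lemma smul_sumr I (r : seq I) (Q : pred I) (F : I -> A) b :
  b ** (\sum_(i <- r | Q i) F i) = \sum_(i <- r | Q i) b ** F i.
Proof. by elim/big_rec2: _ => [|i x y _ <-]; rewrite ?smul0r ?smulDr. Qed.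

Lemma star0 : star (0 : A) = 0.
Proof. by rewrite -(scale0r (0 : A)) starZ conjC0 !scale0r. Qed.

Lemma starN a : star (- a) = - star a.
Proof. by rewrite -scaleN1r starZ rmorphN rmorph1 scaleN1r. Qed.

Lemma starB a b : star (a - b) = star a - star b.
Proof. by rewrite starD starN. Qed.

Lemma star_sum I (r : seq I) (Q : pred I) (F : I -> A) :
  star (\sum_(i <- r | Q i) F i) = \sum_(i <- r | Q i) star (F i).
Proof. by elim/big_rec2: _ => [|i x y _ <-]; rewrite ?star0 ?starD. Qed.

Lemma star_unit e : left_id e (smul : A -> A -> A) -> star e = e.
Proof. by move=> el; rewrite -[RHS]starK -(el (star e)) starM !starK el. Qed.

End StarAlgebraTheory.

Section CStarPositivity.
Variables (R : realType) (P : cstarAlgType R).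
Implicit Types (x y z h a b : P) (r t : R).

Local Notation "r '%:C'" := (real_complex R r).

(** The norm of [P] takes values in [R[i]]; the real version makes estimates accessible to [lra] and
    [nra]. *)
Definition nrm x : R := complex.Re `|x|.

Lemma normrE x : `|x| = (nrm x)%:C.
Proof. by rewrite /nrm RRe_real ?normr_real. Qed.

Lemma nrm_ge0 x : 0 <= nrm x.
Proof. by rewrite -ler0c -normrE. Qed.

Lemma nrmD x y : nrm (x + y) <= nrm x + nrm y.
Proof. by rewrite -lecR rmorphD /= -!normrE ler_normD. Qed.

Lemma nrmN x : nrm (- x) = nrm x.
Proof. by rewrite /nrm normrN. Qed.

Lemma nrmB x y : nrm (x - y) <= nrm x + nrm y.
Proof. by rewrite -(nrmN y) nrmD. Qed.

Lemma nrmZ (k : R[i]) x : (nrm (k *: x))%:C = `|k| * (nrm x)%:C.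
Proof. by rewrite -!normrE normrZ. Qed.

Lemma nrm_scale r x : nrm (r%:C *: x) = `|r| * nrm x.
Proof.
apply: (@complexI R); rewrite nrmZ rmorphM /=; congr (_ * _).
by rewrite normc_def /= expr0n /= addr0 sqrtr_sqr.
Qed.

Lemma nrm_imag x : nrm ('i *: x) = nrm x.
Proof. by apply: (@complexI R); rewrite nrmZ normCi mul1r. Qed.

Lemma nrmM x y : nrm (x ** y) <= nrm x * nrm y.
Proof. by rewrite -lecR rmorphM /= -!normrE normr_smul. Qed.

Lemma nrm_cstar x : nrm (star x ** x) = nrm x ^+ 2.
Proof.
by apply: (@complexI R); rewrite rmorphXn /= -!normrE cstar_identity.
Qed.

Lemma nrm_eq0 x : (nrm x == 0) = (x == 0).
Proof. by rewrite -[RHS]normr_eq0 normrE -(inj_eq (@complexI R)). Qed.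

Lemma nrm0 : nrm 0 = 0.
Proof. by apply/eqP; rewrite nrm_eq0. Qed.

Lemma nrm_star x : nrm (star x) = nrm x.
Proof.
suff le y : nrm y <= nrm (star y).
  by apply/eqP; rewrite eq_le le andbT -{2}(starK x) le.
have [->|y0] := eqVneq y 0; first by rewrite star0.
have y_gt0 : 0 < nrm y by rewrite lt_def nrm_eq0 y0 nrm_ge0.
by rewrite -(ler_pM2r y_gt0) -expr2 -nrm_cstar nrmM.
Qed.

Lemma star_conjR r x : star (r%:C *: x) = r%:C *: star x.
Proof.
rewrite starZ; congr (_ *: _); apply: (conj_Creal _).
by apply/complex_realP; exists r.
Qed.


Lemma half_scaleK x : (2^-1 : R)%:C *: x *+ 2 = x.
Proof.
rewrite mulr2n -scalerDl -rmorphD /= (_ : 2^-1 + 2^-1 = 1) ?rmorph1; last by field.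
by rewrite scale1r.
Qed.

Lemma nrm_small_eq0 x r : (forall d, 0 < d -> nrm x <= d * r) -> x = 0.
Proof.
move=> small; apply/eqP; rewrite -nrm_eq0 eq_le nrm_ge0 andbT.
have r_ge0 : 0 <= r by rewrite -(mul1r r) (le_trans (nrm_ge0 x)) ?small.
apply/ler_addgt0Pr => d d0; rewrite add0r.
have r1 : 0 < r + 1 by rewrite ltr_wpDl.
apply: le_trans (small (d / (r + 1)) _) _; first by rewrite divr_gt0.
by rewrite mulrAC ler_pdivrMr // ler_pM2l // lerDl.
Qed.

(** Method of majorants: [s] is nondecreasing and bounded, hence Cauchy, and its increments control
    those of [u]. *)
Lemma limit_of_majorant (u : nat -> P) (s : nat -> R) (c : R) :
  (forall n, s n <= c) ->
  (forall m n, (m <= n)%N -> nrm (u n - u m) <= s n - s m) ->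
  exists l, forall d, 0 < d -> exists N, forall n, (N <= n)%N -> nrm (l - u n) < d.
Proof.
move=> sc us.
have s_nd : {homo s : m n / (m <= n)%N >-> m <= n}.
  by move=> m n mn; rewrite -subr_ge0 (le_trans (nrm_ge0 _) (us m n mn)).
have s_cvg : cvgn s.
  by apply: nondecreasing_is_cvgn => //; exists c => _ [n _ <-].
have s_cauchy (d : R) : 0 < d ->
    exists N, forall n, (N <= n)%N -> s n - s N < d.
  move=> d0; have /cvgrPdist_lt /(_ _ d0) [N _ hN] := s_cvg.
  exists N => n Nn; have := hN N (leqnn N); rewrite /= ger0_norm; last first.
    by rewrite subr_ge0; apply: nondecreasing_cvgn_le.
  by apply: le_lt_trans; rewrite lerB //; apply: nondecreasing_cvgn_le.
have u_cvg : cvg (u @ \oo).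
  suff : cauchy_ex (u @ \oo) by move/cauchy_exP => /cauchy_cvg.
  move=> e e0; have eE : e = (complex.Re e)%:C by rewrite RRe_real ?gtr0_real.
  have /s_cauchy[N hN] : 0 < complex.Re e by rewrite -ltcR -eE.
  exists (u N), N => // n /= Nn.
  rewrite -ball_normE /= distrC normrE eE ltcR.
  exact: le_lt_trans (us N n Nn) (hN n Nn).
exists (lim (u @ \oo)) => d d0.
have dC : 0 < d%:C by rewrite ltcR.
have /cvgrPdist_lt /(_ _ dC) [N _ hN] := u_cvg.
by exists N => n Nn; have := hN n Nn; rewrite /= normrE ltcR.
Qed.

Section WithUnit.
Variables (e : P) (smul1e : left_id e (smul : P -> P -> P))
          (smule1 : right_id e (smul : P -> P -> P)).

Let star_e : star e = e. Proof. exact: star_unit smul1e. Qed.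

(** Only an inequality, because [e] vanishes when [P] is the zero algebra. *)
Lemma nrm_unit_le1 : nrm e <= 1.
Proof.
have := nrm_cstar e; rewrite star_e smul1e => /eqP.
rewrite -[X in X == _]mulr1 expr2 -subr_eq0 -mulrBr mulf_eq0 => /orP[/eqP->//|].
by rewrite subr_eq0 => /eqP <-.
Qed.

(* [2 y = k + y ^ 2] says that [e - y] is a square root of [e - k].  The
   iterates of [y |-> (k + y ^ 2) / 2] are majorised by those for [k = 1]. *)
Lemma sqrt_fixpoint k : star k = k -> nrm k <= 1 ->
  exists y, [/\ star y = y, nrm y <= 1, y *+ 2 = k + y ** y
    & forall z, z ** k = k ** z -> z ** y = y ** z].
Proof.
move=> sk k1.
pose fy := fix fy n := if n is n'.+1 then
  (2^-1 : R)%:C *: (k + fy n' ** fy n') else 0 : P.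
pose s := fix s n : R := if n is n'.+1 then 2^-1 * (1 + s n' ^+ 2) else 0.
have s01 n : 0 <= s n <= 1 by elim: n => [|n ih] /=; nra.
have sfy n : star (fy n) = fy n.
  by elim: n => [|n ih] /=; rewrite ?star0 // star_conjR starD starM ih sk.
have nfy n : nrm (fy n) <= s n.
  elim: n => [|n ih] /=; first by rewrite nrm0.
  rewrite nrm_scale ger0_norm ?invr_ge0 // ler_pM2l ?invr_gt0 //.
  apply: le_trans (nrmD _ _) _; rewrite lerD // (le_trans (nrmM _ _)) //.
  by rewrite expr2 ler_pM ?nrm_ge0.
have cfy n z : z ** k = k ** z -> z ** fy n = fy n ** z.
  move=> zk; elim: n => [|n ih] /=; first by rewrite smul0l smul0r.
  by rewrite smulZl smulZr smulDl smulDr zk smulA ih -smulA ih smulA.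
have dfy n : nrm (fy n.+1 - fy n) <= s n.+1 - s n.
  elim: n => [|n ih].
    by rewrite subr0 (le_trans (nfy 1%N)) //= subr0.
  (* Both iterates commute with whatever commutes with [k], hence with each other, so the difference
     of squares factors. *)
  have -> : fy n.+2 - fy n.+1 =
      (2^-1 : R)%:C *: ((fy n.+1 - fy n) ** (fy n.+1 + fy n)).
    have E : fy n ** fy n.+1 = fy n.+1 ** fy n by apply/cfy/esym/cfy.
    rewrite smulBl !smulDr E.
    rewrite -[fy n.+2]/((2^-1 : R)%:C *: (k + fy n.+1 ** fy n.+1)).
    rewrite -[X in _ - X = _]/((2^-1 : R)%:C *: (k + fy n ** fy n)).
    by module.
  have -> : s n.+2 - s n.+1 = 2^-1 * ((s n.+1 - s n) * (s n.+1 + s n)).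
    by rewrite -[s n.+2]/(2^-1 * (1 + s n.+1 ^+ 2)) {2}/s -/s; ring.
  rewrite nrm_scale ger0_norm ?invr_ge0 // ler_pM2l ?invr_gt0 //.
  apply: le_trans (nrmM _ _) _; rewrite ler_pM ?nrm_ge0 //.
  by rewrite (le_trans (nrmD _ _)) // lerD.
have mfy m n : (m <= n)%N -> nrm (fy n - fy m) <= s n - s m.
  elim: n => [|n ih]; first by rewrite leqn0 => /eqP->; rewrite !subrr nrm0.
  rewrite leq_eqVlt => /orP[/eqP<-|mn]; first by rewrite !subrr nrm0.
  have -> : fy n.+1 - fy m = (fy n.+1 - fy n) + (fy n - fy m) by module.
  have -> : s n.+1 - s m = (s n.+1 - s n) + (s n - s m) by ring.
  by rewrite (le_trans (nrmD _ _)) // lerD // ih.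
have s1 n : s n <= 1 by case/andP: (s01 n).
have [y hy] := limit_of_majorant s1 mfy.
have ny d : 0 < d -> nrm y <= 1 + d.
  move=> d0; have [N /(_ _ (leqnn N)) hN] := hy d d0.
  have -> : y = fy N + (y - fy N) by module.
  by rewrite (le_trans (nrmD _ _)) // lerD ?(ltW hN) // (le_trans (nfy N)).
have ny1 : nrm y <= 1 by apply/ler_addgt0Pr.
exists y; split=> //.
- apply/eqP; rewrite -subr_eq0; apply/eqP/(@nrm_small_eq0 _ 2) => d d0.
  have [N /(_ _ (leqnn N)) hN] := hy d d0.
  have -> : star y - y = star (y - fy N) - (y - fy N).
    by rewrite starB sfy; module.
  by rewrite (le_trans (nrmB _ _)) // nrm_star mulrDr mulr1 ltW // ltrD.
(* The 4 is 2 for the doubled term, plus the bounds 1 on [y] and on [fy N]. *)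
- apply/eqP; rewrite -subr_eq0; apply/eqP/(@nrm_small_eq0 _ 4) => d d0.
  have [N hN] := hy d d0.
  have -> : y *+ 2 - (k + y ** y) = (y - fy N.+1) *+ 2 -
      (y ** (y - fy N) + (y - fy N) ** fy N).
    have E : fy N.+1 *+ 2 = k + fy N ** fy N.
      by rewrite half_scaleK.
    by rewrite mulrnBl E smulBl smulBr; module.
  have h0 := ltW (hN N (leqnn N)); have h1 := ltW (hN N.+1 (leqnSn N)).
  have a0 := nrm_ge0 y; have a1 := nrm_ge0 (y - fy N).
  have a2 := nrm_ge0 (fy N); have a3 := nfy N; have a4 := s1 N.
  have b1 := nrmB ((y - fy N.+1) *+ 2) (y ** (y - fy N) + (y - fy N) ** fy N).
  have b2 := nrmD (y ** (y - fy N)) ((y - fy N) ** fy N).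
  have b3 := nrmM y (y - fy N); have b4 := nrmM (y - fy N) (fy N).
  have b5 := nrmD (y - fy N.+1) (y - fy N.+1).
  rewrite -mulr2n in b5; nra.
- move=> z zk; apply/eqP; rewrite -subr_eq0.
  apply/eqP/(@nrm_small_eq0 _ (nrm z *+ 2)) => d d0.
  have [N /(_ _ (leqnn N)) hN] := hy d d0.
  have -> : z ** y - y ** z = z ** (y - fy N) - (y - fy N) ** z.
    by rewrite smulBl smulBr (cfy _ _ zk); module.
  have h0 := ltW hN.
  have b1 := nrmB (z ** (y - fy N)) ((y - fy N) ** z).
  have b3 := nrmM z (y - fy N); have b4 := nrmM (y - fy N) z.
  have a0 := nrm_ge0 z; rewrite mulrnAr mulr2n; nra.
Qed.

(** Positivity without spectra: for self-adjoint [h] the estimate confines the spectrum to the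
    interval from 0 to [2 t]. In this form sums are handled by the triangle inequality. *)
Definition pos h := star h = h /\ exists2 t, 0 <= t & nrm (t%:C *: e - h) <= t.

Lemma pos_radius h : pos h -> exists2 t, 0 < t & nrm (t%:C *: e - h) <= t.
Proof.
case=> _ [t t0 ht]; exists (t + 1); first by rewrite ltr_wpDl.
have -> : (t + 1)%:C *: e - h = (t%:C *: e - h) + e by rewrite rmorphD rmorph1; module.
by rewrite (le_trans (nrmD _ _)) // lerD // nrm_unit_le1.
Qed.

Lemma posD a b : pos a -> pos b -> pos (a + b).
Proof.
move=> [sa [t t0 ta]] [sb [r r0 rb]]; split; first by rewrite starD sa sb.
exists (t + r); first exact: addr_ge0.
have -> : (t + r)%:C *: e - (a + b) = (t%:C *: e - a) + (r%:C *: e - b).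
  by rewrite rmorphD; module.
by rewrite (le_trans (nrmD _ _)) // lerD.
Qed.

Lemma posZ r a : 0 <= r -> pos a -> pos (r%:C *: a).
Proof.
move=> r0 [sa [t t0 ta]]; split; first by rewrite star_conjR sa.
exists (r * t); first exact: mulr_ge0.
have -> : (r * t)%:C *: e - r%:C *: a = r%:C *: (t%:C *: e - a).
  by rewrite rmorphM; module.
by rewrite nrm_scale ger0_norm // ler_wpM2l.
Qed.

(** Rescaling writes [h] as [t (e - k)] with [k] of norm at most 1, and [e - y] is a root of
    [e - k]. That the root commutes with the commutant of [h] is what makes roots of commuting
    elements commute later. *)
Lemma pos_sqrt h : pos h -> exists s, [/\ pos s, s ** s = h
  & forall z, z ** h = h ** z -> z ** s = s ** z].
Proof.
move=> ph; have [sh _] := ph; have [t t0 ht] := pos_radius ph.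
pose k := e - t^-1%:C *: h.
have tV : t%:C * t^-1%:C = 1 by rewrite -rmorphM divff ?gt_eqF // rmorph1.
have tk : t%:C *: k = t%:C *: e - h by rewrite scalerBr scalerA tV scale1r.
have sk : star k = k by rewrite starB star_conjR sh star_e.
have k1 : nrm k <= 1.
  by rewrite -(ler_pM2l t0) mulr1 -{1}(gtr0_norm t0) -nrm_scale tk.
have [y [sy y1 yk yc]] := sqrt_fixpoint sk k1.
exists ((Num.sqrt t)%:C *: (e - y)); split.
- split; first by rewrite star_conjR starB star_e sy.
  exists (Num.sqrt t); first exact: sqrtr_ge0.
  rewrite scalerBr opprB addrC subrK nrm_scale ger0_norm ?sqrtr_ge0 //.
  by rewrite ler_piMr ?sqrtr_ge0.
- rewrite smulZl smulZr scalerA -rmorphM -expr2 sqr_sqrtr ?ltW //.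
  rewrite smulBl !smulBr !smul1e smule1.
  have -> : e - y - (y - y ** y) = e - (y *+ 2 - y ** y) by module.
  by rewrite yk addrK scalerBr tk opprB addrC subrK.
- move=> z zh; rewrite smulZl smulZr smulBl smulBr smul1e smule1 yc //.
  by rewrite smulBl smulBr smulZl smulZr smul1e smule1 zh.
Qed.

(** With [s] a root of [e - h ** h] commuting with [h], the element [u = h + i s] satisfies
    [star u ** u = e]; being the imaginary part of [u], [s] has norm at most 1. *)
Lemma nrm_unit_subsqr_le1 h : star h = h -> nrm h <= 1 -> nrm (e - h ** h) <= 1.
Proof.
move=> sh h1; have shh : star (h ** h) = h ** h by rewrite starM sh.
have hh1 : nrm (h ** h) <= 1 by rewrite (le_trans (nrmM _ _)) // mulr_ile1 ?nrm_ge0.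
have [y [sy y1 yk yc]] := sqrt_fixpoint shh hh1.
pose s := e - y; have ss : star s = s by rewrite starB star_e sy.
have hs : h ** s = s ** h.
  by rewrite smulBl smulBr smul1e smule1 yc // smulA.
have s2 : s ** s = e - h ** h.
  rewrite smulBl !smulBr !smul1e smule1.
  have -> : e - y - (y - y ** y) = e - (y *+ 2 - y ** y) by module.
  by rewrite yk addrK.
pose u := h + 'i *: s.
have su : star u = h - 'i *: s by rewrite starD starZ conjCi sh ss scaleNr.
have uu : star u ** u = e.
  rewrite su smulBl !smulDr !smulZl !smulZr hs scalerA -expr2 sqrCi s2.
  by module.
have u1 : nrm u <= 1.
  by rewrite -(@ler_pXn2r _ 2%N) ?nnegrE ?nrm_ge0 // expr1n -nrm_cstar uu nrm_unit_le1.
rewrite -s2 -{1}ss nrm_cstar -[leRHS](expr1n _ 2%N) ler_pXn2r ?nnegrE ?nrm_ge0 //.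
rewrite -[s]half_scaleK scalerMnr nrm_scale ger0_norm ?invr_ge0 // -(nrm_imag _).
have -> : 'i *: (s *+ 2) = u - star u by rewrite su; module.
by have := nrmB u (star u); rewrite nrm_star; lra.
Qed.

Lemma pos_sqr h : star h = h -> pos (h ** h).
Proof.
move=> sh; split; first by rewrite starM sh.
pose c := nrm h + 1; have c0 : 0 < c by rewrite ltr_wpDl ?nrm_ge0.
have cV : c%:C * c^-1%:C = 1 by rewrite -rmorphM divff ?gt_eqF // rmorph1.
have [] : star (c^-1%:C *: h) = c^-1%:C *: h /\ nrm (c^-1%:C *: h) <= 1.
  split; first by rewrite star_conjR sh.
  rewrite nrm_scale gtr0_norm ?invr_gt0 // mulrC ler_pdivrMr // mul1r.
  by rewrite lerDl.
move=> /nrm_unit_subsqr_le1 /[apply].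
set g := _ - _ => g1; exists (c ^+ 2); first exact: sqr_ge0.
have -> : (c ^+ 2)%:C *: e - h ** h = (c ^+ 2)%:C *: g.
  rewrite /g smulZl smulZr scalerBr !scalerA.
  by rewrite expr2 rmorphM mulrACA cV mulr1 scale1r.
by rewrite nrm_scale ger0_norm ?sqr_ge0 // ler_piMr ?sqr_ge0.
Qed.

(** If [s] and [r] are commuting roots of [a] and [t e - a], then [u = s + i r] has
    [star u ** u = t e], and [s] is the real part of [u]. *)
Lemma nrm_le_of_pos a t : 0 <= t -> pos a -> pos (t%:C *: e - a) -> nrm a <= t.
Proof.
move=> t0 /pos_sqrt[s [[ss _] s2 sc]] /pos_sqrt[r [[sr _] r2 rc]].
have sr_comm : s ** r = r ** s.
  apply: rc; rewrite smulBl smulBr smulZl smulZr smul1e smule1.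
  by rewrite -s2 smulA.
pose u := s + 'i *: r.
have su : star u = s - 'i *: r by rewrite starD starZ conjCi ss sr scaleNr.
have uu : star u ** u = t%:C *: e.
  rewrite su smulBl !smulDr !smulZl !smulZr sr_comm scalerA -expr2 sqrCi r2 s2.
  by module.
have u1 : nrm u ^+ 2 <= t.
  rewrite -nrm_cstar uu nrm_scale ger0_norm // ler_piMr //.
  exact: nrm_unit_le1.
rewrite -s2 -{1}ss nrm_cstar (le_trans _ u1) //.
rewrite ler_pXn2r ?nnegrE ?nrm_ge0 //.
rewrite -[s]half_scaleK scalerMnr nrm_scale ger0_norm ?invr_ge0 //.
have -> : s *+ 2 = u + star u by rewrite su; module.
by have := nrmD u (star u); rewrite nrm_star; lra.
Qed.

Lemma pos_antisym a : pos a -> pos (- a) -> a = 0.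
Proof.
move=> pa pNa; apply/eqP; rewrite -nrm_eq0 eq_le nrm_ge0 andbT.
by apply: nrm_le_of_pos => //; rewrite scale0r add0r.
Qed.

Definition spow x n := iter n (smul x) e.

Lemma spowS x n : spow x n.+1 = x ** spow x n. Proof. by []. Qed.

Lemma spowD x m n : spow x (m + n) = spow x m ** spow x n.
Proof.
by elim: m => [|m ih]; [rewrite smul1e | rewrite addSn !spowS ih smulA].
Qed.

Lemma spow_star x n : star x = x -> star (spow x n) = spow x n.
Proof.
move=> sx; elim: n => [|n ih]; first exact: star_e.
by rewrite -[in RHS]addn1 spowD !spowS starM ih sx smule1.
Qed.

Lemma nrm_spow2 x k : star x = x -> nrm (spow x (2 ^ k)) = nrm x ^+ (2 ^ k).
Proof.
move=> sx; elim: k => [|k ih]; first by rewrite /= smule1.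
rewrite expnS mul2n -addnn spowD exprD -ih -expr2 -nrm_cstar.
by rewrite spow_star.
Qed.

(** Stands in for the spectral radius formula: at exponents [2 ^ k] the C*-identity makes the norm
    of the power exact, so a norm above [t] would force exponential growth against a linear
    factor. *)
Lemma nrm_le_of_growth x t C : star x = x -> 0 < t ->
  (forall n, nrm (spow x n) <= C * n.+1%:R * t ^+ n) -> nrm x <= t.
Proof.
move=> sx t0 growth; rewrite leNgt; apply/negP => tx.
pose d := nrm x / t - 1.
have d0 : 0 < d by rewrite subr_gt0 ltr_pdivlMr // mul1r.
have xE : nrm x = t * (1 + d) by rewrite /d addrCA subrr addr0 mulrCA divff ?mulr1 // gt_eqF.
have bernoulli n : 1 + n%:R * d <= (1 + d) ^+ n.
  elim: n => [|n ih]; first by rewrite mul0r addr0 expr0.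
  have nd : 0 <= n%:R * d * d by rewrite !mulr_ge0 // ltW.
  rewrite exprS; apply: (le_trans _ (ler_wpM2l _ ih)); last by lra.
  by rewrite -[n.+1%:R]natr1; nra.
(* Squaring Bernoulli's inequality at exponent [n] gives a quadratic lower bound at exponent [2 n],
   to be compared with the factor [2 n + 1 <= 3 n]. *)
have bound k : (2 ^ k)%:R * d ^+ 2 <= 3 * C.
  set n := (2 ^ k)%N.
  have n1 : 1 <= n%:R :> R by rewrite ler1n expn_gt0.
  have := growth (2 ^ k.+1)%N; rewrite nrm_spow2 // xE exprMn mulrC.
  rewrite ler_pM2r ?exprn_gt0 // expnS -/n mulnC exprM -natr1 natrM.
  have /= := bernoulli n => b1 b2.
  have nd : 0 <= n%:R * d by rewrite mulr_ge0 // ltW.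
  have b3 : (n%:R * d) ^+ 2 <= ((1 + d) ^+ n) ^+ 2.
    by rewrite ler_pXn2r ?nnegrE ?exprn_ge0 // ?(le_trans _ b1) //; lra.
  have C0 : 0 <= C.
    by have := growth 0%N; rewrite expr0 !mulr1; apply: le_trans; exact: nrm_ge0.
  have : n%:R * (n%:R * d ^+ 2) <= n%:R * (3 * C) by nra.
  by rewrite ler_pM2l // (lt_le_trans ltr01).
have C0 : 0 <= 3 * C by apply: le_trans (bound 0%N); rewrite mul1r sqr_ge0.
have := bound (Num.truncn (3 * C / d ^+ 2)).+1; apply/negP; rewrite -ltNge.
rewrite -ltr_pdivrMr ?exprn_gt0 //.
apply: lt_trans (truncnS_gt _) _; rewrite ltr_nat; exact: ltn_expl.
Qed.

(* The intertwining relation turns the powers of [t e - c] into those of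
   [t e - b], so they grow at most linearly faster than [t ^ n]. *)
Lemma pos_intertwine b c u v :
  star c = c -> c = u ** v -> v ** c = b ** v -> pos b -> pos c.
Proof.
move=> sc cuv vc /pos_radius[t t0 tb]; split=> //; exists t; first exact: ltW.
pose g := t%:C *: e - c; pose g' := t%:C *: e - b.
have vg n : v ** spow g n = spow g' n ** v.
  elim: n => [|n ih]; first by rewrite /= smul1e smule1.
  rewrite !spowS smulA.
  have -> : v ** g = g' ** v.
    by rewrite smulBl smulBr smulZl smulZr smul1e smule1 vc.
  by rewrite -smulA ih smulA.
have g'n n : nrm (spow g' n) <= t ^+ n.
  elim: n => [|n ih]; first exact: nrm_unit_le1.
  rewrite spowS exprS (le_trans (nrmM _ _)) //.
  by rewrite ler_pM ?nrm_ge0.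
pose K := nrm u * nrm v; have K0 : 0 <= K by rewrite mulr_ge0 ?nrm_ge0.
have gn n : t * nrm (spow g n) <= (t + n%:R * K) * t ^+ n.
  elim: n => [|n ih].
    by rewrite mul0r addr0 expr0 ler_pM2l // nrm_unit_le1.
  have -> : spow g n.+1 = t%:C *: spow g n - u ** (spow g' n ** v).
    rewrite spowS -vg smulBl smulZl smul1e.
    by rewrite cuv smulA.
  have h1 : nrm (u ** (spow g' n ** v)) <= K * t ^+ n.
    rewrite (le_trans (nrmM _ _)) // /K -mulrA ler_wpM2l ?nrm_ge0 //.
    rewrite (le_trans (nrmM _ _)) // mulrC ler_wpM2l ?nrm_ge0 //.
  have h2 := nrmB (t%:C *: spow g n) (u ** (spow g' n ** v)).
  rewrite nrm_scale gtr0_norm // in h2.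
  have tn : 0 <= t ^+ n by rewrite exprn_ge0 // ltW.
  rewrite exprS -[n.+1%:R]natr1; nra.
apply: (@nrm_le_of_growth _ _ (1 + K / t)) => //.
  by rewrite /g starB star_conjR star_e sc.
move=> n; rewrite -(ler_pM2l t0) (le_trans (gn n)) //.
have -> : t * ((1 + K / t) * n.+1%:R * t ^+ n) = (t + K) * n.+1%:R * t ^+ n.
  by field; rewrite gt_eqF.
rewrite ler_wpM2r ?exprn_ge0 ?(ltW t0) // -[n.+1%:R]natr1.
have -> : (t + K) * (n%:R + 1) = (t + n%:R * K) + (t * n%:R + K) by ring.
by rewrite lerDl addr_ge0 // mulr_ge0 // ltW.
Qed.

(* Kaplansky's trick: with [a = y^* y] and [c = |a| - a], the element
   [z = y c] satisfies [z^* z <= 0]; as [z z^* + z^* z >= 0], also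
   [z z^* >= 0], whence [z^* z >= 0] and [z = 0]. *)
Theorem pos_star_mul y : pos (star y ** y).
Proof.
set a := star y ** y; have sa : star a = a by rewrite starM starK.
have [b [pb b2 bc]] := pos_sqrt (pos_sqr sa); have [sb _] := pb.
have ab : a ** b = b ** a by apply: bc; rewrite smulA.
pose c := b - a; have sc : star c = c by rewrite starB sb sa.
have c2 : c ** c = (b *+ 2) ** c.
  by rewrite /c mulr2n (smulDl b b) !smulBl !smulBr b2 ab; module.
have pc : pos c.
  by apply: (@pos_intertwine _ _ e c sc _ c2); rewrite ?smul1e // mulr2n; apply: posD.
have bcN : a ** c = - (b ** c) by rewrite /c !smulBr b2 ab; module.
have [r [[sr _] r2 rc]] := pos_sqrt pb.
have cb : c ** b = b ** c by rewrite /c smulBl smulBr ab.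
have cr : c ** r = r ** c by exact: rc.
pose z := y ** c.
have zz : star z ** z = - ((r ** c) ** (r ** c)).
  rewrite starM sc -smulA (smulA (star y)) -/a bcN smulNr; congr (- _).
  by rewrite (smulA c) cb -r2 !smulA -(smulA r c r) cr !smulA.
have s_rc : star (r ** c) = r ** c by rewrite starM sr sc.
have pNzz : pos (- (star z ** z)) by rewrite zz opprK; apply: pos_sqr.
have pzz' : pos (z ** star z).
  pose p := z + star z; pose q := 'i *: (z - star z).
  have sp : star p = p by rewrite starD starK addrC.
  have sq : star q = q by rewrite starZ conjCi starB starK scaleNr -scalerN opprB.
  have half0 : 0 <= 2^-1 :> R by rewrite invr_ge0.
  have /(posZ half0) : pos (p ** p + q ** q + (- (star z ** z)) *+ 2).
    by rewrite mulr2n; do !apply: posD => //; apply: pos_sqr.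
  suff -> : p ** p + q ** q + (- (star z ** z)) *+ 2 = (z ** star z) *+ 2.
    by rewrite -scalerMnr half_scaleK.
  rewrite /p /q smulZl smulZr scalerA -expr2 sqrCi.
  by rewrite !(smulDl, smulDr, smulNl, smulNr); module.
(* Multiplication by [z] intertwines [star z ** z] with [z ** star z]; this replaces the equality of
   their nonzero spectra. *)
have pzz : pos (star z ** z).
  apply: (@pos_intertwine (z ** star z) _ (star z) z) => //.
    by rewrite starM starK.
  by rewrite smulA.
have z0 : star z ** z = 0 by apply: pos_antisym.
have rc0 : r ** c = 0.
  apply/eqP; rewrite -nrm_eq0 -sqrf_eq0 -nrm_cstar s_rc.
  by rewrite -[_ ** _]opprK -zz z0 oppr0 nrm0.
have c0 : c = 0.
  apply/eqP; rewrite -nrm_eq0 -sqrf_eq0 -nrm_cstar sc c2.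
  by rewrite mulr2n smulDl -r2 -smulA rc0 smul0r addr0 nrm0.
by rewrite -(subrK a b) -/c c0 add0r in pb.
Qed.

Lemma pos_nrm_sub h : star h = h -> pos ((nrm h)%:C *: e - h).
Proof.
move=> sh; split; first by rewrite starB star_conjR star_e sh.
by exists (nrm h); rewrite ?nrm_ge0 // opprB addrC subrK.
Qed.

End WithUnit.
End CStarPositivity.

(** * Extension of functionals and states *)

Section HahnBanach.
Variables (R : realType) (V : lmodType R) (p : V -> R).
Hypotheses (pD : forall x y, p (x + y) <= p x + p y)
           (pZ : forall r x, 0 <= r -> p (r *: x) <= r * p x).
Implicit Types (G : set (V * R)) (x y v : V) (a b c r t : R).

(** Partial functionals are kept as graphs, so that the union of a chain is again one without
    choosing values; the sublinear bound makes such a relation single-valued. *)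
Definition linear_graph G := forall x y a b r,
  G (x, a) -> G (y, b) -> G (r *: x + y, r * a + b).

Definition dominated_graph G := forall x a, G (x, a) -> a <= p x.

Let p0 : p 0 <= 0.
Proof. by have := pZ 0 (lexx 0); rewrite scale0r mul0r. Qed.

Let pZ_ge r x : 0 < r -> r * p x <= p (r *: x).
Proof.
move=> r0; rewrite -ler_pdivlMl //.
apply: le_trans (pZ _ _); last by rewrite invr_ge0 ltW.
by rewrite scalerA mulVf ?gt_eqF // scale1r.
Qed.

Lemma dominated_graph_fun G x a b : linear_graph G -> dominated_graph G ->
  G (x, a) -> G (x, b) -> a = b.
Proof.
move=> lG dG Ga Gb; apply/eqP; rewrite eq_le.
have le u w : G (x, u) -> G (x, w) -> u <= w.
  move=> Gu Gw; have := dG _ _ (lG _ _ _ _ (-1) Gw Gu).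
  by rewrite scaleN1r addNr mulN1r => /le_trans /(_ p0); rewrite addrC subr_le0.
by rewrite !le.
Qed.

Lemma graph_scale G x a r : linear_graph G -> G (x, a) -> G (r *: x, r * a).
Proof.
move=> lG Ga; have G0 : G (0, 0).
  by have := lG _ _ _ _ (-1) Ga Ga; rewrite scaleN1r addNr mulN1r addNr.
by have := lG _ _ _ _ r Ga G0; rewrite !addr0.
Qed.

(** The value [c] at [v] must lie above all [a - p (x - v)] and below all [p (x + v) - a].
    Subadditivity separates the two families, so the supremum of the first works; general [t]
    follows by scaling. *)
Lemma extend_graph G v x0 a0 : linear_graph G -> dominated_graph G ->
  G (x0, a0) -> exists c, let G' := [set u | exists x a t,
      [/\ G (x, a), u.1 = x + t *: v & u.2 = a + t * c]] in
  linear_graph G' /\ dominated_graph G'.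
Proof.
move=> lG dG G0.
pose S := [set s | exists x a, G (x, a) /\ s = a - p (x - v)].
have sep x a y b : G (x, a) -> G (y, b) -> a - p (x - v) <= p (y + v) - b.
  move=> Ga Gb; rewrite lerBrDr addrAC lerBlDr.
  have /dG := lG _ _ _ _ 1 Ga Gb; rewrite scale1r mul1r => /le_trans; apply.
  by have := pD (y + v) (x - v); rewrite addrACA subrr addr0 (addrC y).
have S_sup : has_sup S.
  split; first by exists (a0 - p (x0 - v)), x0, a0.
  by exists (p (x0 + v) - a0) => _ [x [a [Ga ->]]]; apply: sep.
exists (sup S) => G'; split.
  move=> x y a b r [x1 [a1 [t [G1 /= -> ->]]]] [x2 [a2 [s [G2 /= -> ->]]]].
  exists (r *: x1 + x2), (r * a1 + a2), (r * t + s); split=> /=.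
  - exact: lG.
  - by rewrite scalerDr scalerA scalerDl addrACA.
  - by ring.
move=> _ _ [x [a [t [Ga /= -> ->]]]].
have [t0|t0|->] := ltgtP t 0; last by rewrite scale0r mul0r !addr0 dG.
- have s0 : 0 < - t by rewrite oppr_gt0.
  have : (- t)^-1 * a - p ((- t)^-1 *: x - v) <= sup S.
    apply: sup_upper_bound => //.
    by exists ((- t)^-1 *: x), ((- t)^-1 * a); split=> //; apply: graph_scale.
  rewrite lerBlDr -lerBlDl -(ler_pM2l s0) mulrBr mulVKf ?gt_eqF //.
  rewrite mulNr opprK => h; apply: (le_trans h).
  have {2}-> : x = (- t) *: ((- t)^-1 *: x - v) - t *: v.
    by rewrite scalerBr scalerA divff ?gt_eqF // scale1r scaleNr opprK addrK.
  by rewrite subrK pZ_ge.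
- have : sup S <= p (t^-1 *: x + v) - t^-1 * a.
    apply: ge_sup; first by case: S_sup.
    move=> _ [y [b [Gb ->]]]; apply: sep => //; exact: graph_scale.
  rewrite lerBrDr -(ler_pM2l t0) mulrDr mulVKf ?gt_eqF // addrC => h.
  apply: (le_trans h).
  have {2}-> : x = t *: (t^-1 *: x + v) - t *: v.
    by rewrite scalerDr scalerA divff ?gt_eqF // scale1r addrK.
  by rewrite subrK pZ_ge.
Qed.

Theorem hahn_banach G0 : linear_graph G0 -> dominated_graph G0 -> G0 !=set0 ->
  exists f : V -> R, [/\ scalar f, forall x, f x <= p x
    & forall x a, G0 (x, a) -> f x = a].
Proof.
move=> lG0 dG0 [[x0 a0] G00].
(* Adjoining [G0] to [X] makes the condition hold for the union of the empty chain too, as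
   [Zorn_bigcup] requires. *)
pose good X := linear_graph (G0 `|` X) /\ dominated_graph (G0 `|` X).
have [|A [[lA dA] Amax]] := @Zorn_bigcup _ good.
  move=> F Fgood Ftot; split; last first.
    move=> x a [/dG0 //|[X FX Xxa]].
    by apply: (proj2 (Fgood X FX)); right.
  move=> x y a b r [Gx|[X FX Xx]] [Gy|[Y FY Yy]].
  - by left; apply: lG0.
  - case: (proj1 (Fgood Y FY) x y a b r (or_introl Gx) (or_intror Yy)) => l.
      by left.
    by right; exists Y.
  - case: (proj1 (Fgood X FX) x y a b r (or_intror Xx) (or_introl Gy)) => l.
      by left.
    by right; exists X.
  - have [Z [FZ Zx Zy]] : exists Z, [/\ F Z, Z (x, a) & Z (y, b)].
      have [XY|YX] := Ftot _ _ FX FY; first by exists Y; split=> //; apply: XY.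
      by exists X; split=> //; apply: YX.
    case: (proj1 (Fgood Z FZ) x y a b r (or_intror Zx) (or_intror Zy)) => l.
      by left.
    by right; exists Z.
set G := G0 `|` A in lA dA.
have Gx0 : G (x0, a0) by left.
have tot v : exists a, G (v, a).
  apply: contrapT => nG; have [c [lG' dG']] := extend_graph v lA dA Gx0.
  set G' := [set u | _] in lG' dG'.
  have GG' : G `<=` G'.
    by move=> [x a] Ga; exists x, a, 0; rewrite /= scale0r mul0r !addr0.
  have AG' : A `<=` G' by move=> u Au; apply: GG'; right.
  apply: (Amax G').
    split=> // G'A; apply: nG; exists c; right; apply: G'A.
    exists 0, 0, 1; rewrite /= scale1r mul1r !add0r; split=> //.
    by have := graph_scale 0 lA Gx0; rewrite scale0r mul0r.
  have G0G' : G0 `|` G' = G'.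
    by apply/seteqP; split=> [u [G0u|//]|u G'u]; [apply: GG'; left|right].
  by rewrite /good G0G'.
have [f fG] := choice tot.
exists f; split.
- move=> r x y; apply: (dominated_graph_fun lA dA (fG _)); exact: lA.
- by move=> x; apply: dA.
- by move=> x a G0x; apply: (dominated_graph_fun lA dA (fG x)); left.
Qed.

End HahnBanach.

Section Realification.
Variables (R : realType) (V : lmodType R[i]).

Definition realification : Type := V.
HB.instance Definition _ := GRing.Zmodule.on realification.

Let scale (r : R) (v : realification) : realification := (r%:C)%C *: (v : V).

Fact realification_scaleA r s v : scale r (scale s v) = scale (r * s) v.
Proof. by rewrite /scale scalerA rmorphM. Qed.
Fact realification_scale1 : left_id 1 scale.
Proof. by move=> v; rewrite /scale rmorph1 scale1r. Qed.
Fact realification_scaleDr : right_distributive scale +%R.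
Proof. by move=> r u v; apply: scalerDr. Qed.
Fact realification_scaleDl v : {morph scale^~ v : r s / r + s}.
Proof. by move=> r s; rewrite /scale rmorphD scalerDl. Qed.
HB.instance Definition _ := GRing.Zmodule_isLmodule.Build R realification
  realification_scaleA realification_scale1 realification_scaleDr
  realification_scaleDl.
End Realification.

Section States.
Variables (R : realType) (P : cstarAlgType R) (e : P).
Hypotheses (smul1e : left_id e (smul : P -> P -> P))
           (smule1 : right_id e (smul : P -> P -> P)).
Local Notation "r '%:C'" := (real_complex R r).
Local Notation pos := (pos e).

Lemma nrm_unit : e != 0 -> nrm e = 1.
Proof.
move=> e0; have := nrm_cstar e; rewrite (star_unit smul1e) smul1e => /eqP.
rewrite -[X in X == _]mulr1 expr2 -subr_eq0 -mulrBr mulf_eq0 nrm_eq0 (negPf e0).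
by rewrite subr_eq0 => /eqP <-.
Qed.

(** Hahn-Banach is applied on the real span of [e] and [h = star x ** x], where [a e + b h] is sent
    to [a + b t]. The point is domination by the norm, and only [b > 0] uses positivity of [h]. *)
Lemma norming_functional x : x != 0 -> exists f : realification P -> R,
  [/\ scalar f, forall y : P, f y <= nrm y, f e = 1
    & f (star x ** x) = nrm x ^+ 2].
Proof.
move=> x0; set h := star x ** x; set t := nrm x ^+ 2.
have t0 : 0 < t by rewrite exprn_gt0 // lt_def nrm_eq0 x0 nrm_ge0.
have th : nrm h = t by rewrite nrm_cstar.
have sh : star h = h by rewrite starM starK.
have ph : pos h by exact: pos_star_mul.
have e0 : e != 0.
  by apply: contraNneq x0 => e0; rewrite -(smul1e x) e0 smul0l.
have pe : pos e by rewrite -[X in pos X]smul1e; apply: pos_sqr => //;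
  exact: star_unit smul1e.
pose G := [set u : realification P * R | exists a b : R,
  u.1 = a%:C *: e + b%:C *: h /\ u.2 = a + b * t].
have lG : linear_graph G.
  move=> y z _ _ r [a [b [/= -> ->]]] [c [d [/= -> ->]]].
  exists (r * a + c), (r * b + d); split=> /=; last by ring.
  rewrite -[r *: _]/(r%:C *: (a%:C *: e + b%:C *: h)).
  by rewrite !(rmorphD, rmorphM); module.
have dG : @dominated_graph R (realification P) (@nrm R P) G.
  move=> _ _ [a [b [/= -> ->]]]; set y : P := (X in nrm X).
  have ne r : nrm (r%:C *: e) = `|r| by rewrite nrm_scale nrm_unit ?mulr1.
  have sy : star y = y.
    by rewrite starD !star_conjR sh (star_unit smul1e).
  have [b0|b0|b0] := ltgtP b 0; last first.
  - by rewrite /y b0 rmorph0 scale0r mul0r !addr0 ne ler_norm.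
  (* If the norm of [y] were below [a + b t], then [h] would be dominated by [r' e] with [r' < t],
     against the norm [t] of [h]. *)
  - rewrite leNgt; apply/negP => lt_nrm.
    pose r := (nrm y - a) / b; pose r' := Num.max r 0.
    have : pos (r'%:C *: e - h).
      have -> : r'%:C *: e - h =
          (r' - r)%:C *: e + b^-1%:C *: ((nrm y)%:C *: e - y).
        have bV : b^-1%:C *: (b%:C *: h) = h.
          by rewrite scalerA -rmorphM mulVf ?gt_eqF // rmorph1 scale1r.
        rewrite /y opprD addrA scalerBr bV -scalerBl -rmorphB scalerA -rmorphM.
        by rewrite mulrC -/r rmorphB; module.
      apply: posD; first by apply: posZ => //; rewrite subr_ge0 le_max lexx.
      apply: posZ; first by rewrite invr_ge0 ltW.
      exact: pos_nrm_sub.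
    move/(nrm_le_of_pos smul1e smule1 _ ph); rewrite le_max lexx orbT => /(_ isT).
    rewrite th le_max [t <= 0]leNgt t0 orbF ler_pdivlMr //.
    by rewrite lerBrDl mulrC leNgt lt_nrm.
  - have [a0|a0] := leP 0 a.
      rewrite -{1}(ger0_norm a0) -ne.
      have -> : a%:C *: e = y - b%:C *: h by rewrite /y addrK.
      rewrite -lerBrDr (le_trans (nrmB _ _)) // nrm_scale th ltr0_norm //.
      by rewrite mulNr.
    rewrite (le_trans _ (nrm_ge0 _)) //.
    have bt : b * t < 0 by rewrite nmulr_rlt0.
    by lra.
have pZ r (y : realification P) : 0 <= r -> @nrm R P (r *: y) <= r * @nrm R P y.
  by move=> r0; rewrite nrm_scale ger0_norm.
have G0 : G !=set0.
  by exists (0, 0), 0, 0; split; rewrite /= ?rmorph0 ?scale0r ?mul0r addr0.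
have [f [lf df Gf]] := @hahn_banach R (realification P) _ (@nrmD R P) pZ G lG dG G0.
exists f; split=> //; apply: Gf.
  exists 1, 0; split; rewrite /= ?mul0r ?addr0 //.
  by rewrite rmorph1 rmorph0 scale1r scale0r addr0.
exists 0, 1; split; rewrite /= ?mul1r ?add0r //.
by rewrite rmorph1 rmorph0 scale1r scale0r add0r.
Qed.

Theorem exists_norming_state x : x != 0 -> exists F : P -> R[i],
  [/\ scalar F, forall y, 0 <= F (star y ** y), F e = 1
    & F (star x ** x) = (nrm x ^+ 2)%:C].
Proof.
move=> /norming_functional[f [lf df fe fx]].
(* Functionals bounded by the norm with value 1 at [e] are positive:
   [t - f y = f (t e - y) <= t]. *)
have fpos (y : P) : pos y -> 0 <= f y.
  move=> [_ [t _ ht]]; have := le_trans (df _) ht.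
  have -> : t%:C *: e - y = (-1 : R) *: (y : realification P) + t *: (e : realification P).
    by rewrite addrC scaleN1r.
  rewrite lf -[t *: _]addr0 lf fe.
  have := lf 1 0 0; rewrite scaler0 addr0; lra.
(* [F y] will be [f] of the real part of [y] plus [i] times [f] of its imaginary part
   [- i (y - star y) / 2], so [F] is real on self-adjoint elements by construction. *)
pose A (y : P) := f (y + star y).
pose B (y : P) := f (- ('i *: (y - star y))).
have fZD r (y z : P) : f (r%:C *: y + z) = r * f y + f z by exact: lf.
have f0 : f (0 : P) = 0.
  have := fZD 0 0 0; rewrite mul0r add0r rmorph0 scale0r addr0.
  by have := fZD (-1) 0 0; rewrite scaler0 addr0; lra.
have fZ r (y : P) : f (r%:C *: y) = r * f y.
  by have := fZD r y 0; rewrite f0 !addr0.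
have kE (k : R[i]) : k = (complex.Re k)%:C + 'i * (complex.Im k)%:C.
  by rewrite {1}(complexE k) complexiE.
have kJ (k : R[i]) : k^* = (complex.Re k)%:C - 'i * (complex.Im k)%:C.
  rewrite {1}(kE k) rmorphD rmorphM /= conjCi mulNr.
  by congr (_ - _ * _); apply: conj_Creal; apply/complex_realP; eexists.
have ii : 'i * 'i = -1 :> R[i] by rewrite -expr2 sqrCi.
have lAB (k : R[i]) y z : A (k *: y + z) = complex.Re k * A y - complex.Im k * B y + A z
    /\ B (k *: y + z) = complex.Im k * A y + complex.Re k * B y + B z.
  rewrite /A /B starD starZ; have := kE k; have := kJ k.
  set a := complex.Re k; set b := complex.Im k => -> ->; rewrite -(mulNr b) -!addrA -!fZD.
  split; congr (f _); first by apply: (@sqz_vec_inj R[i] P); rewrite !sqz_vecE; ring.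
  rewrite !(scalerDl, scalerDr, scalerN, scaleNr, scalerBl, scalerBr).
  rewrite !scalerA !mulrA ii.
  by apply: (@sqz_vec_inj R[i] P); rewrite !sqz_vecE; ring.
pose F y := ((2^-1 * A y)%:C + 'i * (2^-1 * B y)%:C).
have Fsa y : star y = y -> F y = (f y)%:C.
  move=> sy; rewrite /F /A /B sy subrr scaler0 oppr0.
  have -> : y + y = (2 : R)%:C *: y by rewrite rmorph_nat scaler_nat.
  by rewrite fZ mulKf ?pnatr_eq0 // f0 mulr0 rmorph0 mulr0 addr0.
exists F; split.
- move=> k y z; rewrite /F; have [-> ->] := lAB k y z.
  by rewrite [in RHS](kE k); ring: ii.
- by move=> y; rewrite Fsa ?starM ?starK // ler0c fpos //; apply: pos_star_mul.
- by rewrite Fsa ?fe // (star_unit smul1e).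
- by rewrite Fsa ?fx // starM starK.
Qed.
End States.

(** * Finite spans and Gram-Schmidt for semidefinite forms *)

Section LinearSpan.
Variables (K : fieldType) (V : lmodType K).
Implicit Types (s : seq V) (u v : V) (k : K).

(** Spans have to live in the possibly infinite-dimensional [P]; the recursion removes one
    coefficient at a time. *)
Fixpoint lspan s v : Prop :=
  if s is u :: s' then exists k, lspan s' (v - k *: u) else v = 0.

Lemma lspan_lin s k u v : lspan s u -> lspan s v -> lspan s (k *: u + v).
Proof.
elim: s u v => [|x s ih] u v /=; first by move=> -> ->; rewrite scaler0 addr0.
move=> [a ua] [b vb]; exists (k * a + b).
by have := ih _ _ ua vb; congr lspan; module.
Qed.

Lemma lspan0 s : lspan s 0.
Proof. by elim: s => [//|x s ih] /=; exists 0; rewrite scale0r subr0. Qed.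

Lemma lspanZ s k u : lspan s u -> lspan s (k *: u).
Proof. by move=> su; rewrite -[_ *: _]addr0; apply: lspan_lin => //; apply: lspan0. Qed.

Lemma lspanD s u v : lspan s u -> lspan s v -> lspan s (u + v).
Proof. by move=> su sv; rewrite -[u]scale1r; apply: lspan_lin. Qed.

Lemma lspanB s u v : lspan s u -> lspan s v -> lspan s (u - v).
Proof. by move=> su sv; rewrite addrC -scaleN1r; apply: lspan_lin. Qed.

Lemma lspan_sum s I (r : seq I) (Q : pred I) (F : I -> V) :
  (forall i, Q i -> lspan s (F i)) -> lspan s (\sum_(i <- r | Q i) F i).
Proof. by move=> sF; elim/big_rec: _ => [|i x /sF]; [exact: lspan0|exact: lspanD]. Qed.

Lemma lspan_cons s u v : lspan s v -> lspan (u :: s) v.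
Proof. by move=> sv; exists 0; rewrite scale0r subr0. Qed.

Lemma lspan_mem s u : u \in s -> lspan s u.
Proof.
elim: s => // x s ih; rewrite inE => /orP[/eqP->|us]; last exact/lspan_cons/ih.
by exists 1; rewrite scale1r subrr; apply: lspan0.
Qed.

Lemma lspan_ind s (Q : V -> Prop) :
  Q 0 -> (forall k u v, Q u -> Q v -> Q (k *: u + v)) ->
  {in s, forall u, Q u} -> forall v, lspan s v -> Q v.
Proof.
move=> Q0 QD; elim: s => [|x s ih] Qs v /=; first by move->.
move=> [k /ih Qv]; rewrite -(subrK (k *: x) v) addrC; apply: QD.
  by apply: Qs; rewrite mem_head.
by apply: Qv => u us; apply: Qs; rewrite inE us orbT.
Qed.

Lemma finite_dimensional_span : finite_dimensional V ->
  exists s, forall v, lspan s v.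
Proof.
move=> [n [b bV]]; exists [seq b i | i : 'I_n] => v.
have [c ->] := bV v; apply: lspan_sum => i _.
by apply/lspanZ/lspan_mem/map_f; rewrite mem_enum.
Qed.

End LinearSpan.

Section GramSchmidt.
Variables (K : numClosedFieldType) (V : lmodType K) (B : V -> V -> K).
Hypotheses (B_lin : forall u, scalar (B u))
           (B_herm : forall u v, B v u = (B u v)^*)
           (B_ge0 : forall u, 0 <= B u u).
Implicit Types (u v w : V) (k : K).

Let BD u v w : B u (v + w) = B u v + B u w.
Proof. by rewrite -[v]scale1r B_lin mul1r scale1r. Qed.
Let B0 u : B u 0 = 0.
Proof. by have := B_lin u (-1) 0 0; rewrite scaler0 addr0 mulN1r addNr. Qed.
Let BZ u k v : B u (k *: v) = k * B u v.
Proof. by rewrite -[_ *: _]addr0 B_lin B0 addr0. Qed.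
Let BN u v : B u (- v) = - B u v.
Proof. by rewrite -scaleN1r BZ mulN1r. Qed.
Let Bsum u I (r : seq I) (F : I -> V) :
  B u (\sum_(i <- r) F i) = \sum_(i <- r) B u (F i).
Proof. by elim/big_rec2: _ => [|i x y _ <-]; rewrite ?B0 ?BD. Qed.
Let BZl u k v : B (k *: u) v = k^* * B u v.
Proof. by rewrite B_herm BZ rmorphM /= -B_herm. Qed.
Let BDl u v w : B (v + w) u = B v u + B w u.
Proof. by rewrite B_herm BD rmorphD /= -!B_herm. Qed.

(** Degenerate case of Cauchy-Schwarz. With [c = B v u] nonzero, [s] is chosen so that [s] times the
    square of the modulus of [c] is [B v v + 1]; at [v] minus [s] times the conjugate of [c] times
    [u] the form is then [- B v v - 2], which is negative. *)
Lemma form_null u v : B u u = 0 -> B v u = 0.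
Proof.
move=> uu; apply/eqP/negP => /negP vu0; set c := B v u in vu0.
pose s := (B v v + 1) / `|c| ^+ 2.
have c0 : 0 < `|c| ^+ 2 by rewrite exprn_gt0 // normr_gt0.
have s_real : s^* = s.
  by apply/CrealP; rewrite realM ?realV ?realD ?ger0_real // ltW.
have cc : c * c^* = `|c| ^+ 2 by rewrite normCK.
have := B_ge0 (v + (- (s * c^*)) *: u).
rewrite BD !BDl !BZ !BZl uu !mulr0 addr0 -/c (B_herm v u) -/c.
rewrite rmorphN rmorphM /= conjCK s_real.
have -> : B v v + - (s * c) * c^* + - (s * c^*) * c = - (B v v) - 2.
  have sc : s * (c * c^*) = B v v + 1 by rewrite cc mulfVK // gt_eqF.
  by ring: sc.
have : 0 < B v v + 2 by rewrite ltr_wpDl.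
by rewrite -opprD oppr_ge0 => /lt_le_trans /[apply]; rewrite ltxx.
Qed.

(** Null vectors are not divided out: the expansion of [v] holds up to a vector orthogonal to
    everything, and a list element whose residue is null contributes no basis vector. *)
Theorem gram_schmidt (s : seq V) : exists n (w : 'I_n -> V),
  [/\ forall i, lspan s (w i),
      forall i j, B (w i) (w j) = (i == j)%:R
    & forall v, lspan s v ->
        forall u, B u (v - \sum_i B (w i) v *: w i) = 0].
Proof.
(* Families indexed by [nat] avoid casts between ordinals when the basis grows. *)
suff [n [w [ws wo wr]]] : exists n (w : nat -> V),
  [/\ forall i, (i < n)%N -> lspan s (w i),
      forall i j, (i < n)%N -> (j < n)%N -> B (w i) (w j) = (i == j)%:R
    & forall v, lspan s v ->
        forall u, B u (v - \sum_(i < n) B (w i) v *: w i) = 0].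
  exists n, (fun i : 'I_n => w i); split=> // i; first exact: ws.
  by move=> j; apply: wo.
elim: s => [|x s [n [w [ws wo wr]]]].
  exists 0%N, (fun=> 0); split=> // v -> u; by rewrite big_ord0 subr0 B0.
pose res v := v - \sum_(i < n) B (w i) v *: w i.
have resD k u v : res (k *: u + v) = k *: res u + res v.
  rewrite /res (eq_bigr (fun i : 'I_n => k *: (B (w i) u *: w i) + B (w i) v *: w i)).
    by rewrite big_split -scaler_sumr /=; module.
  by move=> i _; rewrite B_lin scalerDl scalerA.
have wres i v : (i < n)%N -> B (w i) (res v) = 0.
  move=> lt_in; rewrite /res BD BN Bsum (bigD1 (Ordinal lt_in)) //= BZ wo // eqxx mulr1.
  rewrite big1 ?addr0 ?subrr // => j ji; rewrite BZ wo // [_ == _](negPf _) ?mulr0 //.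
  by rewrite eq_sym.
have spanE v : lspan (x :: s) v -> exists k v', lspan s v' /\ v = k *: x + v'.
  by move=> [k sv]; exists k, (v - k *: x); split=> //; rewrite addrC subrK.
have [r0|r0] := eqVneq (B (res x) (res x)) 0.
  exists n, w; split=> // [i lt_in|v /spanE[k [v' [sv' ->]]] u].
    by apply: lspan_cons; apply: ws.
  by rewrite -/(res _) resD BD BZ (wr _ sv') form_null // mulr0 addr0.
set c := B (res x) (res x) in r0; have c0 : 0 < c by rewrite lt_def r0 B_ge0.
pose z := (sqrtC c)^-1 *: res x.
have sq0 : sqrtC c != 0 by rewrite sqrtC_eq0.
have sq_real : ((sqrtC c)^-1)^* = (sqrtC c)^-1.
  by apply/CrealP; rewrite realV ger0_real // sqrtC_ge0 ltW.
have zz : B z z = 1.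
  rewrite BZ BZl -/c sq_real mulrA -expr2 exprVn sqrtCK mulVf //.
have wz i : (i < n)%N -> B (w i) z = 0 by move=> lt_in; rewrite BZ wres // mulr0.
have zw i : (i < n)%N -> B z (w i) = 0 by move=> lt_in; rewrite B_herm wz // rmorph0.
have zres v : B z (res v) = B z v.
  by rewrite /res BD BN Bsum big1 ?oppr0 ?addr0 // => i _; rewrite BZ zw // mulr0.
pose w' i := if (i < n)%N then w i else z.
have w'n : w' n = z by rewrite /w' ltnn.
have w'w i : (i < n)%N -> w' i = w i by rewrite /w' => ->.
exists n.+1, w'; split.
- move=> i _; rewrite /w'; case: ifP => [lt_in|_].
    exact/lspan_cons/ws.
  apply/lspanZ/lspanB; first by apply: lspan_mem; rewrite mem_head.
  by apply: lspan_sum => j _; apply/lspanZ/lspan_cons/ws.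
- move=> i j; rewrite !ltnS (leq_eqVlt i) (leq_eqVlt j).
  move=> /orP[/eqP->|lt_in] /orP[/eqP->|lt_jn]; rewrite ?w'n ?w'w //.
  + by rewrite eqxx.
  + by rewrite zw // gtn_eqF.
  + by rewrite wz // ltn_eqF.
  + exact: wo.
- move=> v /spanE[k [v' [sv' ->]]] u.
  set y := k *: x + v'; rewrite big_ord_recr /= w'n.
  under eq_bigr => i _ do rewrite w'w //.
  rewrite opprD addrA -/(res y) -zres resD BD.
  have -> : B z (k *: res x + res v') *: z = k *: res x.
    rewrite BD (wr _ sv') addr0 BZ BZl -/c sq_real scalerA; congr (_ *: _).
    have sc : (sqrtC c)^-1 * (sqrtC c)^-1 * c = 1.
      by rewrite -expr2 exprVn sqrtCK mulVf.
    by ring: sc.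
  by rewrite BD BN BZ (wr _ sv') addr0 subrr.
Qed.

Lemma parseval s n (w : 'I_n -> V) :
  (forall v, lspan s v -> forall u, B u (v - \sum_i B (w i) v *: w i) = 0) ->
  forall u v, lspan s v -> B u v = \sum_i (B (w i) u)^* * B (w i) v.
Proof.
move=> wr u v /wr /(_ u); rewrite BD BN Bsum => /subr0_eq ->.
by apply: eq_bigr => i _; rewrite BZ mulrC -B_herm.
Qed.

End GramSchmidt.

(** * The regular representation *)

Section Adjoint.
Variable K : numClosedFieldType.

Definition adjmx m n (A : 'M[K]_(m, n)) : 'M[K]_(n, m) := map_mx Num.conj A^T.

Lemma adjmxE m n (A : 'M[K]_(m, n)) i j : adjmx A i j = (A j i)^*.
Proof. by rewrite !mxE. Qed.

Lemma adjmxK m n (A : 'M[K]_(m, n)) : adjmx (adjmx A) = A.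
Proof. by apply/matrixP => i j; rewrite !mxE conjCK. Qed.

Lemma adjmxM m n p (A : 'M[K]_(m, n)) (B : 'M[K]_(n, p)) :
  adjmx (A *m B) = adjmx B *m adjmx A.
Proof. by rewrite /adjmx trmx_mul map_mxM. Qed.

Lemma adjmxD m n (A B : 'M[K]_(m, n)) : adjmx (A + B) = adjmx A + adjmx B.
Proof. by apply/matrixP => i j; rewrite !mxE rmorphD. Qed.

Lemma adjmxN m n (A : 'M[K]_(m, n)) : adjmx (- A) = - adjmx A.
Proof. by apply/matrixP => i j; rewrite !mxE rmorphN. Qed.

Lemma adjmxB m n (A B : 'M[K]_(m, n)) : adjmx (A - B) = adjmx A - adjmx B.
Proof. by rewrite adjmxD adjmxN. Qed.

Lemma adjmxZ m n k (A : 'M[K]_(m, n)) : adjmx (k *: A) = k^* *: adjmx A.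
Proof. by apply/matrixP => i j; rewrite !mxE rmorphM. Qed.

Lemma adjmx0 m n : adjmx (0 : 'M[K]_(m, n)) = 0.
Proof. by apply/matrixP => i j; rewrite !mxE conjC0. Qed.

Lemma adjmx1 n : adjmx (1%:M : 'M[K]_n) = 1%:M.
Proof. by apply/matrixP => i j; rewrite !mxE eq_sym rmorph_nat. Qed.

Lemma mxtrace_adj n (A : 'M[K]_n) : \tr (adjmx A) = (\tr A)^*.
Proof. by rewrite /mxtrace rmorph_sum; apply: eq_bigr => i _; rewrite !mxE. Qed.

Lemma mxtrace_adj_mul m n (A : 'M[K]_(m, n)) :
  \tr (adjmx A *m A) = \sum_j \sum_i `|A i j| ^+ 2.
Proof.
rewrite /mxtrace; apply: eq_bigr => j _; rewrite mxE; apply: eq_bigr => i _.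
by rewrite adjmxE mulrC -normCK.
Qed.

Lemma mxtrace_adj_mul_ge0 m n (A : 'M[K]_(m, n)) : 0 <= \tr (adjmx A *m A).
Proof. by rewrite mxtrace_adj_mul; do 2!apply: sumr_ge0 => ? _; rewrite exprn_ge0. Qed.

Lemma mxtrace_adj_mul_eq0 m n (A : 'M[K]_(m, n)) :
  \tr (adjmx A *m A) = 0 -> A = 0.
Proof.
rewrite mxtrace_adj_mul => /psumr_eq0P A0; apply/matrixP => i j; rewrite mxE.
have /psumr_eq0P := A0 (fun j _ => sumr_ge0 _ (fun i _ => exprn_ge0 2 (normr_ge0 (A i j)))) j isT.
move=> /(_ (fun i _ => exprn_ge0 2 (normr_ge0 (A i j)))) /(_ i isT) /eqP.
by rewrite sqrf_eq0 normr_eq0 => /eqP.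
Qed.

Lemma hermitian_diag n (M : 'M[K]_n) : adjmx M = M ->
  exists (U : 'M[K]_n) (d : 'rV[K]_n), [/\ U *m adjmx U = 1%:M,
    adjmx U *m U = 1%:M & M = adjmx U *m diag_mx d *m U].
Proof.
move=> MM; have Mn : M \is normalmx.
  by apply/normalmxP; rewrite -[map_mx _ _]/(adjmx M) MM.
have /orthomx_spectralP := Mn.
have Uu := spectral_unitarymx M.
rewrite (invmx_unitary Uu) -[map_mx _ _]/(adjmx _) => ME.
exists (spectralmx M), (spectral_diag M); split=> //.
  exact/unitarymxP.
by rewrite -[adjmx _]/(map_mx _ _) -(invmx_unitary Uu) mulVmx // unitarymx_unit.
Qed.

End Adjoint.

Section RegularRepresentation.
Variables (K : numClosedFieldType) (A : starAlgType K).
Implicit Types (a b : A) (tau : A -> K).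

(** Polarisation against the unit: positivity at [a + e] and at [a + i e] makes
    [tau (star a) + tau a] and [i (tau (star a) - tau a)] real. *)
Lemma positive_hermitian e tau : left_id e (smul : A -> A -> A) ->
  right_id e (smul : A -> A -> A) -> scalar tau ->
  (forall a, 0 <= tau (star a ** a)) -> forall a, tau (star a) = (tau a)^*.
Proof.
move=> e1 e2 lt pt a; have se := star_unit e1.
have tD u v : tau (u + v) = tau u + tau v.
  by rewrite -[u]scale1r lt mul1r scale1r.
have tZ k u : tau (k *: u) = k * tau u.
  have t0 : tau 0 = 0 by apply/(addrI (tau 0)); rewrite -tD !addr0.
  by rewrite -[_ *: _]addr0 lt t0 addr0.
have real_tau b : tau (star b ** b) \is Num.real by rewrite ger0_real.
have r1 : tau (star a) + tau a \is Num.real.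
  have -> : tau (star a) + tau a =
      tau (star (a + e) ** (a + e)) - tau (star a ** a) - tau (star e ** e).
    by rewrite starD se !(smulDl, smulDr) !e1 !e2 !tD; ring.
  by rewrite !rpredB.
have r2 : 'i * (tau (star a) - tau a) \is Num.real.
  have -> : 'i * (tau (star a) - tau a) =
      tau (star (a + 'i *: e) ** (a + 'i *: e)) - tau (star a ** a) - tau (star e ** e).
    rewrite starD starZ se conjCi !(smulDl, smulDr, smulZl, smulZr) !e1 !e2 !(tD, tZ).
    by have := sqrCi K; rewrite expr2 => ii; ring: ii.
  by rewrite !rpredB.
move: r1 r2; rewrite !CrealE !rmorphM !rmorphD rmorphN /= conjCi mulNr -mulrN.
move=> /eqP r1 /eqP /(mulfI (neq0Ci K)) r2.
apply: (mulfI (_ : 2 != 0)); first by rewrite pnatr_eq0.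
have -> : 2 * tau (star a) = (tau (star a) + tau a) + (tau (star a) - tau a) by ring.
by rewrite -r1 -r2; ring.
Qed.

(* Coordinates on [A] in which left multiplication becomes a star-homomorphism
   [L] into matrices, [g i] being the adjoint of the [i]-th basis vector.  The
   basis is orthonormal for the trace [a |-> \tr (L a)] and diagonalises [tau],
   with weights [c]; hence [L a] is block diagonal with respect to [c]. *)
Record regular_rep e tau n (L : A -> 'M[K]_n) (c : 'I_n -> K) (g : 'I_n -> A)
    : Prop := RegularRep {
  reg_hom : star_hom L;
  reg_weight_gt0 : forall i, 0 < c i;
  reg_block : forall a i j, L a i j != 0 -> c i = c j;
  reg_trace : forall a, tau a = \sum_i c i * L a i i;
  reg_mulr : forall a i, g i ** a = \sum_j L a i j *: g j;
  reg_unit : \sum_i star (g i) ** g i = e;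
  reg_span : forall a, exists k : 'I_n -> K, a = \sum_i k i *: g i;
  reg_one : L e = 1%:M
}.

(** Orthonormality is taken for [s], the trace of left multiplication computed in a
    [tau]-orthonormal basis. With this choice [\sum_i w i ** star (w i)] is the unit, from which
    [reg_trace] and [reg_unit] follow. A unitary change of basis then diagonalises the Gram matrix
    of [tau] and keeps orthonormality for [s]. *)
Theorem exists_regular_rep e tau : finite_dimensional A ->
  left_id e (smul : A -> A -> A) -> right_id e (smul : A -> A -> A) ->
  scalar tau -> (forall a, 0 <= tau (star a ** a)) ->
  (forall a, tau (star a ** a) = 0 -> a = 0) ->
  (forall a b, tau (a ** b) = tau (b ** a)) ->
  exists n (L : A -> 'M[K]_n) c g, regular_rep e tau L c g.
Proof.
move=> /finite_dimensional_span[bas basV] e1 e2 lt pt ft tt.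
have se := star_unit e1.
have linD (f : A -> K) : scalar f -> forall u v, f (u + v) = f u + f v.
  by move=> lf u v; rewrite -[u]scale1r lf mul1r scale1r.
have lin0 (f : A -> K) : scalar f -> f 0 = 0.
  by move=> lf; apply/(addrI (f 0)); rewrite -(linD _ lf) !addr0.
have linZ (f : A -> K) : scalar f -> forall k u, f (k *: u) = k * f u.
  by move=> lf k u; rewrite -[_ *: _]addr0 lf lin0 ?addr0.
have lin_sum (f : A -> K) : scalar f -> forall (I : finType) (F : I -> A),
    f (\sum_i F i) = \sum_i f (F i).
  move=> lf I F; elim/big_rec2: _ => [|i x y _ <-]; first exact: lin0.
  exact: linD.
have form (f : A -> K) : scalar f -> forall u, scalar (fun v => f (star u ** v)).
  by move=> lf u k v w; rewrite smulDr smulZr lf.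
have herm (f : A -> K) : scalar f -> (forall a, 0 <= f (star a ** a)) ->
    forall u v, f (star v ** u) = (f (star u ** v))^*.
  by move=> lf pf u v; rewrite -(positive_hermitian e1 e2 lf pf) starM starK.
have basis (f : A -> K) : scalar f -> (forall a, 0 <= f (star a ** a)) ->
    (forall a, f (star a ** a) = 0 -> a = 0) ->
    exists n (u : 'I_n -> A), (forall i j, f (star (u i) ** u j) = (i == j)%:R)
      /\ forall v, v = \sum_i f (star (u i) ** v) *: u i.
  move=> lf pf ff;
    have [n [u [_ uo ur]]] := gram_schmidt (form f lf) (herm f lf pf) pf bas.
  exists n, u; split=> // v; apply/eqP; rewrite -subr_eq0; apply/eqP/ff.
  exact: ur.
have [m [u [_ uE]]] := basis tau lt pt ft.
pose s a := \sum_i tau (star (u i) ** (a ** u i)).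
have ls : scalar s.
  move=> k a b; rewrite mulr_sumr -big_split; apply: eq_bigr => i _ /=.
  by rewrite smulDl smulZl smulDr smulZr lt.
have ps_sum a : s (star a ** a) = \sum_i tau (star (a ** u i) ** (a ** u i)).
  by apply: eq_bigr => i _; rewrite starM !smulA.
have ps a : 0 <= s (star a ** a) by rewrite ps_sum sumr_ge0.
have fs a : s (star a ** a) = 0 -> a = 0.
  rewrite ps_sum => /psumr_eq0P s0; rewrite -(e2 a) (uE e) smul_sumr big1 // => i _.
  by rewrite smulZr (ft (a ** u i)) ?scaler0 // s0.
have ts a b : s (a ** b) = s (b ** a).
  have sE x y : s (x ** y) = \sum_i \sum_j
      tau (star (u j) ** (y ** u i)) * tau (star (u i) ** (x ** u j)).
    apply: eq_bigr => i _; rewrite -smulA {1}(uE (y ** u i)) !smul_sumr lin_sum //.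
    by apply: eq_bigr => j _; rewrite !smulZr linZ.
  rewrite !sE exchange_big; apply: eq_bigr => i _; apply: eq_bigr => j _.
  by rewrite mulrC.
have [n [f [fo fE]]] := basis s ls ps fs.
pose M : 'M[K]_n := \matrix_(i, j) tau (star (f i) ** f j).
have [U [d [UU1 UU2 ME]]] : exists (U : 'M[K]_n) (d : 'rV[K]_n),
    [/\ U *m adjmx U = 1%:M, adjmx U *m U = 1%:M & M = adjmx U *m diag_mx d *m U].
  by apply: hermitian_diag; apply/matrixP => i j; rewrite !mxE -herm.
pose w k := \sum_i (U k i)^* *: f i.
have star_w k : star (w k) = \sum_i U k i *: star (f i).
  by rewrite star_sum; apply: eq_bigr => i _; rewrite starZ conjCK.
have form_w (h : A -> K) : scalar h -> forall k v,
    h (star (w k) ** v) = \sum_i U k i * h (star (f i) ** v).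
  move=> lh k v; rewrite star_w smul_suml lin_sum //.
  by apply: eq_bigr => i _; rewrite smulZl linZ.
have form_ww (h : A -> K) : scalar h -> forall k l, h (star (w k) ** w l) =
    (U *m (\matrix_(i, j) h (star (f i) ** f j)) *m adjmx U) k l.
  move=> lh k l; rewrite form_w // -mulmxA mxE; apply: eq_bigr => i _.
  rewrite smul_sumr lin_sum // mxE; congr (_ * _); apply: eq_bigr => j _.
  by rewrite smulZr linZ // !mxE mulrC.
have wo k l : s (star (w k) ** w l) = (k == l)%:R.
  rewrite form_ww // (_ : \matrix_(i, j) _ = 1%:M) ?mulmx1 ?UU1 ?mxE //.
  by apply/matrixP => i j; rewrite !mxE fo.
have wtau k l : tau (star (w k) ** w l) = d 0 k *+ (k == l).
  rewrite form_ww // -/M ME !mulmxA UU1 mul1mx -mulmxA UU1 mulmx1 !mxE //.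
have wE v : v = \sum_k s (star (w k) ** v) *: w k.
  rewrite {1}(fE v); under eq_bigr => i _ do rewrite -[f i]scale1r.
  rewrite /w; under [RHS]eq_bigr => k _ do rewrite form_w // scaler_sumr.
  rewrite exchange_big /=; apply: eq_bigr => j _.
  rewrite scale1r; under eq_bigr => k _ do rewrite scalerA mulr_suml.
  rewrite -scaler_suml exchange_big /=; congr (_ *: _).
  rewrite -[LHS]mul1r.
  under eq_bigr => i _.
    under eq_bigr => k _ do rewrite mulrAC.
    rewrite -mulr_suml.
    rewrite (_ : \sum_k _ = (adjmx U *m U) j i); last first.
      by rewrite mxE; apply: eq_bigr => k _; rewrite !mxE mulrC.
    rewrite UU2 mxE.
    over.
  by rewrite (bigD1 j) //= eqxx mul1r big1 ?addr0 ?mul1r // => i ij;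
    rewrite eq_sym (negPf ij) mul0r.
pose L a : 'M[K]_n := \matrix_(i, j) s (star (w i) ** (a ** w j)).
have LE a j : a ** w j = \sum_k L a k j *: w k.
  by rewrite {1}(wE (a ** w j)); apply: eq_bigr => k _; rewrite mxE.
have L_star a i j : L (star a) i j = (L a j i)^*.
  by rewrite !mxE -herm // starM -smulA.
have gE a i : star (w i) ** a = \sum_j L a i j *: star (w j).
  rewrite -[LHS]starK starM starK LE star_sum; apply: eq_bigr => j _.
  by rewrite starZ L_star conjCK.
(* The trace of left multiplication does not depend on the basis; here it is evaluated in the basis
   [w]. *)
have sL a : s a = \sum_i s (star (w i) ** (a ** w i)).
  rewrite {1}/s; under eq_bigr => i _.
    rewrite (wE (a ** u i)) smul_sumr lin_sum //.
    under eq_bigr => k _ do rewrite smulZr linZ //.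
    over.
  rewrite exchange_big; apply: eq_bigr => k _ /=.
  rewrite [X in _ = s (_ ** (_ ** X))](uE (w k)) !smul_sumr lin_sum //;
    apply: eq_bigr => i _.
  by rewrite !smulZr linZ // mulrC.
(* By the previous identity and traciality [s (a ** z) = s a] for every [a], and a faithful [s]
   determines [z] from this. *)
have zE : \sum_i w i ** star (w i) = e.
  set z := \sum_i _.
  have sz a : s (a ** z) = s a.
    rewrite [RHS]sL smul_sumr lin_sum //; apply: eq_bigr => i _.
    by rewrite smulA ts.
  apply/eqP; rewrite -subr_eq0; apply/eqP/fs.
  have sB x y : s (x - y) = s x - s y by rewrite linD // -scaleN1r linZ // mulN1r.
  by rewrite smulBr e2 sB sz subrr.
(* Expanding [a ** w j] produces the weight of [i], expanding [star (w i) ** a] in [dE'] the weight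
   of [j]; equating the two gives the block structure. *)
have dE a i j : tau (star (w i) ** (a ** w j)) = d 0 i * L a i j.
  rewrite LE smul_sumr lin_sum // (bigD1 i) //= smulZr linZ // wtau eqxx mulr1n mulrC.
  rewrite big1 ?addr0 // => k ki.
  by rewrite smulZr linZ // wtau eq_sym (negPf ki) mulr0n mulr0.
have dE' a i j : tau (star (w i) ** (a ** w j)) = d 0 j * L a i j.
  rewrite smulA gE smul_suml lin_sum // (bigD1 j) //= smulZl linZ // wtau eqxx mulr1n mulrC.
  rewrite big1 ?addr0 // => k kj.
  by rewrite smulZl linZ // wtau (negPf kj) mulr0n mulr0.
exists n, L, (fun i => d 0 i), (fun i => star (w i)); split.
- split.
  + by move=> k a b; apply/matrixP => i j; rewrite !mxE smulDl smulZl smulDr smulZr ls.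
  + move=> a b; apply/matrixP => i j.
    rewrite -[L a ** L b]/(L a *m L b) !mxE -smulA LE !smul_sumr lin_sum //.
    by apply: eq_bigr => k _; rewrite !smulZr linZ // !mxE mulrC.
  + move=> a; apply/matrixP => i j; rewrite L_star.
    by rewrite -[star (L a)]/(adjmx (L a)) adjmxE.
- move=> i; have := wtau i i; rewrite eqxx mulr1n => <-.
  rewrite lt_def pt andbT; apply/eqP => /ft w0.
  have := wo i i; rewrite w0 smul0r lin0 // eqxx => /eqP.
  by rewrite eq_sym oner_eq0.
- move=> a i j Lij; apply: (mulIf Lij); rewrite -dE; exact: dE'.
- move=> a; rewrite -{1}(e2 a) -zE smul_sumr lin_sum //; apply: eq_bigr => i _.
  by rewrite smulA tt dE.
- by move=> a i; apply: gE.
- by rewrite -[RHS]zE; apply: eq_bigr => i _; rewrite starK.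
- move=> a; exists (fun i => (s (star (w i) ** star a))^*).
  rewrite -{1}(starK a) {1}(wE (star a)) star_sum.
  by apply: eq_bigr => i _; rewrite starZ.
- by apply/matrixP => i j; rewrite !mxE e1 wo.
Qed.

End RegularRepresentation.

(** * Integral weights *)

Section RationalWeights.
Variable R : realType.

(** Induction on [m]: if [c m] is a rational combination of the earlier weights, [q m] is forced to
    be the same combination of their approximations; otherwise any close rational will do, as no
    relation involves [c m]. *)
Lemma rational_relations (m : nat) (c : nat -> R) (d : R) : 0 < d ->
  exists q : nat -> rat, (forall i, (i < m)%N -> `|ratr (q i) - c i| < d) /\
    forall z : nat -> rat, \sum_(i < m) ratr (z i) * c i = 0 ->
      \sum_(i < m) z i * q i = 0.
Proof.
elim: m d => [|m ih] d d0; first by exists (fun=> 0); split=> // z _; rewrite big_ord0.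
have [[x cx]|indep] := pselect (exists x : nat -> rat, c m = \sum_(i < m) ratr (x i) * c i).
  (* The earlier approximations must be finer by the total size of the coefficients, since their
     errors add up in [q m]; the 1 keeps the division legitimate and the bound strict. *)
  pose d' := d / (1 + \sum_(i < m) `|ratr (x i) : R|).
  have S0 : 0 <= \sum_(i < m) `|ratr (x i) : R| by rewrite sumr_ge0.
  have S1 : 0 < 1 + \sum_(i < m) `|ratr (x i) : R| by rewrite ltr_wpDr.
  have d'0 : 0 < d' by rewrite divr_gt0.
  have d'd : d' <= d by rewrite ler_pdivrMr // ler_peMr ?(ltW d0) ?lerDl.
  have [q [qc qz]] := ih d' d'0.
  exists (fun i => if (i < m)%N then q i else \sum_(i < m) x i * q i); split.
    move=> i; rewrite ltnS leq_eqVlt => /orP[/eqP->|lt_im]; last first.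
      by rewrite lt_im (lt_le_trans (qc i lt_im)).
    rewrite ltnn rmorph_sum cx -sumrB.
    apply: le_lt_trans (ler_norm_sum _ _ _) _.
    apply: (@le_lt_trans _ _ (\sum_(i < m) `|ratr (x i) : R| * d')).
      apply: ler_sum => j _; rewrite rmorphM /= -mulrBr normrM.
      by rewrite ler_wpM2l // ltW // qc.
    rewrite -mulr_suml /d' mulrCA gtr_pMr //.
    by rewrite ltr_pdivrMr // mul1r ltrDr.
  move=> z; rewrite !big_ord_recr /= ltnn cx mulr_sumr -big_split /= => zc.
  under eq_bigr => i _ do rewrite ltn_ord.
  rewrite mulr_sumr -big_split /=.
  have zq : \sum_(i < m) ratr (z i + z m * x i) * c i = 0.
    by rewrite -[RHS]zc; apply: eq_bigr => i _; rewrite rmorphD rmorphM /= mulrDl mulrA.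
  rewrite -[RHS](qz (fun i => z i + z m * x i)) //.
  by apply: eq_bigr => i _; rewrite mulrDl mulrA.
have [q [qc qz]] := ih d d0.
have [r /[!in_itv]/= /andP[rl ru]] : exists r : rat, ratr r \in `]c m - d, c m + d[.
  by apply: rat_in_itvoo; lra.
exists (fun i => if (i < m)%N then q i else r); split.
  move=> i; rewrite ltnS leq_eqVlt => /orP[/eqP->|lt_im]; last by rewrite lt_im qc.
  by rewrite ltnn ltr_distl rl.
move=> z; rewrite !big_ord_recr /= ltnn => zc.
have [zm|zm] := eqVneq (z m) 0.
  rewrite zm rmorph0 mul0r addr0 in zc.
  by under eq_bigr => i _ do rewrite ltn_ord; rewrite (qz _ zc) zm mul0r addr0.
case: indep; exists (fun i => - (z i / z m)).
apply: (@mulfI _ (ratr (z m))); first by rewrite fmorph_eq0.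
move/eqP: zc; rewrite addrC addr_eq0 => /eqP->; rewrite mulr_sumr -sumrN.
apply: eq_bigr => i _; rewrite rmorphN fmorph_div mulNr mulrN mulrA; congr (- (_ * _)).
by rewrite mulrC divfK // fmorph_eq0.
Qed.

(** Positive rational approximations with the same relations are scaled by a common denominator.
    Relations are stated between lists, the form in which eigenvalue multiplicities produce them. *)
Theorem natural_weights (I : finType) (c : I -> R) : (forall i, 0 < c i) ->
  exists N : I -> nat, (forall i, (0 < N i)%N) /\
    forall s t : seq I, \sum_(i <- s) c i = \sum_(i <- t) c i ->
      (\sum_(i <- s) N i = \sum_(i <- t) N i)%N.
Proof.
move=> c0.
pose cn k := if insub k is Some i then c (enum_val (i : 'I_#|I|)) else 0.
have cnE (i : I) : cn (enum_rank i) = c i.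
  by rewrite /cn valK enum_rankK.
(* A bound below every [c i], even for empty [I]; approximating to within [d] keeps the rationals
   positive. *)
pose d := (1 + \sum_i (c i)^-1)^-1.
have S0 : 0 <= \sum_i (c i)^-1 by rewrite sumr_ge0 // => i _; rewrite invr_ge0 ltW.
have d0 : 0 < d by rewrite invr_gt0 ltr_wpDr.
have dc i : d <= c i.
  rewrite -[leRHS]invrK lef_pV2 ?posrE ?invr_gt0 ?ltr_wpDr //.
  rewrite (bigD1 i) //= addrCA lerDl addr_ge0 // sumr_ge0 // => j _.
  by rewrite invr_ge0 ltW.
have [q [qc qz]] := rational_relations #|I| cn d0.
pose r (i : I) := q (enum_rank i).
have r0 i : 0 < r i.
  have := qc (enum_rank i) (ltn_ord _); rewrite cnE -/(r i) ltr_distl => /andP[h _].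
  by rewrite -(ltr0q R); have := dc i; lra.
have rz (z : I -> rat) : \sum_i ratr (z i) * c i = 0 -> \sum_i z i * r i = 0.
  pose zn k := if insub k is Some i then z (enum_val (i : 'I_#|I|)) else 0.
  have znE (i : I) : zn (enum_rank i) = z i by rewrite /zn valK enum_rankK.
  have sum_rank (T : nmodType) (F : nat -> T) :
      \sum_(k < #|I|) F k = \sum_(i : I) F (enum_rank i).
    rewrite (reindex (@enum_rank I)) //.
    by exists enum_val => i _; rewrite ?enum_rankK ?enum_valK.
  move=> zc; have /qz : \sum_(k < #|I|) ratr (zn k) * cn k = 0.
    by rewrite (sum_rank _ (fun k => ratr (zn k) * cn k)) -[RHS]zc;
      apply: eq_bigr => i _; rewrite znE cnE.
  by rewrite (sum_rank _ (fun k => zn k * q k)) => zq; rewrite -[RHS]zq;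
    apply: eq_bigr => i _; rewrite znE.
have [D D0 [N NE]] : exists2 D : rat, 0 < D &
    exists N : I -> nat, forall i, (N i)%:R = r i * D.
  exists (\prod_j denq (r j))%:~R.
    by rewrite ltr0z prodr_gt0 // => j _; apply: denq_gt0.
  exists (fun i => absz (numq (r i) * \prod_(j | j != i) denq (r j))) => i.
  rewrite pmulrn gez0_abs; last first.
    rewrite mulr_ge0 //; first by rewrite numq_ge0 ltW.
    by apply: prodr_ge0 => j _; apply: denq_ge0.
  rewrite [in RHS](bigD1 i) //= !intrM mulrA; congr (_ * _).
  by rewrite -{2}(divq_num_den (r i)) divfK // intr_eq0 denq_neq0.
exists N; split.
  by move=> i; rewrite -(ltr0n rat) NE mulr_gt0.
have count_sum (V : nmodType) (F : I -> V) (s : seq I) :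
    \sum_(i <- s) F i = \sum_i F i *+ count_mem i s.
  elim: s => [|x s ih]; first by rewrite big_nil big1.
  rewrite big_cons ih (bigD1 x) //= [in RHS](bigD1 x) //= eqxx addrA -mulrS.
  congr (_ + _); apply: eq_bigr => i ix.
  by rewrite eq_sym (negPf ix).
move=> s t; rewrite (count_sum _ c s) (count_sum _ c t) => st.
have /rz : \sum_i ratr ((count_mem i s)%:R - (count_mem i t)%:R) * c i = 0.
  under eq_bigr => i _ do rewrite rmorphB !rmorph_nat mulrBl !mulr_natl.
  by rewrite sumrB st subrr.
move=> /(congr1 ( *%R^~ D)); rewrite /= mul0r mulr_suml => /eqP.
rewrite (eq_bigr (fun i => (N i)%:R *+ count_mem i s - (N i)%:R *+ count_mem i t));
  last first.
  by move=> i _; rewrite -mulrA -NE mulrBl !mulr_natl.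
rewrite sumrB subr_eq0 => /eqP st'.
have := st';
  rewrite -(count_sum rat (fun i => (N i)%:R) s) -(count_sum rat (fun i => (N i)%:R) t) => {}st'.
apply/eqP; rewrite -(eqr_nat rat) !natr_sum; apply/eqP.
exact: st'.
Qed.

End RationalWeights.

(** * From real to integral weights in trace identities *)

Section WeightTransfer.
Variable K : numClosedFieldType.

(** [M] commutes with the diagonal matrix [C] of the [c i], so [Z = M + i C] is normal.
    Diagonalising [Z] diagonalises its real part [M] and imaginary part [C] together, and each
    eigenvector sits in one block, of which [sigma] names an index. *)
Lemma block_diagonalize n (M : 'M[K]_n) (c : 'I_n -> K) : adjmx M = M ->
  (forall i, c i \is Num.real) -> (forall i j, M i j != 0 -> c i = c j) ->
  exists (U : 'M[K]_n) (mu : 'rV[K]_n) (sigma : 'I_n -> 'I_n),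
    [/\ U *m adjmx U = 1%:M, adjmx U *m U = 1%:M,
        M = adjmx U *m diag_mx mu *m U
      & forall a i, U a i != 0 -> c i = c (sigma a)].
Proof.
move=> MM c_real cM; pose C : 'M[K]_n := diag_mx (\row_i c i).
have CC : adjmx C = C.
  apply/matrixP => i j; rewrite !mxE eq_sym; case: eqP => [->|_].
    by rewrite !mulr1n (CrealP _).
  by rewrite conjC0.
have MC : M *m C = C *m M.
  apply/matrixP => i j; rewrite mul_mx_diag mul_diag_mx !mxE mulrC.
  have [->|/cM->//] := eqVneq (M i j) 0; first by rewrite !mulr0.
pose Z := M + 'i *: C.
have ZZ : adjmx Z = M - 'i *: C by rewrite adjmxD adjmxZ MM CC conjCi scaleNr.
have Zn : Z \is normalmx.
  apply/normalmxP; rewrite -[map_mx _ _]/(adjmx Z) ZZ /Z.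
  by rewrite !(mulmxDl, mulmxDr, mulNmx, mulmxN) -!scalemxAl -!scalemxAr MC; module.
have /orthomx_spectralP := Zn; have Uu := spectral_unitarymx Z.
set U := spectralmx Z in Uu *; set d := spectral_diag Z.
rewrite (invmx_unitary Uu) -[map_mx _ _]/(adjmx U) => ZE.
have UU : U *m adjmx U = 1%:M by apply/unitarymxP.
have UU' : adjmx U *m U = 1%:M.
  by rewrite -[adjmx _]/(map_mx _ _) -(invmx_unitary Uu) mulVmx // unitarymx_unit.
pose d' : 'rV[K]_n := map_mx Num.conj d.
have ZE' : adjmx Z = adjmx U *m diag_mx d' *m U.
  rewrite {1}ZE !adjmxM adjmxK mulmxA; congr (_ *m _ *m _).
  apply/matrixP => i j; rewrite !mxE eq_sym; case: eqP => [->|_] //.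
  by rewrite conjC0.
have two0 : 2 != 0 :> K by rewrite pnatr_eq0.
have ME : M = 2^-1 *: (Z + adjmx Z).
  rewrite ZZ (_ : Z + _ = 2 *: M) ?scalerA ?mulVf ?scale1r //.
  by rewrite /Z; module.
have CE : C = (2 * 'i)^-1 *: (Z - adjmx Z).
  rewrite ZZ (_ : Z - _ = (2 * 'i) *: C) ?scalerA ?mulVf ?scale1r ?mulf_neq0 ?neq0Ci //.
  by rewrite /Z; module.
have combE k k' : k *: (Z + k' *: adjmx Z) =
    adjmx U *m diag_mx (k *: (d + k' *: d')) *m U.
  rewrite ZE' {1}ZE [diag_mx (k *: _)]linearZ /= -scalemxAr -scalemxAl.
  congr (k *: _); rewrite [diag_mx (_ + _)]linearD /= [diag_mx (k' *: _)]linearZ /=.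
  by rewrite mulmxDr mulmxDl -scalemxAr -scalemxAl.
pose gam := (2 * 'i)^-1 *: (d + (- 1) *: d').
have UC a i : U a i * c i = gam 0 a * U a i.
  have : U *m C = diag_mx gam *m U.
    by rewrite CE -scaleN1r combE !mulmxA UU mul1mx.
  move/matrixP/(_ a i); rewrite mul_mx_diag mul_diag_mx.
  by rewrite [X in X = _]mxE [X in _ = X]mxE mxE.
have nzU a : exists i, U a i != 0.
  apply/existsP; rewrite -[[exists _, _]]negbK negb_exists; apply/negP => /forallP U0.
  have /matrixP/(_ a a)/eqP := UU; rewrite !mxE eqxx big1 ?(eq_sym 0) ?oner_eq0 //.
  by move=> i _; have := U0 i; rewrite negbK => /eqP->; rewrite mul0r.
have [sigma sE] := choice nzU.
exists U, (2^-1 *: (d + 1 *: d')), sigma; split=> //.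
  by rewrite -combE scale1r.
move=> a i Uai.
have cg j : U a j != 0 -> c j = gam 0 a.
  by move=> Uaj; apply: (mulfI Uaj); rewrite UC mulrC.
by rewrite !cg.
Qed.

Lemma weighted_trace n (U : 'M[K]_n) (nu : 'rV[K]_n) (sigma : 'I_n -> 'I_n)
    (w : 'I_n -> K) : U *m adjmx U = 1%:M ->
  (forall a i, U a i != 0 -> w i = w (sigma a)) ->
  \sum_i w i * (adjmx U *m diag_mx nu *m U) i i = \sum_a w (sigma a) * nu 0 a.
Proof.
move=> UU wU.
have E i : w i * (adjmx U *m diag_mx nu *m U) i i =
    \sum_a w (sigma a) * nu 0 a * (U a i * (U a i)^*).
  rewrite mxE mulr_sumr; apply: eq_bigr => a _; rewrite mul_mx_diag !mxE.
  have [->|/wU->] := eqVneq (U a i) 0; first by rewrite !(mulr0, mul0r).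
  by ring.
rewrite (eq_bigr _ (fun i _ => E i)) exchange_big; apply: eq_bigr => a _ /=.
rewrite -mulr_sumr (_ : \sum_i _ = 1) ?mulr1 //.
transitivity ((U *m adjmx U) a a); last by rewrite UU mxE eqxx.
by rewrite mxE; apply: eq_bigr => i _; rewrite !mxE.
Qed.

(** Equal moments integrate every polynomial alike; one that vanishes at all the points except [z]
    isolates the mass at [z]. *)
Lemma power_sums_fiber (I J : finType) (x : I -> K) (y : J -> K)
    (a : I -> K) (b : J -> K) :
  (forall k, \sum_i a i * x i ^+ k = \sum_j b j * y j ^+ k) ->
  forall z, \sum_(i | x i == z) a i = \sum_(j | y j == z) b j.
Proof.
move=> xy z.
have poly_xy (p : {poly K}) : \sum_i a i * p.[x i] = \sum_j b j * p.[y j].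
  have E (T : finType) (f g : T -> K) : \sum_t f t * p.[g t] =
      \sum_(k < size p) p`_k * \sum_t f t * g t ^+ k.
    under [RHS]eq_bigr => k _ do rewrite mulr_sumr.
    rewrite exchange_big; apply: eq_bigr => t _ /=.
    by rewrite horner_coef mulr_sumr; apply: eq_bigr => k _; ring.
  by rewrite !E; apply: eq_bigr => k _; rewrite xy.
pose s := [seq u <- [seq x i | i : I] ++ [seq y j | j : J] | u != z].
pose q := \prod_(u <- s) ('X - u%:P).
have q0 u : u \in s -> q.[u] = 0.
  by move=> us; apply/eqP; rewrite -/(root q u) root_prod_XsubC.
have qz : q.[z] != 0.
  by rewrite -/(root q z) root_prod_XsubC mem_filter eqxx.
apply: (mulIf qz); have := poly_xy q; rewrite !mulr_suml.
have E (T : finType) (f g : T -> K) : (forall t, g t != z -> g t \in s) ->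
    \sum_t f t * q.[g t] = \sum_(t | g t == z) f t * q.[z].
  move=> gs; rewrite (bigID (fun t => g t == z)) /= [X in _ + X]big1 ?addr0.
    by apply: eq_bigr => t /eqP->.
  by move=> t gt; rewrite q0 ?mulr0 // gs.
rewrite !E // => t tz; rewrite mem_filter tz mem_cat map_f ?orbT ?mem_enum //.
Qed.

Lemma sum_fiber (I J : finType) (x : I -> K) (y : J -> K)
    (a : I -> K) (b : J -> K) :
  (forall z, \sum_(i | x i == z) a i = \sum_(j | y j == z) b j) ->
  \sum_i a i * x i = \sum_j b j * y j.
Proof.
move=> xy; pose s := undup ([seq x i | i : I] ++ [seq y j | j : J]).
have E (T : finType) (f g : T -> K) : (forall t, g t \in s) ->
    \sum_t f t * g t = \sum_(z <- s) z * \sum_(t | g t == z) f t.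
  move=> gs; under [RHS]eq_bigr => z _ do rewrite mulr_sumr big_mkcond.
  rewrite exchange_big; apply: eq_bigr => t _ /=.
  rewrite (bigD1_seq (g t)) ?undup_uniq //= eqxx big1 ?addr0 1?mulrC // => z zt.
  by rewrite eq_sym (negPf zt).
rewrite !E; first by apply: eq_bigr => z _; rewrite xy.
  by move=> t; rewrite mem_undup mem_cat map_f ?orbT ?mem_enum.
by move=> t; rewrite mem_undup mem_cat map_f ?orbT ?mem_enum.
Qed.

(** For self-adjoint [h] in [D] all powers of [h] lie in [D], so the identity for [c] compares all
    moments of two weighted spectra. Hence for each eigenvalue the two total weights agree. This is
    an additive relation between the [c u], so it passes to [N], and summing over eigenvalues gives
    the claim for [h]. *)
Theorem weight_transfer (D : starAlgType K) (e : D) n1 n2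
    (X : D -> 'M[K]_n1) (Y : D -> 'M[K]_n2) (c : 'I_n1 + 'I_n2 -> K)
    (N : 'I_n1 + 'I_n2 -> K) :
  star_hom X -> X e = 1%:M -> star_hom Y -> Y e = 1%:M ->
  (forall u, c u \is Num.real) ->
  (forall d i j, X d i j != 0 -> c (inl i) = c (inl j)) ->
  (forall d i j, Y d i j != 0 -> c (inr i) = c (inr j)) ->
  (forall s t, \sum_(u <- s) c u = \sum_(u <- t) c u ->
    \sum_(u <- s) N u = \sum_(u <- t) N u) ->
  (forall d, \sum_i c (inl i) * X d i i = \sum_j c (inr j) * Y d j j) ->
  forall d, \sum_i N (inl i) * X d i i = \sum_j N (inr j) * Y d j j.
Proof.
move=> [lX mX sX] X1 [lY mY sY] Y1 c_real cX cY cN tr_eq d.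
have Nc u v : c u = c v -> N u = N v.
  by move=> uv; have := cN [:: u] [:: v]; rewrite !big_seq1; apply.
have sa h : star h = h ->
    \sum_i N (inl i) * X h i i = \sum_j N (inr j) * Y h j j.
  move=> sh.
  have [|||U [mu [sg [UU UU' XE Uc]]]] := @block_diagonalize _ (X h) (c \o inl).
  - by rewrite -[LHS]/(star (X h)) -sX sh.
  - by move=> i; apply: c_real.
  - exact: cX.
  have [|||V [nu [ta [VV VV' YE Vc]]]] := @block_diagonalize _ (Y h) (c \o inr).
  - by rewrite -[LHS]/(star (Y h)) -sY sh.
  - by move=> i; apply: c_real.
  - exact: cY.
  have hpow n (Z : D -> 'M[K]_n) (W : 'M[K]_n) (xi : 'rV[K]_n) :
      (forall a b, Z (a ** b) = Z a ** Z b) -> Z e = 1%:M ->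
      W *m adjmx W = 1%:M -> adjmx W *m W = 1%:M ->
      Z h = adjmx W *m diag_mx xi *m W -> forall k,
      Z (iter k (smul h) e) = adjmx W *m diag_mx (\row_a xi 0 a ^+ k) *m W.
    move=> mZ Z1 WW WW' ZE; elim=> [|k ih] /=.
      rewrite Z1 (_ : diag_mx _ = 1%:M) ?mulmx1 ?WW' //.
      by apply/matrixP => i j; rewrite !mxE expr0.
    rewrite mZ ih ZE -[_ ** _]/(_ *m _) !mulmxA -(mulmxA _ W) WW mulmx1.
    rewrite -(mulmxA (adjmx W)) mulmx_diag; congr (_ *m diag_mx _ *m _).
    by apply/rowP => a; rewrite !mxE exprS.
  have fib z : \sum_(a | mu 0 a == z) c (inl (sg a)) =
      \sum_(b | nu 0 b == z) c (inr (ta b)).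
    apply: power_sums_fiber => k; have := tr_eq (iter k (smul h) e).
    rewrite (hpow _ X _ _ mX X1 UU UU' XE) (hpow _ Y _ _ mY Y1 VV VV' YE).
    rewrite (@weighted_trace _ U _ sg (c \o inl)) //.
    rewrite (@weighted_trace _ V _ ta (c \o inr)) //= => E.
    transitivity (\sum_a c (inl (sg a)) * (\row_b mu 0 b ^+ k) 0 a).
      by apply: eq_bigr => a _; rewrite mxE.
    by rewrite E; apply: eq_bigr => a _; rewrite mxE.
  rewrite XE YE (@weighted_trace _ U _ sg (N \o inl)) //; last first.
    by move=> a i /Uc /Nc.
  rewrite (@weighted_trace _ V _ ta (N \o inr)) //; last by move=> a i /Vc /Nc.
  apply: sum_fiber => z.
  (* The eigenvectors of eigenvalue [z] on either side, listed by the blocks containing them. *)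
  pose s := [seq inl (sg a) : 'I_n1 + 'I_n2 | a <- index_enum 'I_n1 & mu 0 a == z].
  pose t := [seq inr (ta b) : 'I_n1 + 'I_n2 | b <- index_enum 'I_n2 & nu 0 b == z].
  have := cN s t; rewrite !big_map !big_filter; apply; exact: fib.
have lin n (Z : D -> 'M[K]_n) (w : 'I_n -> K) : linear Z -> forall k u v,
    \sum_i w i * Z (k *: u + v) i i =
    k * (\sum_i w i * Z u i i) + \sum_i w i * Z v i i.
  move=> lZ k u v; rewrite lZ mulr_sumr -big_split; apply: eq_bigr => i _ /=.
  by rewrite !mxE; ring.
pose h1 := d + star d; pose h2 := 'i *: (d - star d).
have h1E : star h1 = h1 by rewrite starD starK addrC.
have h2E : star h2 = h2.
  by rewrite starZ conjCi starB starK scaleNr -scalerN opprB.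
have dE : d = 2^-1 *: h1 + ((- 'i / 2) *: h2 + 0).
  have dd : d = 2^-1 *: (d + d).
    by rewrite -[d in d + d]scale1r -scalerDl scalerA mulVf ?scale1r // pnatr_eq0.
  rewrite addr0 {1}dd /h1 /h2 scalerA mulrAC mulNr -expr2 sqrCi opprK mul1r.
  by rewrite -scalerDr; congr (_ *: _); module.
have Z0 n (Z : D -> 'M[K]_n) (w : 'I_n -> K) : linear Z -> \sum_i w i * Z 0 i i = 0.
  move=> lZ; have := lin n Z w lZ (-1) 0 0; rewrite scaler0 addr0 mulN1r addNr //.
by rewrite dE !lin // !Z0 // !sa.
Qed.

End WeightTransfer.

Section Amplification.
Variables (K : numClosedFieldType) (A : starAlgType K).

Lemma sum_mxtens_index (T : nmodType) m n (F : 'I_(m * n) -> T) :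
  \sum_k F k = \sum_i \sum_j F (mxtens_index (i, j)).
Proof.
rewrite pair_big /= (reindex (@mxtens_index m n)) /=.
  by apply: eq_bigr => -[].
by exists (@mxtens_unindex m n) => k _; rewrite ?mxtens_indexK ?mxtens_unindexK.
Qed.

(* [alpha] is the direct sum in which the block of [L] of index [i] is
   repeated [N i] times, and [J] embeds the first copies. *)
Theorem amplification n (L : A -> 'M[K]_n) (N : 'I_n -> nat) :
  star_hom L -> (forall a i j, L a i j != 0 -> N i = N j) ->
  (forall i, (0 < N i)%N) ->
  exists m (alpha : A -> 'M[K]_m) (J : 'M[K]_(m, n)), [/\ star_hom alpha,
    forall a, \tr (alpha a) = \sum_i (N i)%:R * L a i i,
    forall a, alpha a *m J = J *m L a
    & adjmx J *m J = 1%:M].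
Proof.
move=> [lL mL sL] LN N0; have [r Nr] : exists r, forall i, (N i <= r)%N.
  by exists (\sum_i N i)%N => i; rewrite (bigD1 i) //= leq_addr.
(* Every index gets [r.+1] slots, the surplus ones carrying zero. So [alpha] need not be unital, and
   later arguments work with its support projection instead of the identity. *)
pose alpha a : 'M[K]_(n * r.+1) := \matrix_(p, q)
  (L a (mxtens_unindex p).1 (mxtens_unindex q).1 *+
    (((mxtens_unindex p).2 == (mxtens_unindex q).2)
      && ((mxtens_unindex p).2 < N (mxtens_unindex p).1)%N)).
have alphaE a i j u v : alpha a (mxtens_index (i, u)) (mxtens_index (j, v)) =
    L a i j *+ ((u == v) && (u < N i)%N).
  by rewrite mxE !mxtens_indexK.
pose J : 'M[K]_(n * r.+1, n) := \matrix_(p, j)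
  (((mxtens_unindex p).1 == j) && ((mxtens_unindex p).2 == ord0))%:R.
have JE i u j : J (mxtens_index (i, u)) j = ((i == j) && (u == ord0))%:R.
  by rewrite mxE !mxtens_indexK.
exists (n * r.+1)%N, alpha, J; split.
- split.
  + by move=> k a b; apply/matrixP => p q; rewrite !mxE lL !mxE mulrnDl mulrnAr.
  + move=> a b; apply/matrixP => p q.
    case: (mxtens_indexP p) => i u; case: (mxtens_indexP q) => j v.
    rewrite -[alpha a ** _]/(_ *m _) alphaE mL -[L a ** _]/(_ *m _) !mxE sum_mxtens_index.
    rewrite -sumrMnl; apply: eq_bigr => k _.
    rewrite (bigD1 u) //= !alphaE eqxx /= big1 ?addr0 => [|x xu]; last first.
      by rewrite alphaE eq_sym (negPf xu) mulr0n mul0r.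
    have [->|/LN->] := eqVneq (L a i k) 0; first by rewrite !(mul0rn, mul0r).
    by case: (u < N k)%N; rewrite ?andbT ?andbF ?mulr1n ?mulr0n ?mul0r // mulrnAr.
  + move=> a; apply/matrixP => p q.
    case: (mxtens_indexP p) => i u; case: (mxtens_indexP q) => j v.
    rewrite -[star (alpha a)]/(adjmx (alpha a)) adjmxE !alphaE rmorphMn /= sL.
    rewrite -[star (L a)]/(adjmx (L a)) adjmxE.
    have [->|/LN->] := eqVneq (L a j i) 0; first by rewrite rmorph0 !mul0rn.
    by rewrite eq_sym; case: eqP => // ->.
- move=> a; rewrite /mxtrace sum_mxtens_index; apply: eq_bigr => i _.
  under eq_bigr => u _ do rewrite alphaE eqxx /=.
  rewrite mulr_natl -(big_mkord xpredT (fun u => L a i i *+ (u < N i)%N)).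
  rewrite (big_cat_nat (leq0n _) (leqW (Nr i))) /= [X in _ + X]big_nat_cond [X in _ + X]big1 ?addr0.
    rewrite big_nat_cond (eq_bigr (fun=> L a i i)) -?big_nat_cond ?sumr_const_nat ?subn0 //.
    by move=> u /andP[/andP[_ ->]].
  by move=> u /andP[/andP[Nu _] _]; rewrite ltnNge Nu.
- move=> a; apply/matrixP => p j; case: (mxtens_indexP p) => i u.
  rewrite !mxE sum_mxtens_index.
  transitivity (alpha a (mxtens_index (i, u)) (mxtens_index (j, ord0))).
    rewrite (bigD1 j) //= (bigD1 ord0) //= JE !eqxx mulr1.
    rewrite [X in _ + X + _]big1 ?[X in _ + X]big1 ?addr0 // => [k kj|v v0].
      by rewrite big1 // => v _; rewrite JE (negPf kj) mulr0.
    by rewrite JE (negPf v0) andbF mulr0.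
  have u0N : (u == ord0) && (u < N i)%N = (u == ord0).
    by apply/andb_idr => /eqP->; apply: N0.
  rewrite alphaE u0N.
  rewrite (bigD1 i) //= JE eqxx /= big1 ?addr0 ?mulr_natl // => k ki.
  by rewrite JE eq_sym (negPf ki) mul0r.
- apply/matrixP => i j; rewrite !mxE sum_mxtens_index.
  rewrite (bigD1 i) //= (bigD1 ord0) //= adjmxE !JE !eqxx /= !big1 ?addr0.
  + by rewrite rmorph1 mul1r andbT.
  + by move=> k ki; rewrite big1 // => v _; rewrite adjmxE JE (negPf ki) conjC0 mul0r.
  + by move=> v v0; rewrite adjmxE JE (negPf v0) andbF conjC0 mul0r.
Qed.

End Amplification.

(** * Equality of traces and unitary equivalence *)

Section UnitaryEquivalence.
Variable K : numClosedFieldType.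

Lemma adjmx_mul_eq0 m n (A : 'M[K]_(m, n)) : adjmx A *m A = 0 -> A = 0.
Proof. by move=> AA; apply: mxtrace_adj_mul_eq0; rewrite AA mxtrace0. Qed.

(** Polar decomposition for a single eigenvalue: [f] is the spectral projection of [adjmx T *m T] at
    a nonzero eigenvalue and [k] its square root, so that [k^-1 *: (T *m f)] is a partial isometry
    with initial projection [f]. *)
Lemma intertwiner_partial_isometry m1 m2 (T : 'M[K]_(m2, m1)) : T != 0 ->
  exists (f : 'M[K]_m1) (k : K), [/\ f != 0, f *m f = f, adjmx f = f,
    f *m (adjmx T *m T) = (k * k^*) *: f /\ k != 0
    & forall Z, Z *m (adjmx T *m T) = adjmx T *m T *m Z -> Z *m f = f *m Z].
Proof.
move=> T0; set H := adjmx T *m T.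
have HH : adjmx H = H by rewrite adjmxM adjmxK.
have [U [d [UU UU' HE]]] := hermitian_diag HH.
have UH : U *m H *m adjmx U = diag_mx d by rewrite HE !mulmxA UU mul1mx -mulmxA UU mulmx1.
have [a0 da0] : exists a, d 0 a != 0.
  apply/existsP; apply: contraNT T0; rewrite negb_exists => /forallP d0.
  apply/eqP/adjmx_mul_eq0; rewrite -/H HE (_ : diag_mx d = 0) ?mulmx0 ?mul0mx //.
  apply/matrixP => i j; rewrite !mxE.
  by have := d0 i; rewrite negbK => /eqP->; rewrite mul0rn.
set l := d 0 a0 in da0.
have l_ge0 : 0 <= l.
  have -> : l = (diag_mx d) a0 a0 by rewrite !mxE eqxx.
  rewrite -UH -[U in U *m H]adjmxK /H mulmxA -mulmxA -adjmxM mxE.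
  by apply: sumr_ge0 => i _; rewrite adjmxE mulrC -normCK exprn_ge0.
pose delta : 'rV[K]_m1 := \row_a (d 0 a == l)%:R.
pose f := adjmx U *m diag_mx delta *m U.
have conj_mul (x y : 'M[K]_m1) :
    (adjmx U *m x *m U) *m (adjmx U *m y *m U) = adjmx U *m (x *m y) *m U.
  by rewrite !mulmxA -(mulmxA _ U) UU mulmx1.
exists f, (sqrtC l); split.
- apply: contra_neq (_ : diag_mx delta != 0).
    move=> f0; have := congr1 (fun x => U *m x *m adjmx U) f0.
    by rewrite /f mulmx0 mul0mx !mulmxA UU mul1mx -mulmxA UU mulmx1.
  apply/eqP => /matrixP/(_ a0 a0)/eqP; rewrite !mxE eqxx mulr1n eqxx.
  by rewrite oner_eq0.
- rewrite conj_mul mulmx_diag; congr (_ *m diag_mx _ *m _).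
  by apply/rowP => a; rewrite !mxE; case: eqP; rewrite ?mulr0 ?mulr1.
- rewrite !adjmxM adjmxK mulmxA; congr (_ *m _ *m _).
  apply/matrixP => i j; rewrite !mxE (eq_sym i j); case: (j =P i) => [->|_].
    by rewrite !mulr1n rmorph_nat.
  by rewrite conjC0.
- have sl : sqrtC l * (sqrtC l)^* = l.
    by rewrite (CrealP _) ?ger0_real ?sqrtC_ge0 // -expr2 sqrtCK.
  rewrite sl; split; last by rewrite sqrtC_eq0.
  rewrite HE conj_mul mulmx_diag scalemxAl scalemxAr -linearZ /=.
  congr (_ *m diag_mx _ *m _).
  by apply/rowP => a; rewrite !mxE; case: eqP => [->|];
    rewrite ?mul1r ?mulr1 ?mul0r ?mulr0.
- move=> Z ZH; pose Y := U *m Z *m adjmx U.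
  have YE : Z = adjmx U *m Y *m U by rewrite /Y !mulmxA UU' mul1mx -mulmxA UU' mulmx1.
  have Yd : Y *m diag_mx d = diag_mx d *m Y.
    have conj_mul' (x y : 'M[K]_m1) :
        (U *m x *m adjmx U) *m (U *m y *m adjmx U) = U *m (x *m y) *m adjmx U.
      by rewrite !mulmxA -(mulmxA _ (adjmx U)) UU' mulmx1.
    by rewrite -UH /Y !conj_mul' ZH.
  rewrite YE !conj_mul; congr (_ *m _ *m _); apply/matrixP => i j.
  rewrite mul_mx_diag mul_diag_mx !mxE.
  have /matrixP/(_ i j) := Yd; rewrite mul_mx_diag mul_diag_mx [LHS]mxE [RHS]mxE => dY.
  have [Y0|Y0] := eqVneq (Y i j) 0.
    by move: Y0; rewrite !mxE => ->; rewrite mulr0 mul0r.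
  have -> : d 0 i = d 0 j by apply: (mulIf Y0); rewrite -dY mulrC.
  by rewrite mulrC.
Qed.

Section Intertwiner.
Variables (D : starAlgType K) (e : D) (n : nat) (L : D -> 'M[K]_n).
Variables (c : 'I_n -> K) (tau : D -> K) (g : 'I_n -> D).
Hypothesis reg : regular_rep e tau L c g.
Variables (m1 m2 : nat) (alpha : D -> 'M[K]_m1) (beta : D -> 'M[K]_m2).
Hypotheses (e1 : left_id e (smul : D -> D -> D)) (e2 : right_id e (smul : D -> D -> D)).
Hypotheses (ha : star_hom alpha) (hb : star_hom beta).

Let aM x y : alpha (x ** y) = alpha x *m alpha y. Proof. by case: ha. Qed.
Let bM x y : beta (x ** y) = beta x *m beta y. Proof. by case: hb. Qed.
Let aS x : alpha (star x) = adjmx (alpha x). Proof. by case: ha. Qed.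
Let bS x : beta (star x) = adjmx (beta x). Proof. by case: hb. Qed.
Let aL : linear alpha. Proof. by case: ha. Qed.
Let bL : linear beta. Proof. by case: hb. Qed.

Let lin_sum m (Z : D -> 'M[K]_m) : linear Z -> forall (I : finType) (k : I -> K) F,
  Z (\sum_i k i *: F i) = \sum_i k i *: Z (F i).
Proof.
move=> lZ I k F.
have Z0 : Z 0 = 0.
  by have := lZ (-1) 0 0; rewrite scaler0 addr0 scaleN1r addNr.
by elim/big_rec2: _ => [|i x y _ <-]; rewrite ?lZ.
Qed.

(** The analogue of averaging over a finite group; the [g i] and their adjoints act as dual
    bases. *)
Definition casimir (T : 'M[K]_(m2, m1)) :=
  \sum_i beta (star (g i)) *m T *m alpha (g i).

Lemma casimir_intertwines T d : casimir T *m alpha d = beta d *m casimir T.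
Proof.
have [[_ _ sL] _ _ _ gE _ _ _] := reg.
rewrite mulmx_suml mulmx_sumr.
have E1 i : beta (star (g i)) *m T *m alpha (g i) *m alpha d =
    \sum_j L d i j *: (beta (star (g i)) *m T *m alpha (g j)).
  rewrite -mulmxA -aM gE lin_sum // mulmx_sumr.
  by apply: eq_bigr => j _; rewrite -scalemxAr.
have E2 j : beta d *m (beta (star (g j)) *m T *m alpha (g j)) =
    \sum_i L d i j *: (beta (star (g i)) *m T *m alpha (g j)).
  rewrite !mulmxA -bM -[d ** _]starK starM starK gE star_sum.
  under eq_bigr => i _ do rewrite starZ.
  rewrite lin_sum // !mulmx_suml; apply: eq_bigr => i _.
  by rewrite sL -[star (L d)]/(adjmx (L d)) adjmxE conjCK -!scalemxAl.
rewrite (eq_bigr _ (fun i _ => E1 i)) exchange_big.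
by apply: eq_bigr => j _; rewrite E2.
Qed.

(** Orthogonality of characters, by contraposition: if every average vanishes, summing suitable
    entries over matrix units gives zero for the sum of the squared moduli of the trace [t] at the
    [g i]. These span [D], so [t e] would vanish. *)
Lemma exists_intertwiner (p : 'M[K]_m1) (q : 'M[K]_m2) :
  adjmx p = p -> (forall d, \tr (alpha d *m p) = \tr (beta d *m q)) ->
  \tr (alpha e *m p) != 0 ->
  exists T, casimir (q *m T *m p) != 0.
Proof.
move=> pp tr_eq tr0; apply: contra_neqP tr0 => noT.
have [_ _ _ _ _ _ span _] := reg.
pose t d := \tr (alpha d *m p).
have t_star d : t (star d) = (t d)^* .
  by rewrite /t -mxtrace_adj adjmxM pp aS mxtrace_mulC.
have cas0 T : casimir (q *m T *m p) = 0.
  by apply/eqP; apply: contra_notT noT => T0; exists T.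
have tg i : t (g i) = 0.
  apply/eqP; rewrite -normr_eq0 -sqrf_eq0; apply/eqP; move: i isT.
  apply/psumr_eq0P; first by move=> i _; rewrite exprn_ge0.
  transitivity (\sum_i \tr (beta (star (g i)) *m q) * \tr (p *m alpha (g i))).
    apply: eq_bigr => i _; rewrite -tr_eq -/(t _) t_star mxtrace_mulC -/(t _).
    by rewrite mulrC -normCK.
  transitivity (\sum_j \sum_k casimir (q *m delta_mx j k *m p) j k); last first.
    by rewrite big1 // => j _; rewrite big1 // => k _; rewrite cas0 mxE.
  have deltaE (X : 'M[K]_m2) (Y : 'M[K]_m1) j k :
      (X *m delta_mx j k *m Y) j k = X j j * Y k k.
    rewrite -mulmxA mxE (bigD1 j) //= big1 ?addr0; last first.
      move=> i ij; rewrite [X in _ * X]mxE big1 ?mulr0 // => s _.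
      by rewrite mxE (negPf ij) mul0r.
    rewrite [X in _ * X]mxE (bigD1 k) //= big1 ?addr0.
      by rewrite mxE !eqxx mul1r.
    by move=> s sk; rewrite mxE (negPf sk) andbF mul0r.
  have E j k : casimir (q *m delta_mx j k *m p) j k =
      \sum_i (beta (star (g i)) *m q) j j * (p *m alpha (g i)) k k.
    rewrite summxE; apply: eq_bigr => i _.
    by rewrite !mulmxA -(mulmxA _ p) deltaE.
  under [RHS]eq_bigr => j _ do under eq_bigr => k _ do rewrite E.
  rewrite [in RHS](eq_bigr _ (fun j _ => exchange_big _ _ _ _ _ _)) /=.
  rewrite exchange_big; apply: eq_bigr => i _ /=.
  by rewrite /mxtrace mulr_suml; apply: eq_bigr => j _; rewrite mulr_sumr.
have [k ->] := span e.
rewrite lin_sum // mulmx_suml raddf_sum big1 // => i _ /=.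
by rewrite -scalemxAl mxtraceZ -/(t _) tg mulr0.
Qed.

(** Induction on the rank of [p]. A nonzero average yields a partial isometry [v] matching a
    subrepresentation [f] of [p] with one of [q]; removing both pieces keeps the traces equal and
    lowers the rank. *)
Lemma partial_isometry_of_trace k (p : 'M[K]_m1) (q : 'M[K]_m2) :
  (\rank p <= k)%N ->
  adjmx p = p -> p *m p = p -> (forall d, alpha d *m p = p *m alpha d) ->
  alpha e *m p = p ->
  adjmx q = q -> q *m q = q -> (forall d, beta d *m q = q *m beta d) ->
  beta e *m q = q ->
  (forall d, \tr (alpha d *m p) = \tr (beta d *m q)) ->
  exists w : 'M[K]_(m2, m1), [/\ adjmx w *m w = p, w *m adjmx w = q,
    w *m p = w, q *m w = w & forall d, w *m alpha d = beta d *m w].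
Proof.
elim: k p q => [|k ih] p q rk sp pp ap ep sq qq bq eq tr_eq.
all: have [p0|p0] := eqVneq p 0.
1,3: have q0 : q = 0
  by apply: mxtrace_adj_mul_eq0; rewrite sq qq -eq -tr_eq p0 mulmx0 mxtrace0.
1,2: exists 0; rewrite p0 q0 adjmx0; split=> [||||d]; by rewrite ?mul0mx ?mulmx0.
  by move: rk p0; rewrite leqn0 mxrank_eq0 => ->.
have [S T0] : exists S, casimir (q *m S *m p) != 0.
  apply: exists_intertwiner => //; rewrite ep -pp -{1}sp; apply: contra_neq p0.
  exact: mxtrace_adj_mul_eq0.
set T := casimir _ in T0.
have Tab d : T *m alpha d = beta d *m T by exact: casimir_intertwines.
have Tp : T *m p = T.
  rewrite mulmx_suml; apply: eq_bigr => i _.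
  by rewrite !mulmxA -(mulmxA _ (alpha _) p) ap -!(mulmxA _ p) !mulmxA -!(mulmxA _ p p) pp.
have qT : q *m T = T.
  rewrite mulmx_sumr; apply: eq_bigr => i _.
  by rewrite !mulmxA -bq -(mulmxA _ q q) qq.
have [f [x [f0 ff sf [fH x0] fZ]]] := intertwiner_partial_isometry T0.
set H := adjmx T *m T in fH fZ.
have Tab' d : alpha d *m adjmx T = adjmx T *m beta d.
  have := congr1 (@adjmx K _ _) (Tab (star d)).
  by rewrite !adjmxM aS bS !adjmxK.
have fa d : alpha d *m f = f *m alpha d.
  by apply: fZ; rewrite /H mulmxA Tab' -!mulmxA Tab.
have Hp : H *m p = H by rewrite /H -mulmxA Tp.
have xx0 : x * x^* != 0 by rewrite mulf_neq0 // conjC_eq0.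
have fp : f *m p = f.
  by apply: (scalerI xx0); rewrite scalemxAl -fH -mulmxA Hp.
have pf : p *m f = f by rewrite -{1}sf -{1}sp -adjmxM fp sf.
pose v := x^-1 *: (T *m f).
have vab d : v *m alpha d = beta d *m v.
  by rewrite -scalemxAl -mulmxA -fa mulmxA Tab -mulmxA scalemxAr.
have vv : adjmx v *m v = f.
  rewrite adjmxZ adjmxM sf -scalemxAl -scalemxAr scalerA mulmxA -(mulmxA f) -/H fH.
  rewrite -scalemxAl ff scalerA fmorphV /= -invfM mulrC [x^* * x]mulrC divff //.
  by rewrite scale1r.
have vf : v *m f = v by rewrite -scalemxAl -mulmxA ff.
have vp : v *m p = v by rewrite -scalemxAl -mulmxA fp.
have qv : q *m v = v by rewrite -scalemxAr mulmxA qT.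
set p' := p - f; set q' := q - v *m adjmx v.
have vqv : adjmx v *m q = adjmx v by rewrite -{1}sq -adjmxM qv.
have vvv : v *m adjmx v *m (v *m adjmx v) = v *m adjmx v.
  by rewrite mulmxA -(mulmxA v) vv vf.
have p'f : p' *m f = 0 by rewrite mulmxBl pf ff subrr.
have fp' : f *m p' = 0 by rewrite mulmxBr fp ff subrr.
have p'p : p' *m p = p' by rewrite mulmxBl pp fp.
have vp' : v *m p' = 0 by rewrite mulmxBr vp vf subrr.
have q'v : q' *m v = 0 by rewrite mulmxBl qv -mulmxA vv vf subrr.
have sp' : adjmx p' = p' by rewrite adjmxB sp sf.
have sq' : adjmx q' = q' by rewrite adjmxB sq adjmxM adjmxK.
have bv d : beta d *m (v *m adjmx v) = v *m adjmx v *m beta d.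
  rewrite mulmxA -vab -!mulmxA; congr (_ *m _).
  have := congr1 (@adjmx K _ _) (vab (star d)).
  by rewrite !adjmxM aS bS !adjmxK.
have lt_rank : (\rank p' < \rank p)%N.
  apply: rank_ltmx; rewrite ltmxE; apply/andP; split.
    by apply/submxP; exists p'.
  apply: contra_neqN f0 => /submxP[X pX].
  by rewrite -pf pX -mulmxA p'f mulmx0.
have [||||||||||w [ww ww' wp qw wab]] := ih p' q'.
- by rewrite -ltnS (leq_trans lt_rank).
- exact: sp'.
- by rewrite {2}/p' mulmxBr p'p p'f subr0.
- by move=> d; rewrite mulmxBr mulmxBl ap fa.
- by rewrite mulmxBr ep -{1}pf mulmxA ep pf.
- exact: sq'.
- by rewrite {2}/q' mulmxBr mulmxBl qq -mulmxA vqv mulmxA q'v mul0mx subr0.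
- by move=> d; rewrite mulmxBr mulmxBl bq bv.
- by rewrite mulmxBr eq -{1}qv !mulmxA eq qv.
- move=> d; rewrite !mulmxBr !raddfB /= tr_eq; congr (_ - _).
  have -> : beta d *m (v *m adjmx v) = v *m (alpha d *m adjmx v).
    by rewrite !mulmxA vab.
  by rewrite [RHS]mxtrace_mulC -mulmxA vv.
have wv : adjmx w *m v = 0.
  by rewrite -qw adjmxM sq' -mulmxA q'v mulmx0.
have vw : adjmx v *m w = 0.
  by rewrite -[LHS]adjmxK adjmxM adjmxK wv adjmx0.
have wv' : w *m adjmx v = 0.
  by rewrite -wp -mulmxA -sp' -adjmxM vp' adjmx0 mulmx0.
have vw' : v *m adjmx w = 0.
  by rewrite -[LHS]adjmxK adjmxM adjmxK wv' adjmx0.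
exists (w + v); split.
- by rewrite adjmxD mulmxDl !mulmxDr ww vv wv vw addr0 add0r subrK.
- by rewrite adjmxD mulmxDl !mulmxDr ww' wv' vw' addr0 add0r subrK.
- by rewrite mulmxDl vp -{1}wp -mulmxA p'p wp.
- have qq' : q *m q' = q' by rewrite mulmxBr qq mulmxA qv.
  by rewrite mulmxDr qv -{1}qw mulmxA qq' qw.
- by move=> d; rewrite mulmxDl mulmxDr wab vab.
Qed.

Theorem unitary_equivalence :
  (forall d, \tr (alpha d) = \tr (beta d)) ->
  exists w : 'M[K]_(m2, m1), [/\ adjmx w *m w = alpha e, w *m adjmx w = beta e
    & forall d, w *m alpha d = beta d *m w].
Proof.
move=> tr_eq.
have aE d : alpha d *m alpha e = alpha d by rewrite -aM e2.
have bE d : beta d *m beta e = beta d by rewrite -bM e2.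
have aE' d : alpha e *m alpha d = alpha d by rewrite -aM e1.
have bE' d : beta e *m beta d = beta d by rewrite -bM e1.
have se := star_unit e1.
have [||||||||||w [ww ww' _ _ wab]] :=
  @partial_isometry_of_trace (\rank (alpha e)) (alpha e) (beta e).
all: rewrite ?aE ?bE ?aE' ?bE' //; try by move=> d; rewrite ?aE ?aE' ?bE ?bE'.
- by rewrite -aS se.
- by rewrite -bS se.
by exists w.
Qed.

End Intertwiner.
End UnitaryEquivalence.

(** * Matrices as a C*-algebra *)

Section OperatorNorm.
Variable R : realType.
Local Notation C := R[i].

(** Real part of the Hermitian product: it induces the same norm, and its Cauchy-Schwarz inequality
    is one between reals. *)
Definition ip n (u v : 'cV[C]_n) : R := complex.Re (\tr (adjmx u *m v)).
Definition vnorm n (v : 'cV[C]_n) : R := Num.sqrt (ip v v).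

Lemma ReD (x y : C) : complex.Re (x + y) = complex.Re x + complex.Re y.
Proof. by case: x y => [? ?] [? ?]. Qed.

Lemma ReM_real (r : R) (x : C) : complex.Re ((r%:C)%C * x) = r * complex.Re x.
Proof. by case: x => a b /=; rewrite mul0r subr0. Qed.

Lemma ReJ (x : C) : complex.Re x^* = complex.Re x.
Proof. by case: x. Qed.

Lemma ipC n (u v : 'cV[C]_n) : ip u v = ip v u.
Proof. by rewrite /ip -[X in complex.Re (\tr X)]adjmxK mxtrace_adj ReJ adjmxM adjmxK. Qed.

Lemma ipDr n (u v w : 'cV[C]_n) : ip u (v + w) = ip u v + ip u w.
Proof. by rewrite /ip mulmxDr raddfD ReD. Qed.

Lemma ipZr n (u v : 'cV[C]_n) (r : R) : ip u ((r%:C)%C *: v) = r * ip u v.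
Proof. by rewrite /ip -scalemxAr mxtraceZ ReM_real. Qed.

Lemma ip0r n (u : 'cV[C]_n) : ip u 0 = 0.
Proof. by rewrite /ip mulmx0 mxtrace0. Qed.

Lemma ipE n (v : 'cV[C]_n) : \tr (adjmx v *m v) = ((ip v v)%:C)%C.
Proof. by rewrite /ip RRe_real // ger0_real // mxtrace_adj_mul_ge0. Qed.

Lemma ip_ge0 n (v : 'cV[C]_n) : 0 <= ip v v.
Proof. by rewrite -ler0c -ipE mxtrace_adj_mul_ge0. Qed.

Lemma vnorm_ge0 n (v : 'cV[C]_n) : 0 <= vnorm v.
Proof. exact: sqrtr_ge0. Qed.

Lemma sqr_vnorm n (v : 'cV[C]_n) : vnorm v ^+ 2 = ip v v.
Proof. by rewrite sqr_sqrtr // ip_ge0. Qed.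

Lemma sqr_vnormC n (v : 'cV[C]_n) :
  ((vnorm v)%:C)%C ^+ 2 = \tr (adjmx v *m v).
Proof. by rewrite -rmorphXn sqr_vnorm ipE. Qed.

Lemma vnorm_eq0 n (v : 'cV[C]_n) : vnorm v = 0 -> v = 0.
Proof.
move=> v0; apply: mxtrace_adj_mul_eq0.
by rewrite ipE -sqr_vnorm v0 expr0n rmorph0.
Qed.

Lemma vnormZ n (k : C) (v : 'cV[C]_n) : ((vnorm (k *: v))%:C)%C = `|k| * ((vnorm v)%:C)%C.
Proof.
apply/eqP; rewrite -(@eqrXn2 _ 2%N) //; last 2 first.
- by rewrite ler0c vnorm_ge0.
- by apply: mulr_ge0; rewrite ?normr_ge0 // ler0c vnorm_ge0.
rewrite exprMn !sqr_vnormC adjmxZ -scalemxAl -scalemxAr !mxtraceZ.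
by rewrite normCK [k * k^*]mulrC -mulrA.
Qed.

Lemma cauchy_schwarz n (u v : 'cV[C]_n) : ip u v <= vnorm u * vnorm v.
Proof.
have [u0|u0] := eqVneq (vnorm u) 0.
  by rewrite (vnorm_eq0 u0) ipC ip0r mulr_ge0 ?vnorm_ge0.
have [v0|v0] := eqVneq (vnorm v) 0.
  by rewrite (vnorm_eq0 v0) ip0r mulr_ge0 ?vnorm_ge0.
have u1 : 0 < vnorm u by rewrite lt_def u0 vnorm_ge0.
have v1 : 0 < vnorm v by rewrite lt_def v0 vnorm_ge0.
have := ip_ge0 (((vnorm v)%:C)%C *: u + ((- vnorm u)%:C)%C *: v).
rewrite ipDr !ipZr ![ip (_ + _) _]ipC !ipDr !ipZr -!sqr_vnorm (ipC v u).
set a := vnorm u in u1 *; set b := vnorm v in v1 *; set x := ip u v => h.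
have : 0 <= (a * b) * (a * b - x) by nra.
by rewrite pmulr_rge0 ?mulr_gt0 // subr_ge0.
Qed.

Lemma vnormD n (u v : 'cV[C]_n) : vnorm (u + v) <= vnorm u + vnorm v.
Proof.
rewrite -(@ler_pXn2r _ 2%N) ?nnegrE ?addr_ge0 ?vnorm_ge0 //.
rewrite sqr_vnorm ipDr ![ip (_ + _) _]ipC !ipDr -!sqr_vnorm (ipC v u).
by have := cauchy_schwarz u v; nra.
Qed.

Lemma vnorm0 n : vnorm (0 : 'cV[C]_n) = 0.
Proof. by rewrite /vnorm /ip mulmx0 mxtrace0 sqrtr0. Qed.

Lemma vnorm_sum n I (r : seq I) (F : I -> 'cV[C]_n) :
  vnorm (\sum_(i <- r) F i) <= \sum_(i <- r) vnorm (F i).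
Proof.
elim/big_rec2: _ => [|i x y _ h]; first by rewrite vnorm0.
by rewrite (le_trans (vnormD _ _)) // lerD2l.
Qed.

Lemma normc_le_vnorm n (v : 'cV[C]_n) j : `|v j 0| <= ((vnorm v)%:C)%C.
Proof.
rewrite -(@ler_pXn2r _ 2%N) ?nnegrE ?normr_ge0 //; last by rewrite ler0c vnorm_ge0.
rewrite sqr_vnormC mxtrace_adj_mul big_ord1 (bigD1 j) //= lerDl.
by apply: sumr_ge0 => i _; rewrite exprn_ge0.
Qed.

Definition opnorm n (A : 'M[C]_n) : R :=
  sup [set r | exists2 v : 'cV[C]_n, vnorm v <= 1 & r = vnorm (A *m v)].

Definition absc (x : C) : R := complex.Re `|x|.
Lemma abscE (x : C) : `|x| = ((absc x)%:C)%C.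
Proof. by rewrite /absc RRe_real ?normr_real. Qed.
Lemma absc_ge0 (x : C) : 0 <= absc x.
Proof. by rewrite -ler0c -abscE. Qed.
#[local] Hint Resolve absc_ge0 : core.

Let vnormZ' n k (v : 'cV[C]_n) : vnorm (k *: v) = absc k * vnorm v.
Proof. by apply: (@complexI R); rewrite vnormZ rmorphM /= -abscE. Qed.

Lemma entrywise_bound n (A : 'M[C]_n) (v : 'cV[C]_n) :
  vnorm (A *m v) <= (\sum_i \sum_j absc (A i j)) * vnorm v.
Proof.
have -> : A *m v = \sum_i \sum_j (A i j * v j 0) *: delta_mx i 0.
  apply/colP => k; rewrite mxE [RHS]summxE [RHS](bigD1 k) //= [X in _ = _ + X]big1 ?addr0.
    rewrite summxE; apply: eq_bigr => j _.
    by rewrite !mxE !eqxx mulr1.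
  move=> i ik; rewrite summxE big1 // => j _.
  by rewrite !mxE eq_sym (negPf ik) mulr0.
have nd i : vnorm (delta_mx i 0 : 'cV[C]_n) = 1.
  apply/eqP; rewrite -(@eqrXn2 _ 2%N) ?vnorm_ge0 // sqr_vnorm expr1n; apply/eqP.
  apply: (@complexI R); rewrite -ipE mxtrace_adj_mul big_ord1 (bigD1 i) //= big1.
    by rewrite !mxE !eqxx normr1 expr1n addr0.
  by move=> j ji; rewrite mxE (negPf ji) normr0 expr0n.
rewrite mulr_suml (le_trans (vnorm_sum _ _)) //; apply: ler_sum => i _.
rewrite mulr_suml (le_trans (vnorm_sum _ _)) //; apply: ler_sum => j _.
rewrite vnormZ' nd mulr1 -lecR -abscE normrM rmorphM /= -abscE.
by rewrite ler_wpM2l // normc_le_vnorm.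
Qed.

Let opset_sup n (A : 'M[C]_n) :
  has_sup [set r | exists2 v : 'cV[C]_n, vnorm v <= 1 & r = vnorm (A *m v)].
Proof.
split; first by exists (vnorm (A *m 0)), 0; rewrite ?vnorm0.
exists (\sum_i \sum_j absc (A i j)) => _ [v v1 ->].
apply: le_trans (entrywise_bound A v) _; rewrite ler_piMr //.
by do 2!apply: sumr_ge0 => ? _.
Qed.

Lemma opnorm_ge0 n (A : 'M[C]_n) : 0 <= opnorm A.
Proof.
apply: sup_upper_bound; first exact: opset_sup.
by exists 0; rewrite ?mulmx0 vnorm0.
Qed.

Lemma opnorm_bound n (A : 'M[C]_n) (v : 'cV[C]_n) :
  vnorm (A *m v) <= opnorm A * vnorm v.
Proof.
have [v0|v0] := eqVneq (vnorm v) 0.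
  by rewrite v0 (vnorm_eq0 v0) mulmx0 vnorm0 mulr0.
have v1 : 0 < vnorm v by rewrite lt_def v0 vnorm_ge0.
have vV : 0 <= (vnorm v)^-1 by rewrite invr_ge0 vnorm_ge0.
have nV : absc (((vnorm v)^-1)%:C)%C = (vnorm v)^-1.
  by rewrite /absc ger0_norm ?ler0c.
have : vnorm (A *m ((((vnorm v)^-1)%:C)%C *: v)) <= opnorm A.
  apply: sup_upper_bound; first exact: opset_sup.
  by exists ((((vnorm v)^-1)%:C)%C *: v); rewrite // vnormZ' nV mulVf.
by rewrite -scalemxAr vnormZ' nV mulrC ler_pdivrMr.
Qed.

Lemma opnorm_le n (A : 'M[C]_n) (t : R) : 0 <= t ->
  (forall v, vnorm (A *m v) <= t * vnorm v) -> opnorm A <= t.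
Proof.
move=> t0 At; apply: ge_sup; first by case: (opset_sup A).
by move=> _ [v v1 ->]; rewrite (le_trans (At v)) // ler_piMr.
Qed.

Lemma opnormD n (A B : 'M[C]_n) : opnorm (A + B) <= opnorm A + opnorm B.
Proof.
apply: opnorm_le; first by rewrite addr_ge0 ?opnorm_ge0.
move=> v; rewrite mulmxDl mulrDl (le_trans (vnormD _ _)) //.
by rewrite lerD // opnorm_bound.
Qed.

Let opnormZ_le n (k : C) (A : 'M[C]_n) : opnorm (k *: A) <= absc k * opnorm A.
Proof.
apply: opnorm_le; first by rewrite mulr_ge0 ?opnorm_ge0.
by move=> v; rewrite -scalemxAl vnormZ' -mulrA ler_wpM2l // opnorm_bound.
Qed.

Lemma opnormZ n (k : C) (A : 'M[C]_n) : opnorm (k *: A) = absc k * opnorm A.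
Proof.
apply/eqP; rewrite eq_le opnormZ_le /=.
have [->|k0] := eqVneq k 0.
  by rewrite /absc normr0 mul0r opnorm_ge0.
have nk : absc k^-1 * absc k = 1.
  by apply: (@complexI R); rewrite rmorphM /= -!abscE -normrM mulVf // normr1 rmorph1.
have nk0 : 0 < absc k by rewrite lt_def absc_ge0 andbT; apply: contra_eqN nk => /eqP->;
  rewrite mulr0 eq_sym oner_eq0.
have := opnormZ_le k^-1 (k *: A); rewrite scalerA mulVf // scale1r.
by rewrite -(ler_pM2l nk0) mulrA (mulrC (absc k) (absc k^-1)) nk mul1r.
Qed.

Lemma opnormM n (A B : 'M[C]_n) : opnorm (A *m B) <= opnorm A * opnorm B.
Proof.
apply: opnorm_le; first by rewrite mulr_ge0 ?opnorm_ge0.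
move=> v; rewrite -mulmxA (le_trans (opnorm_bound _ _)) // -mulrA.
by rewrite ler_wpM2l ?opnorm_ge0 // opnorm_bound.
Qed.

Lemma opnorm_eq0 n (A : 'M[C]_n) : opnorm A = 0 -> A = 0.
Proof.
move=> A0; apply/matrixP => i j.
have : A *m delta_mx j 0 = 0 :> 'cV[C]_n.
  apply: vnorm_eq0; apply/eqP; rewrite eq_le vnorm_ge0 andbT.
  by rewrite (le_trans (opnorm_bound _ _)) // A0 mul0r.
by rewrite -colE => /colP/(_ i); rewrite !mxE.
Qed.

Let opnorm_adj_sqr n (A : 'M[C]_n) : opnorm A ^+ 2 <= opnorm (adjmx A *m A).
Proof.
set t := opnorm (adjmx A *m A).
suff : opnorm A <= Num.sqrt t.
  move=> h; have t0 : 0 <= t := opnorm_ge0 _; rewrite -(sqr_sqrtr t0).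
  by rewrite ler_pXn2r ?nnegrE ?opnorm_ge0 ?sqrtr_ge0.
apply: opnorm_le; first exact: sqrtr_ge0.
move=> v; rewrite -(@ler_pXn2r _ 2%N) ?nnegrE ?mulr_ge0 ?vnorm_ge0 ?sqrtr_ge0 //.
rewrite exprMn [Num.sqrt t ^+ 2]sqr_sqrtr ?opnorm_ge0 // (sqr_vnorm (A *m v)).
have -> : ip (A *m v) (A *m v) = ip v (adjmx A *m A *m v).
  by rewrite /ip adjmxM !mulmxA.
rewrite (le_trans (cauchy_schwarz _ _)) // mulrC expr2 mulrA.
by rewrite ler_wpM2r ?vnorm_ge0 // opnorm_bound.
Qed.

Let opnorm_le_adj n (A : 'M[C]_n) : opnorm A <= opnorm (adjmx A).
Proof.
have [A0|A0] := eqVneq (opnorm A) 0; first by rewrite A0 opnorm_ge0.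
have A1 : 0 < opnorm A by rewrite lt_def A0 opnorm_ge0.
rewrite -(ler_pM2r A1); apply: le_trans (opnormM _ _).
exact: opnorm_adj_sqr.
Qed.

Lemma opnorm_cstar n (A : 'M[C]_n) : opnorm (adjmx A *m A) = opnorm A ^+ 2.
Proof.
apply: le_anti; apply/andP; split; last exact: opnorm_adj_sqr.
apply: le_trans (opnormM _ _) _.
apply: (@ler_wpM2r _ (opnorm A) (opnorm_ge0 A) (opnorm (adjmx A))).
by have := opnorm_le_adj (adjmx A); rewrite adjmxK.
Qed.

Lemma opnorm_entry n (A : 'M[C]_n) i j : `|A i j| <= ((opnorm A)%:C)%C.
Proof.
have := normc_le_vnorm (A *m delta_mx j 0) i; rewrite -colE mxE => /le_trans; apply.
rewrite lecR colE (le_trans (opnorm_bound _ _)) // ler_piMr ?opnorm_ge0 //.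
rewrite -(@ler_pXn2r _ 2%N) ?nnegrE ?vnorm_ge0 // sqr_vnorm expr1n -lecR -ipE.
rewrite mxtrace_adj_mul big_ord1 (bigD1 j) //= big1.
  by rewrite !mxE !eqxx normr1 expr1n addr0.
by move=> k kj; rewrite mxE (negPf kj) normr0 expr0n.
Qed.

Lemma opnorm_le_entries n (A : 'M[C]_n) :
  opnorm A <= \sum_i \sum_j absc (A i j).
Proof.
apply: opnorm_le; first by do 2!apply: sumr_ge0 => ? _.
exact: entrywise_bound.
Qed.

End OperatorNorm.

(* ['M[R[i]]_n] under another name, as the library norms matrices by their
   largest entry. *)
Definition opmx (R : realType) n := 'M[R[i]]_n.

Section OperatorCStarAlgebra.
Variables (R : realType) (n : nat).
Local Notation C := R[i].
Local Notation M := (opmx R n).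

HB.instance Definition _ := StarAlgebra.copy M 'M[R[i]]_n.

Let norm (A : M) : C := ((opnorm (A : 'M[C]_n))%:C)%C.

Fact opmx_normD (A B : M) : norm (A + B) <= norm A + norm B.
Proof. by rewrite -rmorphD lecR opnormD. Qed.
Fact opmx_normZ (k : C) (A : M) : norm (k *: A) = `|k| * norm A.
Proof. by rewrite /norm opnormZ rmorphM /= -abscE. Qed.
Fact opmx_norm0 (A : M) : norm A = 0 -> A = 0.
Proof. by move=> /(@complexI R) /opnorm_eq0. Qed.
HB.instance Definition _ := Lmodule_isNormed.Build C M
  opmx_normD opmx_normZ opmx_norm0.

Lemma opmx_normE (A : M) : `|A| = ((opnorm (A : 'M[C]_n))%:C)%C.
Proof. by []. Qed.

Fact opmx_normM (A B : M) : `|A ** B| <= `|A| * `|B|.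
Proof. by rewrite !opmx_normE -rmorphM lecR opnormM. Qed.
Fact opmx_cstar (A : M) : `|star A ** A| = `|A| ^+ 2.
Proof. by rewrite !opmx_normE -rmorphXn /= -opnorm_cstar. Qed.

Lemma Re_le_absc (x : C) : `|complex.Re x| <= absc x.
Proof. by rewrite -lecR -abscE normc_ge_Re. Qed.

Lemma Im_le_absc (x : C) : `|complex.Im x| <= absc x.
Proof.
rewrite -(@ler_pXn2r _ 2%N) ?nnegrE ?absc_ge0 // -lecR.
have -> : ((absc x ^+ 2)%:C)%C = `|x| ^+ 2 by rewrite rmorphXn /= -abscE.
by rewrite -add_Re2_Im2 lecR real_normK ?num_real // lerDr sqr_ge0.
Qed.

Lemma absc_le (x : C) : absc x <= `|complex.Re x| + `|complex.Im x|.
Proof.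
rewrite -(@ler_pXn2r _ 2%N) ?nnegrE ?absc_ge0 ?addr_ge0 // -lecR.
have -> : ((absc x ^+ 2)%:C)%C = `|x| ^+ 2 by rewrite rmorphXn /= -abscE.
rewrite -add_Re2_Im2 lecR sqrrD !real_normK ?num_real // -addrA lerD2l lerDr.
by rewrite mulrn_wge0 // mulr_ge0.
Qed.

Fact opmx_complete (F : set_system M) : ProperFilter F -> cauchy F -> cvg F.
Proof.
move=> FF /cauchy_ballP Fc.
have Fc' (d : R) : 0 < d -> \forall A & B \near F, opnorm ((A : 'M[C]_n) - B) < d.
  move=> d0; have dC : 0 < (d%:C)%C by rewrite ltcR.
  have := Fc _ dC; apply: filterS => -[A B] /=.
  by rewrite -ball_normE /= opmx_normE ltcR.
have coord (h : C -> R) : (forall x y, h (x - y) = h x - h y) ->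
    (forall x, `|h x| <= absc x) -> forall i j,
    cvg ((fun A : M => h ((A : 'M[C]_n) i j)) @ F).
  move=> hB hle i j; apply: cauchy_cvg; apply/cauchy_ballP => d d0.
  rewrite near_map2; have := Fc' d d0; apply: filterS => -[A B] /= AB.
  rewrite /ball /= -hB (le_lt_trans (hle _)) // (le_lt_trans _ AB) //.
  rewrite -lecR -abscE.
  by have := opnorm_entry ((A : 'M[C]_n) - B) i j; rewrite !mxE.
have Re_lim i j := coord (@complex.Re R) (fun x y => _) Re_le_absc i j.
have Im_lim i j := coord (@complex.Im R) (fun x y => _) Im_le_absc i j.
have ReB (x y : C) : complex.Re (x - y) = complex.Re x - complex.Re y by case: x y => ? ? [].
have ImB (x y : C) : complex.Im (x - y) = complex.Im x - complex.Im y by case: x y => ? ? [].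
pose l : 'M[C]_n := \matrix_(i, j)
  Complex (lim ((fun A : M => complex.Re ((A : 'M[C]_n) i j)) @ F))
          (lim ((fun A : M => complex.Im ((A : 'M[C]_n) i j)) @ F)).
apply/cvg_ex; exists (l : M); apply/cvgrPdist_lt => e e0.
have [d d0 eE] : exists2 d : R, 0 < d & e = (d%:C)%C.
  exists (complex.Re e); last by rewrite RRe_real ?gtr0_real.
  by rewrite -ltcR RRe_real ?gtr0_real.
(* Each of the [n * n] entries contributes less than [2 d']; the extra 1 makes the total strictly
   less than [d] and covers [n = 0]. *)
pose d' := d / (n * n).*2.+1%:R.
have d'0 : 0 < d' by rewrite divr_gt0.
have near_coord : \forall A \near F, forall ij : 'I_n * 'I_n,
    absc ((l - (A : 'M[C]_n)) ij.1 ij.2) < d' + d'.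
  apply: filter_forall => -[i j] /=.
  have /cvgrPdist_lt /(_ _ d'0) hRe := Re_lim ReB i j.
  have /cvgrPdist_lt /(_ _ d'0) hIm := Im_lim ImB i j.
  near=> A; apply: le_lt_trans (absc_le _) _; rewrite !mxE ReB ImB /=.
  by apply: ltrD; near: A.
apply: filterS near_coord => A hA; rewrite opmx_normE eE ltcR.
apply: le_lt_trans (opnorm_le_entries _) _.
apply: (@le_lt_trans _ _ (\sum_(i < n) \sum_(j < n) (d' + d'))).
  by apply: ler_sum => i _; apply: ler_sum => j _; apply/ltW/(hA (i, j)).
rewrite !sumr_const !card_ord -mulrnA -mulr2n -mulrnA mulnC muln2.
rewrite -mulr_natr /d' mulrAC ltr_pdivrMr // ltr_pM2l // ltr_nat.
Unshelve. all: by end_near. Qed.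

HB.instance Definition _ := Uniform_isComplete.Build M opmx_complete.
HB.instance Definition _ := StarAlgebra_isCStar.Build R M opmx_normM opmx_cstar.

End OperatorCStarAlgebra.

(** * Dilations *)

Section Vectorisation.
Variables (K : numClosedFieldType) (m k : nat).

(** A matrix is read as a tensor, so that [amplify A], that is [k] copies of [A], acts by left
    multiplication. *)
Definition vectorise (X : 'M[K]_(m, k)) : 'cV[K]_(m * k) :=
  \col_p X (mxtens_unindex p).1 (mxtens_unindex p).2.

Definition amplify (A : 'M[K]_m) : 'M[K]_(m * k) := A *t 1%:M.

Lemma vectorise_linear : linear vectorise.
Proof. by move=> c X Y; apply/colP => p; rewrite !mxE. Qed.

Lemma amplify_linear : linear amplify.
Proof. by move=> c X Y; apply/matrixP => p q; rewrite !mxE mulrDl mulrA. Qed.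

Lemma amplifyM A B : amplify (A *m B) = amplify A *m amplify B.
Proof. by rewrite /amplify tensmx_mul mulmx1. Qed.

Lemma amplify_adj A : amplify (adjmx A) = adjmx (amplify A).
Proof.
apply/matrixP => p q; rewrite !mxE rmorphM /= rmorph_nat.
by rewrite (eq_sym (mxtens_unindex q).2).
Qed.

Lemma amplify_vectorise A X : amplify A *m vectorise X = vectorise (A *m X).
Proof.
apply/colP => p; rewrite !mxE; case: (mxtens_indexP p) => i u.
rewrite sum_mxtens_index mxtens_indexK /=; apply: eq_bigr => j _.
rewrite (bigD1 u) //= tensmxE !mxE mxtens_indexK eqxx mulr1 big1 ?addr0 // => v vu.
by rewrite tensmxE mxE eq_sym (negPf vu) mulr0 mul0r.
Qed.

Lemma vectorise_dot X Y :
  adjmx (vectorise X) *m vectorise Y = (\tr (adjmx X *m Y))%:M.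
Proof.
apply/matrixP => i j; rewrite !ord1 !mxE mulr1n sum_mxtens_index exchange_big.
apply: eq_bigr => u _; rewrite mxE; apply: eq_bigr => v _.
by rewrite !mxE mxtens_indexK.
Qed.

End Vectorisation.

Section Halmos.
Variable K : numClosedFieldType.

Lemma adj_block m1 m2 n1 n2 (a : 'M[K]_(m1, n1)) (b : 'M[K]_(m1, n2)) c
    (d : 'M[K]_(m2, n2)) : adjmx (block_mx a b c d) =
  block_mx (adjmx a) (adjmx c) (adjmx b) (adjmx d).
Proof. by rewrite /adjmx tr_block_mx map_block_mx. Qed.

Lemma partial_isometry_adj n (w : 'M[K]_n) : w *m adjmx w *m w = w ->
  adjmx w *m w *m adjmx w = adjmx w.
Proof.
by move=> www; have := congr1 (@adjmx K _ _) www; rewrite !adjmxM adjmxK mulmxA.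
Qed.

(** The off-diagonal entries, in general square roots of defects, are the defect projections
    themselves, as [w] will be a partial isometry. *)
Definition halmos n (w : 'M[K]_n) : 'M[K]_(n + n) :=
  block_mx w (1%:M - w *m adjmx w) (1%:M - adjmx w *m w) (adjmx w).

Lemma adj_halmos n (w : 'M[K]_n) : adjmx (halmos w) = halmos (adjmx w).
Proof. by rewrite /halmos adj_block !(adjmxB, adjmxM, adjmxK, adjmx1). Qed.

Lemma halmos_unitary n (w : 'M[K]_n) : w *m adjmx w *m w = w ->
  halmos w *m adjmx (halmos w) = 1%:M.
Proof.
move=> www; have www' : adjmx w *m w *m adjmx w = adjmx w.
  exact: partial_isometry_adj.
rewrite adj_halmos mulmx_block adjmxK scalar_mx_block.
set p := adjmx w *m w; set q := w *m adjmx w.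
have wp : w *m p = w by rewrite mulmxA.
have pw : p *m adjmx w = adjmx w by [].
have wq : adjmx w *m q = adjmx w by rewrite mulmxA.
have qw : q *m w = w by [].
have pp : p *m p = p by rewrite {2}/p mulmxA pw.
have qq : q *m q = q by rewrite {2}/q mulmxA qw.
rewrite !(mulmxBl, mulmxBr, mul1mx, mulmx1) wp pw wq qw pp qq -/p -/q.
by rewrite !subrr !subr0 !addr0 subrK addrCA subrr addr0.
Qed.

(* On the doubled space the partial isometry [Y *m adjmx X], which commutes with
   the action of [D], becomes a unitary; [rhoB] is [beta] conjugated by it. *)
Theorem glue (A B D : starAlgType K) (phiA : D -> A) (phiB : D -> B) N r
    (alpha : A -> 'M[K]_N) (beta : B -> 'M[K]_N) (X Y : 'M[K]_(N, r))
    (S : D -> 'M[K]_r) :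
  star_hom alpha -> star_hom beta -> (forall d, star (phiA d) = phiA (star d)) ->
  (forall d, alpha (phiA d) = beta (phiB d)) ->
  adjmx X *m X = 1%:M -> adjmx Y *m Y = 1%:M ->
  (forall d, alpha (phiA d) *m X = X *m S d) ->
  (forall d, beta (phiB d) *m Y = Y *m S d) ->
  exists (rhoA : A -> 'M[K]_(N + N)) (rhoB : B -> 'M[K]_(N + N)),
  [/\ star_hom rhoA, star_hom rhoB, forall d, rhoA (phiA d) = rhoB (phiB d),
      forall a (x : 'cV_N), rhoA a *m col_mx x 0 = col_mx (alpha a *m x) 0
    & forall b (u u' : 'cV_r), beta b *m (Y *m u) = Y *m u' ->
        rhoB b *m col_mx (X *m u) 0 = col_mx (X *m u') 0].
Proof.
move=> [lA mA sA] [lB mB sB] sphi ab XX YY aX bY.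
pose w := Y *m adjmx X.
have wX : w *m X = Y by rewrite /w -mulmxA XX mulmx1.
have wY : adjmx w *m Y = X by rewrite /w adjmxM adjmxK -mulmxA YY mulmx1.
have www : w *m adjmx w *m w = w.
  by rewrite {3}/w -mulmxA (mulmxA (adjmx w)) wY mulmxA wX.
have www' : adjmx w *m w *m adjmx w = adjmx w.
  exact: partial_isometry_adj.
pose U := halmos w.
have UU : U *m adjmx U = 1%:M by apply: halmos_unitary.
have UU' : adjmx U *m U = 1%:M.
  have := @halmos_unitary _ (adjmx w); rewrite -adj_halmos !adjmxK; exact.
pose dbl (Z : 'M[K]_N) : 'M[K]_(N + N) := block_mx Z 0 0 Z.
have dblM Z Z' : dbl (Z *m Z') = dbl Z *m dbl Z'.
  by rewrite /dbl mulmx_block !mulmx0 !mul0mx !addr0 !add0r.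
have dbl_adj Z : dbl (adjmx Z) = adjmx (dbl Z) by rewrite /dbl adj_block !adjmx0.
have dblL k Z Z' : dbl (k *: Z + Z') = k *: dbl Z + dbl Z'.
  by rewrite /dbl scale_block_mx add_block_mx !scaler0 !addr0.
have SE d : S d = adjmx X *m alpha (phiA d) *m X.
  by rewrite -mulmxA aX mulmxA XX mul1mx.
(* [Y] intertwines by hypothesis; for [adjmx X] adjoints are taken, which is possible because [S]
   respects stars. *)
have wD d : w *m alpha (phiA d) = alpha (phiA d) *m w.
  have sS : adjmx (S (star d)) = S d.
    rewrite !SE -sphi sA -[star (alpha _)]/(adjmx _) !adjmxM !adjmxK.
    by rewrite mulmxA.
  rewrite /w -mulmxA -[alpha _ in LHS]adjmxK -adjmxM.
  rewrite -[adjmx (alpha _)]/(star (alpha (phiA d))) -sA sphi aX adjmxM sS.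
  by rewrite ab !mulmxA bY.
have wD' d : adjmx w *m alpha (phiA d) = alpha (phiA d) *m adjmx w.
  have := congr1 (@adjmx K _ _) (wD (star d)); rewrite !adjmxM.
  by rewrite -sphi sA -[star (alpha _)]/(adjmx _) adjmxK.
have UD d : U *m dbl (alpha (phiA d)) = dbl (alpha (phiA d)) *m U.
  rewrite /U /halmos /dbl !mulmx_block !(mulmx0, mul0mx, addr0, add0r).
  have E1 : w *m adjmx w *m alpha (phiA d) = alpha (phiA d) *m (w *m adjmx w).
    by rewrite -mulmxA wD' mulmxA wD mulmxA.
  have E2 : adjmx w *m w *m alpha (phiA d) = alpha (phiA d) *m (adjmx w *m w).
    by rewrite -mulmxA wD mulmxA wD' mulmxA.
  by rewrite !(mulmxBl, mulmxBr) !mul1mx !mulmx1 E1 E2 wD wD'.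
(* The range of [X] is the initial space of [w]: there the defect [1 - adjmx w *m w] vanishes and
   [U] acts as [w] alone. *)
have U0 (u : 'cV[K]_r) : U *m col_mx (X *m u) 0 = col_mx (Y *m u) 0.
  rewrite mul_block_col !mulmx0 !addr0 mulmxA wX mulmxBl mul1mx.
  by rewrite -(mulmxA (adjmx w)) (mulmxA w) wX mulmxA wY subrr.
exists (fun a => dbl (alpha a)), (fun b => adjmx U *m dbl (beta b) *m U); split.
- split=> [k a b|a b|a].
  + by rewrite lA dblL.
  + by rewrite mA dblM.
  + by rewrite sA dbl_adj.
- split=> [k a b|a b|b].
  + by rewrite lB dblL mulmxDr mulmxDl -scalemxAr -scalemxAl.
  + rewrite mB -[beta a ** beta b]/(beta a *m beta b) dblM.
    rewrite -[RHS]/(adjmx U *m dbl (beta a) *m U *m (adjmx U *m dbl (beta b) *m U)).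
    by rewrite !mulmxA -(mulmxA _ U) UU mulmx1.
  + rewrite sB -[star (beta b)]/(adjmx (beta b)) dbl_adj.
    by rewrite -[RHS]/(adjmx _) !adjmxM adjmxK mulmxA.
- by move=> d /=; rewrite -ab -mulmxA -UD mulmxA UU' mul1mx.
- by move=> a x; rewrite /= mul_block_col !mulmx0 mul0mx !addr0.
- move=> b u u' bu; rewrite -mulmxA U0 -mulmxA mul_block_col !mulmx0 mul0mx !addr0 bu.
  by rewrite -U0 mulmxA UU' mul1mx.
Qed.

End Halmos.

Section Dilation.
Variables (K : numClosedFieldType) (A B D P : starAlgType K).
Variables (eA : A) (eB : B) (e : P) (phiA : D -> A) (phiB : D -> B).
Variables (sigmaA : A -> P) (sigmaB : B -> P) (sA : seq A) (sB : seq B).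
Hypotheses (hphiA : star_hom phiA) (hsigmaA : star_hom sigmaA)
           (hsigmaB : star_hom sigmaB).
Hypotheses (e1 : left_id e (smul : P -> P -> P)) (e2 : right_id e (smul : P -> P -> P)).
Hypotheses (sigmaA1 : sigmaA eA = e) (sigmaB1 : sigmaB eB = e).
Hypothesis sigma_phi : forall d, sigmaA (phiA d) = sigmaB (phiB d).
Hypotheses (sAE : forall a, lspan sA a) (sBE : forall b, lspan sB b).

(** The unit is in the range of [sigmaA], so these spans increase with [j] even though only words
    with exactly [j] letters are listed. *)
Fixpoint words j : seq P := if j is j'.+1 then
  [seq sigmaA a ** w | a <- sA, w <- words j'] ++
  [seq sigmaB b ** w | b <- sB, w <- words j'] else [:: e].

Let aL : linear sigmaA. Proof. by case: hsigmaA. Qed.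
Let bL : linear sigmaB. Proof. by case: hsigmaB. Qed.
Let aM x y : sigmaA (x ** y) = sigmaA x ** sigmaA y. Proof. by case: hsigmaA. Qed.
Let bM x y : sigmaB (x ** y) = sigmaB x ** sigmaB y. Proof. by case: hsigmaB. Qed.

Let lin0 (V W : lmodType K) (f : V -> W) : linear f -> f 0 = 0.
Proof. by move=> lf; have := lf (-1) 0 0; rewrite scaler0 addr0 scaleN1r addNr. Qed.

Lemma words_mulA j a y : lspan (words j) y -> lspan (words j.+1) (sigmaA a ** y).
Proof.
move=> yj; move: y yj; apply: lspan_ind => [|k u v|w wj].
- by rewrite smul0r; apply: lspan0.
- by rewrite smulDr smulZr; apply: lspan_lin.
move: a (sAE a); apply: lspan_ind => [|k u v|a sAa].
- by rewrite lin0 // smul0l; apply: lspan0.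
- by rewrite aL smulDl smulZl; apply: lspan_lin.
by apply: lspan_mem; rewrite mem_cat; apply/orP; left; apply/allpairsP; exists (a, w).
Qed.

Lemma words_mulB j b y : lspan (words j) y -> lspan (words j.+1) (sigmaB b ** y).
Proof.
move=> yj; move: y yj; apply: lspan_ind => [|k u v|w wj].
- by rewrite smul0r; apply: lspan0.
- by rewrite smulDr smulZr; apply: lspan_lin.
move: b (sBE b); apply: lspan_ind => [|k u v|b sBb].
- by rewrite lin0 // smul0l; apply: lspan0.
- by rewrite bL smulDl smulZl; apply: lspan_lin.
by apply: lspan_mem; rewrite mem_cat; apply/orP; right; apply/allpairsP; exists (b, w).
Qed.

Lemma words_le i j y : (i <= j)%N -> lspan (words i) y -> lspan (words j) y.
Proof.
move=> /subnK <-; elim: (j - i)%N => [//|n ih] /ih {}ih.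
by rewrite addSn -(e1 y) -sigmaA1; apply: words_mulA.
Qed.

Lemma words_ind (Q : nat -> P -> Prop) :
  Q 0%N e -> (forall j, Q j 0) ->
  (forall j k u v, Q j u -> Q j v -> Q j (k *: u + v)) ->
  (forall j a y, lspan (words j) y -> Q j y -> Q j.+1 (sigmaA a ** y)) ->
  (forall j b y, lspan (words j) y -> Q j y -> Q j.+1 (sigmaB b ** y)) ->
  forall j y, lspan (words j) y -> Q j y.
Proof.
move=> Qe Q0 QD QA QB; elim=> [|j ih]; apply: lspan_ind; do ?by [exact: Q0|exact: QD].
  by move=> u; rewrite inE => /eqP->.
move=> u; rewrite mem_cat => /orP[] /allpairsP[[x w] /= [_ wj ->]].
  by apply: QA; [exact: lspan_mem|apply/ih/lspan_mem].
by apply: QB; [exact: lspan_mem|apply/ih/lspan_mem].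
Qed.

(** An element of [D] is absorbed by the first letter, whichever algebra it comes from; a first
    letter must exist, hence the successor. *)
Lemma words_mulD j d y : lspan (words j.+1) y -> lspan (words j.+1) (sigmaA (phiA d) ** y).
Proof.
move: y; apply: lspan_ind => [|k u v|u].
- by rewrite smul0r; apply: lspan0.
- by rewrite smulDr smulZr; apply: lspan_lin.
rewrite mem_cat => /orP[] /allpairsP[[x w] /= [_ wj ->]]; rewrite smulA.
  by rewrite -aM; apply: words_mulA; apply: lspan_mem.
by rewrite sigma_phi -bM; apply: words_mulB; apply: lspan_mem.
Qed.

Variables (F : P -> K) (lF : scalar F) (pF : forall y, 0 <= F (star y ** y)).

Let form_lin u : scalar (fun v => F (star u ** v)).
Proof. by move=> k v w; rewrite smulDr smulZr lF. Qed.
Let form_herm u v : F (star v ** u) = (F (star u ** v))^*.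
Proof. by rewrite -(positive_hermitian e1 e2 lF pF) starM starK. Qed.
Let F_sum (I : finType) (G : I -> P) : F (\sum_i G i) = \sum_i F (G i).
Proof.
have F0 : F 0 = 0 by have := lF (-1) 0 0; rewrite scaler0 addr0 mulN1r addNr.
elim/big_rec2: _ => [//|i x y _ <-].
by rewrite -[G i]scale1r lF mul1r scale1r.
Qed.

Let FZ k y : F (k *: y) = k * F y.
Proof.
have F0 : F 0 = 0 by have := lF (-1) 0 0; rewrite scaler0 addr0 mulN1r addNr.
by rewrite -[_ *: _]addr0 lF F0 addr0.
Qed.

(* The embedding of GNS vectors into copies of the range of [alpha]: for an
   orthonormal family [v] of GNS vectors, it multiplies by [g i] before taking
   coordinates, so that it intertwines left multiplication with [alpha]. *)
Lemma exists_embedding (Z : starAlgType K) (eZ : Z) (sigma : Z -> P) n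
    (L : Z -> 'M[K]_n) c tau (g : 'I_n -> Z) m (alpha : Z -> 'M[K]_m)
    (J : 'M[K]_(m, n)) k (v : 'I_k -> P) (Y : P -> Prop) :
  star_hom sigma -> sigma eZ = e -> regular_rep eZ tau L c g ->
  (forall a, alpha a *m J = J *m L a) -> adjmx J *m J = 1%:M ->
  (forall i y, Y y -> forall z, F (star z ** (sigma (g i) ** y)) =
     \sum_j (F (star (v j) ** z))^* * F (star (v j) ** (sigma (g i) ** y))) ->
  let Theta y := vectorise (J *m (\matrix_(i, j) F (star (v j) ** (sigma (g i) ** y)))) in
  [/\ linear Theta,
      forall a y, amplify k (alpha a) *m Theta y = Theta (sigma a ** y)
    & forall y z, Y y -> adjmx (Theta z) *m Theta y = (F (star z ** y))%:M].
Proof.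
move=> [lS mS sS] S1 [_ _ _ _ gE gU _ _] aJ JJ parse Theta; split.
- move=> x y z; rewrite /Theta -vectorise_linear scalemxAr -mulmxDr;
    congr (vectorise (_ *m _)).
  by apply/matrixP => i j; rewrite !mxE -lF smulDr smulZr smulDr smulZr.
- move=> a y; rewrite amplify_vectorise mulmxA aJ -mulmxA; congr (vectorise (_ *m _)).
  apply/matrixP => i j; rewrite !mxE (smulA (sigma (g i))) -mS gE.
  have -> : sigma (\sum_j0 L a i j0 *: g j0) = \sum_j0 L a i j0 *: sigma (g j0).
    by elim/big_rec2: _ => [|s x z _ <-]; rewrite ?lin0 ?lS.
  rewrite smul_suml smul_sumr F_sum; apply: eq_bigr => s _.
  by rewrite smulZl smulZr FZ mxE.
- move=> y z Yy; rewrite vectorise_dot adjmxM -mulmxA (mulmxA (adjmx J)) JJ mul1mx.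
  congr (_%:M); rewrite /mxtrace.
  under eq_bigr => j _ do rewrite mxE.
  rewrite exchange_big /=.
  have -> : F (star z ** y) = \sum_i F (star (sigma (g i) ** z) ** (sigma (g i) ** y)).
    rewrite -F_sum -{1}(e1 y) -S1 -gU.
    have -> : sigma (\sum_i star (g i) ** g i) = \sum_i star (sigma (g i)) ** sigma (g i).
      rewrite (big_morph sigma (id1 := 0) (op1 := +%R));
        first by apply: eq_bigr => i _; rewrite mS sS.
        by move=> x x'; rewrite -[x]scale1r lS !scale1r.
      exact: lin0.
    rewrite smul_suml smul_sumr; congr F; apply: eq_bigr => i _.
    by rewrite starM !smulA.
  apply: eq_bigr => i _; rewrite parse //; apply: eq_bigr => j _.
  by rewrite adjmxE !mxE.
Qed.

Variables (nA nB m : nat) (LA : A -> 'M[K]_nA) (LB : B -> 'M[K]_nB).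
Variables (cA : 'I_nA -> K) (cB : 'I_nB -> K) (tauA : A -> K) (tauB : B -> K).
Variables (gA : 'I_nA -> A) (gB : 'I_nB -> B).
Hypotheses (regA : regular_rep eA tauA LA cA gA) (regB : regular_rep eB tauB LB cB gB).
Variables (alpha : A -> 'M[K]_m) (beta : B -> 'M[K]_m).
Variables (JA : 'M[K]_(m, nA)) (JB : 'M[K]_(m, nB)).
Hypotheses (halpha : star_hom alpha) (hbeta : star_hom beta).
Hypotheses (aJ : forall a, alpha a *m JA = JA *m LA a) (JJA : adjmx JA *m JA = 1%:M).
Hypotheses (bJ : forall b, beta b *m JB = JB *m LB b) (JJB : adjmx JB *m JB = 1%:M).
Hypothesis alpha_beta : forall d, alpha (phiA d) = beta (phiB d).

(** Two orthonormal families are needed. [u], from words of length [l.+1], carries the action of [D]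
    that the gluing must respect; [v], one letter longer, gives the coordinates of the vectors
    [g i ** y] inside the embeddings. *)
Theorem exists_dilation l : exists N (rhoA : A -> 'M[K]_N) (rhoB : B -> 'M[K]_N)
    (Theta : P -> 'cV[K]_N), [/\ star_hom rhoA, star_hom rhoB,
  forall d, rhoA (phiA d) = rhoB (phiB d),
  linear Theta &
  [/\ forall j a y, (j < l)%N -> lspan (words j) y ->
        rhoA a *m Theta y = Theta (sigmaA a ** y),
      forall j b y, (j < l)%N -> lspan (words j) y ->
        rhoB b *m Theta y = Theta (sigmaB b ** y)
    & forall j y, (j <= l)%N -> lspan (words j) y ->
        adjmx (Theta y) *m Theta y = (F (star y ** y))%:M]].
Proof.
have [r [u [uS uO uR]]] := gram_schmidt form_lin form_herm pF (words l.+1).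
have [k [v [_ _ vR]]] := gram_schmidt form_lin form_herm pF (words l.+2).
have vP := parseval form_lin form_herm vR.
have [|thAL thAM thAF] := @exists_embedding A eA sigmaA nA LA cA tauA gA m alpha JA k v
    (fun y => lspan (words l.+1) y) hsigmaA sigmaA1 regA aJ JJA.
  by move=> i y Yy z; apply: vP; apply: words_mulA.
have [|thBL thBM thBF] := @exists_embedding B eB sigmaB nB LB cB tauB gB m beta JB k v
    (fun y => lspan (words l.+1) y) hsigmaB sigmaB1 regB bJ JJB.
  by move=> i y Yy z; apply: vP; apply: words_mulB.
set thA := (fun y => vectorise _) in thAL thAM thAF.
set thB := (fun y => vectorise _) in thBL thBM thBF.
pose X : 'M[K]_(m * k, r) := \matrix_(i, j) thA (u j) i 0.
pose Y : 'M[K]_(m * k, r) := \matrix_(i, j) thB (u j) i 0.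
pose U y : 'cV[K]_r := \col_j F (star (u j) ** y).
(* Null vectors are killed by an isometric map, so on this span both embeddings factor through the
   same coordinates [U y], via [X] and via [Y]. *)
have rangeE (th : P -> 'cV[K]_(m * k)) : linear th ->
    (forall y z, lspan (words l.+1) y -> adjmx (th z) *m th y = (F (star z ** y))%:M) ->
    forall y, lspan (words l.+1) y ->
    th y = (\matrix_(i, j) th (u j) i 0) *m U y.
  move=> lth thF y yl; set res := y - \sum_i F (star (u i) ** y) *: u i.
  have resl : lspan (words l.+1) res.
    by apply: lspanB => //; apply: lspan_sum => i _; apply/lspanZ/uS.
  have th0 : th res = 0 by apply: adjmx_mul_eq0; rewrite thF // uR // raddf0.
  have -> : th y = th (\sum_i F (star (u i) ** y) *: u i).
    rewrite -{1}(subrK (\sum_i F (star (u i) ** y) *: u i) y) -/res.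
    by rewrite -[res]scale1r lth th0 scaler0 add0r.
  have -> : th (\sum_i F (star (u i) ** y) *: u i) = \sum_i F (star (u i) ** y) *: th (u i).
    by elim/big_rec2: _ => [|i x z _ <-]; rewrite ?lin0 ?lth.
  apply/colP => i; rewrite summxE mxE; apply: eq_bigr => j _.
  by rewrite !mxE mulrC.
have isoE (th : P -> 'cV[K]_(m * k)) :
    (forall y z, lspan (words l.+1) y -> adjmx (th z) *m th y = (F (star z ** y))%:M) ->
    adjmx (\matrix_(i, j) th (u j) i 0 : 'M[K]_(m * k, r)) *m
      (\matrix_(i, j) th (u j) i 0) = 1%:M.
  move=> thF; apply/matrixP => i j.
  transitivity ((adjmx (th (u i)) *m th (u j)) 0 0).
    by rewrite !mxE; apply: eq_bigr => s _; rewrite !mxE.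
  by rewrite thF // !mxE eqxx mulr1n uO.
have uM d i : lspan (words l.+1) (sigmaA (phiA d) ** u i) by apply: words_mulD.
pose S d : 'M[K]_r := \matrix_(i, j) F (star (u i) ** (sigmaA (phiA d) ** u j)).
have actE (th : P -> 'cV[K]_(m * k)) (Z : 'M[K]_m) d : linear th ->
    (forall y z, lspan (words l.+1) y -> adjmx (th z) *m th y = (F (star z ** y))%:M) ->
    (forall y, amplify k Z *m th y = th (sigmaA (phiA d) ** y)) ->
    amplify k Z *m (\matrix_(i, j) th (u j) i 0) = (\matrix_(i, j) th (u j) i 0) *m S d.
  move=> lth thF thM; apply/matrixP => i j.
  transitivity ((amplify k Z *m th (u j)) i 0).
    by rewrite !mxE; apply: eq_bigr => s _; rewrite !mxE.
  rewrite thM (rangeE _ lth thF) // !mxE; apply: eq_bigr => s _.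
  by rewrite !mxE.
have hom_amp (Q : starAlgType K) (f : Q -> 'M[K]_m) : star_hom f ->
    star_hom (fun x => amplify k (f x)).
  move=> [lf mf sf]; split=> [c x y|x y|x].
  - by rewrite lf amplify_linear.
  - by rewrite mf -[f x ** f y]/(f x *m f y) amplifyM.
  - by rewrite sf -[star (f x)]/(adjmx (f x)) amplify_adj.
have [||||||||rhoA [rhoB [hA hB AB rA rB]]] := @glue K A B D phiA phiB _ r
  (fun a => amplify k (alpha a)) (fun b => amplify k (beta b)) X Y S.
- exact: hom_amp.
- exact: hom_amp.
- by move=> d; case: hphiA => _ _ ->.
- by move=> d; rewrite alpha_beta.
- exact: isoE.
- exact: isoE.
- by move=> d; apply: (actE thA (alpha (phiA d)) d thAL thAF) => y; apply: thAM.
- move=> d; apply: (actE thB (beta (phiB d)) d thBL thBF) => y.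
  by rewrite sigma_phi; apply: thBM.
exists (m * k + m * k)%N, rhoA, rhoB, (fun y => col_mx (thA y) 0); split=> //.
  by move=> c x y; rewrite thAL scale_col_mx add_col_mx scaler0 addr0.
split=> [j a y jl yj|j b y jl yj|j y jl yj].
- by rewrite rA /= thAM.
(* As [j < l], both [y] and its product with [b] stay in the span where [X] and [Y] describe the
   embeddings, so the action of [beta] is carried from [thB] to [thA]. *)
- have yl : lspan (words l.+1) y by apply: words_le yj; rewrite ltnW // ltnS ltnW.
  have byl : lspan (words l.+1) (sigmaB b ** y).
    by apply: (@words_le j.+1); [rewrite ltnS ltnW|apply: words_mulB].
  rewrite (rangeE _ thAL thAF y) // (rangeE _ thAL thAF _ byl); apply: rB.
  by rewrite -(rangeE _ thBL thBF y) // -(rangeE _ thBL thBF _ byl) thBM.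
- rewrite /adjmx tr_col_mx map_row_mx mul_row_col mulmx0 addr0 -/(adjmx (thA y)) thAF //.
  by apply: words_le yj; rewrite ltnW // ltnS.
Qed.

End Dilation.

(** * Traces and residual finite dimensionality *)

Section FiniteSeparation.
Variables (K : numClosedFieldType) (V : lmodType K).

(** While the chosen maps do not separate, some further map is nonzero on a surviving vector, and
    the rank of the common kernel in coordinates drops. *)
Lemma finite_separating (I : Type) (n : I -> nat) (f : forall i, V -> 'M[K]_(n i)) :
  finite_dimensional V -> (forall i, linear (f i)) ->
  (forall v, v != 0 -> exists i, f i v != 0) ->
  exists l : seq I, forall v,
    \sum_(i <- l) \tr (adjmx (f i v) *m f i v) = 0 -> v = 0.
Proof.
move=> [N [b bV]] lf sep.
pose M i : 'M[K]_(N, n i * n i) := \matrix_a mxvec (f i (b a)).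
pose vec (x : 'rV[K]_N) : V := \sum_a x 0 a *: b a.
have fM i x : mxvec (f i (vec x)) = x *m M i.
  have f0 : f i 0 = 0 by have := lf i (-1) 0 0; rewrite scaler0 addr0 scaleN1r addNr.
  have -> : f i (vec x) = \sum_a x 0 a *: f i (b a).
    by rewrite /vec; elim/big_rec2: _ => [//|a u v _ <-]; rewrite lf.
  rewrite linear_sum mulmx_sum_row; apply: eq_bigr => a _.
  by rewrite linearZ /= rowK.
pose S (l : seq I) := (\bigcap_(i <- l) kermx (M i))%MS.
have S_sub (l : seq I) x : \sum_(i <- l) \tr (adjmx (f i (vec x)) *m f i (vec x)) = 0 ->
    (x <= S l)%MS.
  rewrite /S; elim: l => [|i l ih]; first by rewrite !big_nil submx1.
  rewrite !big_cons => /eqP; rewrite paddr_eq0 ?mxtrace_adj_mul_ge0 //; last first.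
    by apply: sumr_ge0 => j _; apply: mxtrace_adj_mul_ge0.
  move=> /andP[/eqP/mxtrace_adj_mul_eq0 fi0 /eqP/ih xl].
  by rewrite sub_capmx xl andbT; apply/sub_kermxP; rewrite -fM fi0 linear0.
suff H k (l : seq I) : (\rank (S l) <= k)%N -> exists l' : seq I, forall v,
    \sum_(i <- l') \tr (adjmx (f i v) *m f i v) = 0 -> v = 0.
  exact: (H _ [::] (leqnn _)).
elim: k l => [|k ih] l rk.
  exists l => v; have [x ->] := bV v => fx.
  have := S_sub l (\row_a x a); have -> : vec (\row_a x a) = \sum_i x i *: b i.
    by apply: eq_bigr => a _; rewrite mxE.
  move=> /(_ fx); move: rk; rewrite leqn0 mxrank_eq0 => /eqP-> /submx0null x0.
  by apply: big1 => a _; have /rowP/(_ a) := x0; rewrite !mxE => ->; rewrite scale0r.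
have [good|bad] := pselect (forall v,
    \sum_(i <- l) \tr (adjmx (f i v) *m f i v) = 0 -> v = 0); first by exists l.
have [x [xS x0]] : exists x, (x <= S l)%MS /\ vec x != 0.
  apply: contrapT => no; apply: bad => v fv; apply/eqP/negPn/negP => v0; apply: no.
  have [x vx] := bV v; exists (\row_a x a).
  have -> : vec (\row_a x a) = v by rewrite vx; apply: eq_bigr => a _; rewrite mxE.
  split=> //; apply: S_sub.
  by have -> : vec (\row_a x a) = v by rewrite vx; apply: eq_bigr => a _; rewrite mxE.
have [i fi] := sep _ x0.
apply: (ih (i :: l)); rewrite -ltnS (leq_trans _ rk) // rank_ltmx //.
rewrite /S big_cons ltmxE capmxSr /=; apply: contra fi => le_cap.
have : (x <= kermx (M i))%MS.
  by apply: submx_trans xS (submx_trans le_cap _); apply: capmxSl.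
move/sub_kermxP; rewrite -fM => fi0; rewrite -(mxvecK (f i (vec x))) fi0.
by rewrite linear0.
Qed.

End FiniteSeparation.

(** A finite family whose images have maximal rank spans: adjoining any further [f v] cannot raise
    the rank. *)
Lemma finite_dimensional_inj (K : fieldType) (V : lmodType K) N (f : V -> 'rV[K]_N) :
  linear f -> injective f -> finite_dimensional V.
Proof.
move=> lf injf.
pose Q r := exists k (d : 'I_k -> V), (r <= \rank (\matrix_i f (d i)))%N.
have Q0 : exists r, `[< Q r >].
  by exists 0%N; apply/asboolP; exists 0%N, (fun=> 0).
have Qb r : `[< Q r >] -> (r <= N)%N.
  by move=> /asboolP[k [d /leq_trans]]; apply; apply: rank_leq_col.
case: (ex_maxnP Q0 Qb) => r /asboolP[k [d rk]] rmax.
have f0 : f 0 = 0 by have := lf (-1) 0 0; rewrite scaler0 addr0 scaleN1r addNr.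
exists k, d => v; set M := \matrix_i f (d i) in rk.
pose d' (i : 'I_(k + 1)) := if fintype.split i is inl j then d j else v.
have ME : \matrix_i f (d' i) = col_mx M (f v).
  apply/row_matrixP => i; rewrite rowK /d'; case: fintype.splitP => j ij.
    have -> : i = lshift 1 j by apply/val_inj.
    by rewrite rowKu rowK.
  have -> : i = rshift k j by apply/val_inj.
  by rewrite rowKd; apply/rowP => a; rewrite mxE ord1.
have : (f v <= M)%MS.
  have le_rk : (\rank (col_mx M (f v)) <= \rank M)%N.
    rewrite -ME (leq_trans _ rk) //; apply: rmax; apply/asboolP.
    by exists (k + 1)%N, d'.
  have MM : (M <= col_mx M (f v))%MS.
    by have := submx_refl (col_mx M (f v)); rewrite {1}col_mx_sub => /andP[].
  by move: le_rk; rewrite (geq_leqif (mxrank_leqif_sup MM)) col_mx_sub => /andP[].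
move=> /submxP[x xE]; exists (fun i => x 0 i); apply: injf.
have -> : f (\sum_i x 0 i *: d i) = \sum_i x 0 i *: f (d i).
  by elim/big_rec2: _ => [//|a u w _ <-]; rewrite lf.
by rewrite xE mulmx_sum_row; apply: eq_bigr => i _; rewrite rowK.
Qed.

Section TracesOfRFD.
Variables (R : realType) (A B D : unitalCStarAlgType R) (phiA : D -> A) (phiB : D -> B).
Hypotheses (hphiA : unital_inclusion phiA) (hphiB : unital_inclusion phiB).
Hypotheses (hA : finite_dimensional A) (hB : finite_dimensional B).
Variables (P : cstarAlgType R) (sigmaA : A -> P) (sigmaB : B -> P).
Hypotheses (hsA : star_hom sigmaA) (iA : injective sigmaA).
Hypotheses (hsB : star_hom sigmaB) (iB : injective sigmaB).
Hypothesis sigma_phi : sigmaA \o phiA =1 sigmaB \o phiB.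
Local Notation K := R[i].

Section OneAlgebra.
Variables (Z : unitalCStarAlgType R) (sigma : Z -> P).
Hypotheses (hs : star_hom sigma).
Variables (I : Type) (n : I -> nat) (rho : forall i, P -> 'M[K]_(n i)).
Hypothesis hrho : forall i, star_hom (rho i).
Variable l : seq I.
Let T p := \sum_(i <- l) \tr (rho i p).

Lemma sum_trace_star_mul p :
  T (star p ** p) = \sum_(i <- l) \tr (adjmx (rho i p) *m rho i p).
Proof.
by apply: eq_bigr => i _; have [_ mr sr] := hrho i; rewrite mr sr.
Qed.

Hypothesis sep : forall z,
  \sum_(i <- l) \tr (adjmx (rho i (sigma z)) *m rho i (sigma z)) = 0 -> z = 0.

Lemma sum_trace_one_neq0 : T (sigma sone) != 0.
Proof.
have [_ ms ss] := hs; apply: contra_neq (@sone_neq0 R Z) => T0; apply: sep.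
rewrite -sum_trace_star_mul -ss -ms smul1r.
by rewrite (star_unit (@smul1l R Z)).
Qed.

Lemma sum_trace_faithful_state :
  tracial_state (fun z => T (sigma z) / T (sigma sone)) /\
  faithful (fun z => T (sigma z) / T (sigma sone)).
Proof.
have [ls ms ss] := hs; have T0 := sum_trace_one_neq0.
have Tpos z : 0 <= T (sigma (star z ** z)).
  rewrite ms ss sum_trace_star_mul; apply: sumr_ge0 => i _.
  exact: mxtrace_adj_mul_ge0.
have T1 : 0 <= T (sigma sone).
  by have := Tpos sone; rewrite smul1r (star_unit (@smul1l R Z)).
split; first split.
- move=> k u v; rewrite ls mulrA -mulrDl; congr (_ / _).
  rewrite /T mulr_sumr -big_split; apply: eq_bigr => i _ /=.
  by have [lr _ _] := hrho i; rewrite lr mxtraceD mxtraceZ.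
- by move=> z; rewrite divr_ge0.
- by rewrite divff.
- move=> u v; rewrite !ms; congr (_ / _); apply: eq_bigr => i _.
  by have [_ mr _] := hrho i; rewrite !mr mxtrace_mulC.
move=> z /eqP; rewrite mulf_eq0 invr_eq0 (negPf T0) orbF ms ss sum_trace_star_mul.
by move=> /eqP /sep.
Qed.
End OneAlgebra.

(** The lists separating [A] and [B] are concatenated so that one functional on [P] serves both. Its
    normalising constants agree because both units are images of the unit of [D]; dividing by them
    allows degenerate representations. *)
Theorem traces_of_rfd : residually_finite_dimensional P ->
  exists (tauA : A -> K) (tauB : B -> K),
    [/\ tracial_state tauA, faithful tauA, tracial_state tauB, faithful tauB
      & forall d : D, tauA (phiA d) = tauB (phiB d)].
Proof.
move=> [I [n [rho [hrho sep]]]].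
have sepZ (Z : unitalCStarAlgType R) (sigma : Z -> P) : finite_dimensional Z ->
    star_hom sigma -> injective sigma -> exists l : seq I, forall z,
    \sum_(i <- l) \tr (adjmx (rho i (sigma z)) *m rho i (sigma z)) = 0 -> z = 0.
  move=> fZ [ls _ _] is_;
    apply: (finite_separating (f := fun i z => rho i (sigma z))) => //.
    by move=> i k u v; have [lr _ _] := hrho i; rewrite ls lr.
  move=> z z0; apply: sep; apply: contra_neq z0 => sz; apply: is_.
  by rewrite sz; have := ls (-1) 0 0; rewrite scaler0 addr0 scaleN1r addNr.
have [lA sA] := sepZ A sigmaA hA hsA iA.
have [lB sB] := sepZ B sigmaB hB hsB iB.
have sepA z : \sum_(i <- lA ++ lB)
    \tr (adjmx (rho i (sigmaA z)) *m rho i (sigmaA z)) = 0 -> z = 0.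
  rewrite big_cat => /eqP; rewrite paddr_eq0 => [/andP[/eqP/sA]| |] //.
    by apply: sumr_ge0 => i _; apply: mxtrace_adj_mul_ge0.
  by apply: sumr_ge0 => i _; apply: mxtrace_adj_mul_ge0.
have sepB z : \sum_(i <- lA ++ lB)
    \tr (adjmx (rho i (sigmaB z)) *m rho i (sigmaB z)) = 0 -> z = 0.
  rewrite big_cat => /eqP; rewrite paddr_eq0 => [/andP[_ /eqP/sB]| |] //.
    by apply: sumr_ge0 => i _; apply: mxtrace_adj_mul_ge0.
  by apply: sumr_ge0 => i _; apply: mxtrace_adj_mul_ge0.
have [tA fA] := sum_trace_faithful_state hsA hrho sepA.
have [tB fB] := sum_trace_faithful_state hsB hrho sepB.
eexists; eexists; split; [exact: tA|exact: fA|exact: tB|exact: fB|] => d.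
have := sigma_phi d; have := sigma_phi sone => /=.
have [_ _ ->] := hphiA; have [_ _ ->] := hphiB.
by move=> -> ->.
Qed.

End TracesOfRFD.

(** * Dense subalgebras and estimates for positive functionals *)

Section Density.
Variables (R : realType) (P : cstarAlgType R).

Lemma closure_nrmP (S : set P) x :
  closure S x <-> forall d : R, 0 < d -> exists2 y, S y & nrm (x - y) < d.
Proof.
split=> [cS d d0|H U].
  have dC : 0 < (d%:C)%C by rewrite ltcR.
  have [y [Sy]] := cS _ (nbhsx_ballx x _ dC).
  by rewrite -ball_normE /= normrE ltcR; exists y.
move=> /nbhs_ballP[e /= e0 eU].
have [d d0 eE] : exists2 d : R, 0 < d & e = (d%:C)%C.
  exists (complex.Re e); last by rewrite RRe_real ?gtr0_real.
  by rewrite -ltcR RRe_real ?gtr0_real.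
have [y Sy xy] := H d d0; exists y; split=> //; apply: eU.
by rewrite -ball_normE /= normrE eE ltcR.
Qed.

Lemma closure_star_subalgebra (S : set P) :
  star_subalgebra S -> star_subalgebra (closure S).
Proof.
move=> [S0 SD SZ SM Sstar]; split.
- exact: subset_closure.
- move=> a b /closure_nrmP ca /closure_nrmP cb; apply/closure_nrmP => d d0.
  have d2 : 0 < d / 2 by rewrite divr_gt0.
  have [x Sx ax] := ca _ d2; have [y Sy bY] := cb _ d2.
  exists (x + y); first exact: SD.
  have -> : a + b - (x + y) = (a - x) + (b - y) by module.
  by have := nrmD (a - x) (b - y); lra.
- move=> k a /closure_nrmP ca; apply/closure_nrmP => d d0.
  pose r := complex.Re `|k|.
  have kE : `|k| = (r%:C)%C by rewrite RRe_real ?normr_real.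
  have r0 : 0 <= r by rewrite -ler0c -kE.
  have r1 : 0 < r + 1 by rewrite ltr_wpDl.
  have [x Sx ax] := ca _ (divr_gt0 d0 r1).
  exists (k *: x); first exact: SZ.
  have -> : nrm (k *: a - k *: x) = r * nrm (a - x).
    by apply: (@complexI R); rewrite -scalerBr nrmZ kE rmorphM.
  rewrite ltr_pdivlMr // in ax; have := nrm_ge0 (a - x); nra.
- move=> a b /closure_nrmP ca /closure_nrmP cb; apply/closure_nrmP => d d0.
  pose r := nrm a + nrm b + 2.
  have r0 : 0 < r by rewrite ltr_wpDl ?addr_ge0 ?nrm_ge0.
  pose d' := Num.min 1 (d / r).
  have d'0 : 0 < d' by rewrite lt_min ltr01 divr_gt0.
  have d'1 : d' <= 1 by rewrite ge_min lexx.
  have d'r : d' * r <= d by rewrite -ler_pdivlMr // ge_min lexx orbT.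
  have [x Sx ax] := ca _ d'0; have [y Sy bY] := cb _ d'0.
  exists (x ** y); first exact: SM.
  have -> : a ** b - x ** y = (a - x) ** b + (x - a) ** (b - y) + a ** (b - y).
    by rewrite !(smulBl, smulBr); module.
  have h1 := nrmD ((a - x) ** b + (x - a) ** (b - y)) (a ** (b - y)).
  have h2 := nrmD ((a - x) ** b) ((x - a) ** (b - y)).
  have h3 := nrmM (a - x) b; have h4 := nrmM (x - a) (b - y).
  have h5 := nrmM a (b - y).
  have xa : nrm (x - a) = nrm (a - x) by rewrite -nrmN opprB.
  rewrite xa in h4.
  have := nrm_ge0 a; have := nrm_ge0 b; have := nrm_ge0 (a - x); have := nrm_ge0 (b - y).
  rewrite /r in d'r *; nra.
- move=> a /closure_nrmP ca; apply/closure_nrmP => d /ca[x Sx ax].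
  by exists (star x); [apply: Sstar|rewrite -starB nrm_star].
Qed.

Lemma generated_dense (G S : set P) : cstar_generates G -> star_subalgebra S ->
  G `<=` S -> forall x (d : R), 0 < d -> exists2 y, S y & nrm (x - y) < d.
Proof.
move=> gen subS GS x; apply/closure_nrmP.
rewrite (gen (closure S)) //; first exact: closure_star_subalgebra.
  exact: closed_closure.
by move=> y /GS; apply: subset_closure.
Qed.

(** [P] is not given as unital; elements on which [e] acts as a two-sided unit form a
    star-subalgebra, and density extends this to all of [P]. *)
Lemma generated_unit (G : set P) e : cstar_generates G -> star e = e ->
  (forall x, G x -> e ** x = x /\ x ** e = x) ->
  left_id e (smul : P -> P -> P) /\ right_id e (smul : P -> P -> P).
Proof.
move=> gen se eG; pose S := [set x : P | e ** x = x /\ x ** e = x].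
have subS : star_subalgebra S.
  split=> /=.
  - by rewrite /S /= smul0l smul0r.
  - by move=> a b [a1 a2] [b1 b2]; rewrite /S /= smulDl smulDr a1 a2 b1 b2.
  - by move=> k a [a1 a2]; rewrite /S /= smulZl smulZr a1 a2.
  - by move=> a b [a1 a2] [b1 b2]; rewrite /S /= smulA a1 -smulA b2.
  - move=> a [a1 a2]; split.
      by rewrite -[X in X ** _]se -starM a2.
    by rewrite -[X in _ ** X]se -starM a1.
have dense x (d : R) : 0 < d -> exists2 y, S y & nrm (x - y) < d.
  exact: (generated_dense gen subS eG).
split=> x; apply/eqP; rewrite -subr_eq0;
  apply/eqP/(@nrm_small_eq0 _ _ _ (nrm e + 1)) => d d0.
  have [y [y1 _] xy] := dense x d d0.
  have -> : e ** x - x = e ** (x - y) - (x - y) by rewrite smulBr y1; module.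
  have := nrmB (e ** (x - y)) (x - y); have := nrmM e (x - y).
  have := nrm_ge0 e; have := nrm_ge0 (x - y); nra.
have [y [_ y1] xy] := dense x d d0.
have -> : x ** e - x = (x - y) ** e - (x - y) by rewrite smulBl y1; module.
have := nrmB ((x - y) ** e) (x - y); have := nrmM (x - y) e.
have := nrm_ge0 e; have := nrm_ge0 (x - y); nra.
Qed.

Variables (e : P) (smul1e : left_id e (smul : P -> P -> P))
          (smule1 : right_id e (smul : P -> P -> P)).

(** The square of the norm times [e], minus [star y ** y], is the square of a self-adjoint element,
    on which [F] is nonnegative. *)
Lemma positive_functional_bound (F : P -> R[i]) : scalar F ->
  (forall y, 0 <= F (star y ** y)) -> F e = 1 ->
  forall y, F (star y ** y) <= ((nrm y ^+ 2)%:C)%C.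
Proof.
move=> lF pF F1 y; set h := star y ** y.
have sh : star h = h by rewrite starM starK.
have [s [[ss _] s2 _]] := pos_sqrt smul1e smule1 (pos_nrm_sub smul1e sh).
have := pF s; rewrite ss s2 addrC -scaleN1r lF mulN1r.
have F0 : F 0 = 0 by have := lF (-1) 0 0; rewrite scaler0 addr0 mulN1r addNr.
by rewrite -[_%:C%C *: e]addr0 lF F1 F0 mulr1 addr0 addrC subr_ge0 nrm_cstar.
Qed.

Lemma positive_functional_parallelogram (F : P -> R[i]) : scalar F ->
  (forall y, 0 <= F (star y ** y)) ->
  forall x y, F (star x ** x) <= 2 * F (star y ** y) + 2 * F (star (x - y) ** (x - y)).
Proof.
move=> lF pF x y.
have FD u v : F (u + v) = F u + F v by rewrite -[u]scale1r lF mul1r scale1r.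
have FN u : F (- u) = - F u.
  by apply/eqP; rewrite -subr_eq0 opprK -FD addNr; have := lF (-1) 0 0;
    rewrite scaler0 addr0 mulN1r addNr => ->.
(* By the parallelogram identity for [y] and [x - y], the difference of the two sides is [F] at the
   square of [x - 2 y]. *)
rewrite -subr_ge0; have := pF (x - y *+ 2); rewrite mulr2n.
rewrite !(starB, starD) !(smulDl, smulDr, smulNl, smulNr) !(FD, FN).
by congr (0 <= _); ring.
Qed.

End Density.

(** * Representations of the two algebras with a common restriction *)

Section CommonRepresentation.
Variables (R : realType) (A B D : unitalCStarAlgType R) (phiA : D -> A) (phiB : D -> B).
Hypotheses (hphiA : unital_inclusion phiA) (hphiB : unital_inclusion phiB).
Hypotheses (hA : finite_dimensional A) (hB : finite_dimensional B).
Local Notation K := R[i].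

Lemma regular_rep_inj (Z : unitalCStarAlgType R) tau n (L : Z -> 'M[K]_n) c g :
  regular_rep sone tau L c g -> forall z, L z = 0 -> z = 0.
Proof.
move=> [_ _ _ _ gE gU _ _] z Lz; rewrite -(smul1l z) -gU smul_suml big1 // => i _.
rewrite -smulA gE Lz big1 ?smul0r // => j _.
by rewrite mxE scale0r.
Qed.

Lemma regular_rep_of_state (Z : unitalCStarAlgType R) tau :
  finite_dimensional Z -> tracial_state tau -> faithful tau ->
  exists n (L : Z -> 'M[K]_n) c g, regular_rep sone tau L c g.
Proof.
move=> fZ [lt pt t1 tt] ft.
by apply: exists_regular_rep => //; [exact: smul1l|exact: smul1r].
Qed.

Lemma finite_dimensional_subalgebra (tau : A -> K) : tracial_state tau -> faithful tau ->
  finite_dimensional D.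
Proof.
move=> ht ft; have [n [L [c [g reg]]]] := regular_rep_of_state hA ht ft.
have [[lL _ _] _ _ _ _ _ _ _] := reg; have [[lphi _ _] iphi _] := hphiA.
have lf : linear (fun d => mxvec (L (phiA d))).
  by move=> k u v; rewrite lphi lL linearP.
apply: (finite_dimensional_inj lf) => u v /(can_inj mxvecK) Luv.
apply: iphi; apply/eqP; rewrite -subr_eq0; apply/eqP/(regular_rep_inj reg).
by rewrite addrC -scaleN1r lL Luv scaleN1r addNr.
Qed.

Theorem common_representation (tauA : A -> K) (tauB : B -> K) :
  tracial_state tauA -> faithful tauA -> tracial_state tauB -> faithful tauB ->
  (forall d : D, tauA (phiA d) = tauB (phiB d)) ->
  exists nA (LA : A -> 'M[K]_nA) cA gA nB (LB : B -> 'M[K]_nB) cB gB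
    m (alpha : A -> 'M[K]_m) (beta : B -> 'M[K]_m) JA JB,
  [/\ regular_rep sone tauA LA cA gA, regular_rep sone tauB LB cB gB,
      star_hom alpha /\ star_hom beta,
      (forall a, alpha a *m JA = JA *m LA a) /\ adjmx JA *m JA = 1%:M
    & ((forall b, beta b *m JB = JB *m LB b) /\ adjmx JB *m JB = 1%:M) /\
      forall d, alpha (phiA d) = beta (phiB d)].
Proof.
move=> tA fA tB fB tAB.
have [nA [LA [cA [gA regA]]]] := regular_rep_of_state hA tA fA.
have [nB [LB [cB [gB regB]]]] := regular_rep_of_state hB tB fB.
have [hLA cA0 cLA trA _ _ _ LA1] := regA; have [hLB cB0 cLB trB _ _ _ LB1] := regB.
have [[lphiA mphiA sphiA] iphiA phiA1] := hphiA.
have [[lphiB mphiB sphiB] iphiB phiB1] := hphiB.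
have comp_hom (Z : unitalCStarAlgType R) n (L : Z -> 'M[K]_n) (phi : D -> Z) :
    star_hom L -> star_hom phi -> star_hom (fun d => L (phi d)).
  move=> [l1 m1 s1] [l2 m2 s2]; split=> [k u v|u v|u].
  - by rewrite l2 l1.
  - by rewrite m2 m1.
  - by rewrite s2 s1.
have hphiA' : star_hom phiA by split.
have hphiB' : star_hom phiB by split.
(* The weights of both algebras are made integral together, because agreement on [D] consists of
   relations between the two families. *)
pose c (u : 'I_nA + 'I_nB) : K := match u with inl i => cA i | inr j => cB j end.
have c0 u : 0 < c u by case: u => i /=.
have cRe u : ((complex.Re (c u))%:C)%C = c u by rewrite RRe_real ?gtr0_real.
have [N [N0 Nrel]] : exists N : 'I_nA + 'I_nB -> nat, (forall u, (0 < N u)%N) /\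
    forall s t : seq ('I_nA + 'I_nB), \sum_(u <- s) c u = \sum_(u <- t) c u ->
      (\sum_(u <- s) N u = \sum_(u <- t) N u)%N.
  have [u|N [N0 Nrel]] := @natural_weights R _ (fun u => complex.Re (c u)).
    by rewrite -ltcR cRe.
  exists N; split=> // s t st; apply: Nrel; apply: (@complexI R).
  by rewrite !rmorph_sum /= (eq_bigr c) // [RHS](eq_bigr c).
have Nc u v : c u = c v -> N u = N v.
  by move=> uv; have := Nrel [:: u] [:: v]; rewrite !big_seq1; apply.
have trN d : \sum_i (N (inl i))%:R * LA (phiA d) i i =
    \sum_j (N (inr j))%:R * LB (phiB d) j j.
  apply: (@weight_transfer K D sone nA nB (fun d => LA (phiA d)) (fun d => LB (phiB d))
    c (fun u => (N u)%:R)).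
  - exact: comp_hom.
  - by rewrite phiA1.
  - exact: comp_hom.
  - by rewrite phiB1.
  - by move=> u; apply: gtr0_real.
  - by move=> x i j; apply: cLA.
  - by move=> x i j; apply: cLB.
  - by move=> s t /Nrel st; rewrite -!natr_sum st.
  - by move=> x; rewrite -trA -trB tAB.
have [mA [alpha [JA [halpha alphaT alphaJ JJA]]]] :
    exists m (alpha : A -> 'M[K]_m) (J : 'M[K]_(m, nA)), [/\ star_hom alpha,
    forall a, \tr (alpha a) = \sum_i (N (inl i))%:R * LA a i i,
    forall a, alpha a *m J = J *m LA a & adjmx J *m J = 1%:M].
  by apply: (amplification (N := fun i => N (inl i))) => // a i j /cLA ij; apply: Nc.
have [mB [beta [JB [hbeta betaT betaJ JJB]]]] :
    exists m (beta : B -> 'M[K]_m) (J : 'M[K]_(m, nB)), [/\ star_hom beta,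
    forall b, \tr (beta b) = \sum_j (N (inr j))%:R * LB b j j,
    forall b, beta b *m J = J *m LB b & adjmx J *m J = 1%:M].
  by apply: (amplification (N := fun j => N (inr j))) => // b i j /cLB ij; apply: Nc.
(* Averaging over [D] requires a regular representation of [D], hence a faithful trace on it; the
   restriction of [tauA] provides one. *)
pose tauD d := tauA (phiA d).
have [ltA ptA t1A ttA] := tA.
have tD : tracial_state tauD.
  split=> [k u v|u||u v]; rewrite /tauD.
  - by rewrite lphiA ltA.
  - by rewrite mphiA sphiA.
  - by rewrite phiA1.
  - by rewrite !mphiA.
have fD : faithful tauD.
  move=> d; rewrite /tauD mphiA sphiA => /fA d0; apply: iphiA; rewrite d0.
  by have := lphiA (-1) 0 0; rewrite scaler0 addr0 scaleN1r addNr.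
have hD := finite_dimensional_subalgebra tA fA.
have [nD [LD [cD [gD regD]]]] := regular_rep_of_state hD tD fD.
have [|w [ww ww' wab]] := unitary_equivalence regD (@smul1l R D) (@smul1r R D)
    (comp_hom _ _ _ _ halpha hphiA') (comp_hom _ _ _ _ hbeta hphiB').
  by move=> d; rewrite alphaT betaT trN.
have [lb mb sb] := hbeta; have [la ma sa] := halpha.
have bM x y : beta (x ** y) = beta x *m beta y by rewrite mb.
have aM x y : alpha (x ** y) = alpha x *m alpha y by rewrite ma.
have ww1 : w *m adjmx w = beta sone by rewrite ww' phiB1.
have ww2 : adjmx w *m w = alpha sone by rewrite ww phiA1.
have b1 x : w *m adjmx w *m beta x = beta x by rewrite ww1 -bM smul1l.
(* [mA] and [mB] may differ: conjugation by [w] moves [beta] to the space of [alpha], and it stays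
   multiplicative because [w *m adjmx w] is the support of [beta]. *)
exists nA, LA, cA, gA, nB, LB, cB, gB, mA, alpha.
exists (fun b => adjmx w *m beta b *m w), JA, (adjmx w *m JB); split=> //.
- split=> //; split=> [k u v|u v|u].
  + by rewrite lb mulmxDr mulmxDl -scalemxAr -scalemxAl.
  + rewrite bM -[RHS]/(adjmx w *m beta u *m w *m (adjmx w *m beta v *m w)).
    by rewrite -!mulmxA (mulmxA w) (mulmxA (w *m _)) b1.
  + by rewrite sb -[RHS]/(adjmx _) !adjmxM adjmxK mulmxA.
- split; first split=> [b|].
  + rewrite -!mulmxA (mulmxA w) ww1 (mulmxA (beta b)) -bM smul1r.
    by rewrite betaJ.
  + rewrite adjmxM adjmxK -mulmxA (mulmxA w) ww1 betaJ LB1 mulmx1.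
    exact: JJB.
- by move=> d; rewrite -mulmxA -wab mulmxA ww2 -aM smul1l.
Qed.

End CommonRepresentation.

(** For nonzero [x], a state [F] norming [star x ** x] is reproduced at a nearby [y] by a vector
    functional [G] of a finite-dimensional [pi]. If [pi x] vanished, two parallelogram estimates,
    through [G] and then [F], would bound the squared norm of [x] by 6 times that of [x - y]. A
    distance below a third of the norm of [x] excludes this, since 6 is less than 9. *)
Theorem rfd_of_traces (R : realType) (A B D : unitalCStarAlgType R)
    (phiA : D -> A) (phiB : D -> B)
    (hphiA : unital_inclusion phiA) (hphiB : unital_inclusion phiB)
    (hA : finite_dimensional A) (hB : finite_dimensional B)
    (P : cstarAlgType R) (sigmaA : A -> P) (sigmaB : B -> P)
    (hP : is_amalgamated_free_product phiA phiB sigmaA sigmaB)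
    (tauA : A -> R[i]) (tauB : B -> R[i]) :
  tracial_state tauA -> faithful tauA -> tracial_state tauB -> faithful tauB ->
  (forall d : D, tauA (phiA d) = tauB (phiB d)) ->
  residually_finite_dimensional P.
Proof.
move=> tA fA tB fB tAB.
have [[hsA isA] [hsB isB] sigma_phi gen univ] := hP.
have [nA [LA [cA [gA [nB [LB [cB [gB [m [alpha [beta [JA [JB
  [regA regB [halpha hbeta] [aJ JJA] [[bJ JJB] ab]]]]]]]]]]]]]]] :=
  common_representation hphiA hphiB hA hB tA fA tB fB tAB.
have [hphiA' _ phiA1] := hphiA; have [_ _ phiB1] := hphiB.
have [lsA msA ssA] := hsA; have [lsB msB ssB] := hsB.
pose e := sigmaA sone.
have eB : sigmaB sone = e by rewrite /e -phiA1 -phiB1; have /= -> := sigma_phi sone.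
have se : star e = e by rewrite -ssA (star_unit (@smul1l R A)).
have [e1 e2] : left_id e (smul : P -> P -> P) /\ right_id e (smul : P -> P -> P).
  apply: (generated_unit gen se) => _ [[a _ <-]|[b _ <-]].
    by rewrite -!msA smul1l smul1r.
  by rewrite -eB -!msB smul1l smul1r.
have [sA sAE] := finite_dimensional_span hA.
have [sB sBE] := finite_dimensional_span hB.
pose W := words e sigmaA sigmaB sA sB.
have WA := words_mulA (e := e) (sigmaB := sigmaB) (sB := sB) hsA sAE.
have WB := words_mulB (e := e) (sigmaA := sigmaA) (sA := sA) hsB sBE.
(* A star-subalgebra containing the generators is required for density. Elements raising word length
   in a controlled way, together with their adjoints, form one, and applying such an element to [e]
   puts it in the span of some [W l]. *)
pose bounded x := forall j, exists l, forall y, lspan (W j) y -> lspan (W l) (x ** y).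
have Wle := words_le (sigmaB := sigmaB) (sB := sB) hsA e1 (erefl : sigmaA sone = e) sAE.
pose S := [set x : P | bounded x /\ bounded (star x)].
have subS : star_subalgebra S.
  have bD x y : bounded x -> bounded y -> bounded (x + y).
    move=> bx b_y j; have [l hl] := bx j; have [l' hl'] := b_y j.
    exists (maxn l l') => z zj; rewrite smulDl; apply: lspanD.
      by apply: (Wle l); [exact: leq_maxl|exact: hl].
    by apply: (Wle l'); [exact: leq_maxr|exact: hl'].
  have bZ k x : bounded x -> bounded (k *: x).
    move=> bx j; have [l hl] := bx j; exists l => z zj.
    by rewrite smulZl; apply/lspanZ/hl.
  have bM x y : bounded x -> bounded y -> bounded (x ** y).
    move=> bx b_y j; have [l hl] := b_y j; have [l' hl'] := bx l.
    by exists l' => z zj; rewrite -smulA; apply/hl'/hl.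
  split.
  - suff b0 : bounded 0 by split; rewrite ?star0.
    by move=> j; exists j => y _; rewrite smul0l; apply: lspan0.
  - by move=> a b [a1 a2] [b1 b2]; split; rewrite ?starD; apply: bD.
  - by move=> k a [a1 a2]; split; rewrite ?starZ; apply: bZ.
  - by move=> a b [a1 a2] [b1 b2]; split; rewrite ?starM; apply: bM.
  - by move=> a [a1 a2]; split; rewrite ?starK.
have genS : range sigmaA `|` range sigmaB `<=` S.
  move=> _ [[a _ <-]|[b _ <-]]; split; rewrite -?ssA -?ssB => j; exists j.+1 => y yj.
  - exact: WA.
  - exact: WA.
  - exact: WB.
  - exact: WB.
(* All finite-dimensional representations are taken at once; what remains is to find, for each [x],
   one that does not kill it. *)
exists {N : nat & {f : P -> 'M[R[i]]_N | star_hom f}}, (fun u => tag u),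
  (fun u => sval (tagged u : {f : P -> 'M[R[i]]_(tag u) | star_hom f})).
split=> [[N [f hf]] //|x x0].
have [F [lF pF F1 Fx]] := exists_norming_state e1 e2 x0.
have n0 : 0 < nrm x by rewrite lt_def nrm_eq0 x0 nrm_ge0.
have [y [b_y _] xy] := generated_dense gen subS genS x (divr_gt0 n0 (ltr0n R 3)).
have [l hl] := b_y 0%N.
have yl : lspan (W l) y by rewrite -(e2 y); apply: hl; apply: lspan_mem; rewrite mem_head.
have [N [rhoA [rhoB [Th [hrA hrB rAB lTh [ThA ThB ThF]]]]]] :=
  exists_dilation (eB := sone) hphiA' hsA hsB e1 e2 (erefl : sigmaA sone = e) eB
    sigma_phi sAE sBE lF pF regA regB halpha hbeta aJ JJA bJ JJB ab l.+1.
have [pi [hpi [piA piB]]] : exists pi : P -> 'M[R[i]]_N, star_hom pi /\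
    ((forall a, pi (sigmaA a) = rhoA a) /\ (forall b, pi (sigmaB b) = rhoB b)).
  by have [pi [hpi piA piB]] := univ (opmx R N) rhoA rhoB hrA hrB rAB; exists pi.
exists (existT _ N (exist _ pi hpi)) => /=.
have [lpi mpi spi] := hpi.
have Th0 : Th 0 = 0 by have := lTh (-1) 0 0; rewrite scaler0 addr0 scaleN1r addNr.
have pi0 : pi 0 = 0.
  by have := lpi (-1) 0 0; rewrite scaler0 addr0 scaleN1r addNr.
have mpi' u v : pi (u ** v) = pi u *m pi v by exact: mpi.
(* [pi] acts on [Th e] letter by letter as the dilation prescribes, so every word of length at most
   [l.+1] is sent to its own dilated vector. *)
have piTh j z : lspan (W j) z -> (j <= l.+1)%N -> pi z *m Th e = Th z.
  move: j z; apply: words_ind.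
  - move=> _; rewrite /e piA -/e.
    by rewrite (ThA 0%N) // ?e1 //; apply: lspan_mem; rewrite mem_head.
  - by move=> j _; rewrite pi0 mul0mx Th0.
  - by move=> j k u v Qu Qv jl; rewrite lpi mulmxDl -scalemxAl Qu ?Qv // lTh.
  - move=> j a z zj Qz jl; rewrite mpi' -mulmxA Qz 1?ltnW //.
    by rewrite piA; apply: (ThA j).
  - move=> j b z zj Qz jl; rewrite mpi' -mulmxA Qz 1?ltnW //.
    by rewrite piB; apply: (ThB j).
pose xi := Th e.
pose G z := (adjmx xi *m pi z *m xi) 0 0.
have GE z : G (star z ** z) =
    \tr (adjmx (pi z *m xi) *m (pi z *m xi)).
  rewrite /G /mxtrace big_ord1 mpi' adjmxM !mulmxA;
    rewrite [X in _ *m X *m _ *m _](spi z : pi (star z) = adjmx (pi z)).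
  by [].
have lG : scalar G.
  by move=> k u v; rewrite /G lpi mulmxDr mulmxDl -scalemxAr -scalemxAl !mxE.
have pG z : 0 <= G (star z ** z) by rewrite GE mxtrace_adj_mul_ge0.
have Gy : G (star y ** y) = F (star y ** y).
  rewrite GE (piTh l) ?leqnSn // (ThF l) ?leqnSn //.
  by rewrite mxtrace_scalar mulr1n.
have G1 : G e = 1.
  have e0 : lspan (W 0%N) e by apply: lspan_mem; rewrite mem_head.
  rewrite -[X in G X](e1 e) -{1}se GE (piTh 0%N) // (ThF 0%N) //.
  by rewrite mxtrace_scalar mulr1n se e1.
apply/eqP => pix.
have Gx : G (star x ** x) = 0 by rewrite GE pix mul0mx adjmx0 mulmx0 mxtrace0.
have h1 := positive_functional_parallelogram lF pF x y.
have h2 := positive_functional_parallelogram lG pG y x.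
have h3 := positive_functional_bound e1 e2 lF pF F1 (x - y).
have h4 := positive_functional_bound e1 e2 lG pG G1 (y - x).
rewrite Gx Gy mulr0 add0r in h2.
have nyx : nrm (y - x) = nrm (x - y) by rewrite -nrmN opprB.
rewrite nyx in h4.
have : ((nrm x ^+ 2)%:C)%C <= ((6 * nrm (x - y) ^+ 2)%:C)%C.
  rewrite -Fx (le_trans h1) //.
  have -> : ((6 * nrm (x - y) ^+ 2)%:C)%C =
      2 * (2 * ((nrm (x - y) ^+ 2)%:C)%C) + 2 * ((nrm (x - y) ^+ 2)%:C)%C.
    by rewrite rmorphM rmorph_nat; ring.
  apply: lerD; last by rewrite ler_pM2l.
  by rewrite ler_pM2l // (le_trans h2) // ler_pM2l.
rewrite lecR ltr_pdivlMr // in xy *; have := nrm_ge0 (x - y); nra.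
Qed.

Local Open Scope complex_scope.

Theorem theorem4p2 (R : realType) (A B D : unitalCStarAlgType R)
    (phiA : D -> A) (phiB : D -> B)
    (hphiA : unital_inclusion phiA) (hphiB : unital_inclusion phiB)
    (hA : finite_dimensional A) (hB : finite_dimensional B)
    (P : cstarAlgType R) (sigmaA : A -> P) (sigmaB : B -> P)
    (hP : is_amalgamated_free_product phiA phiB sigmaA sigmaB) :
  residually_finite_dimensional P <->
  exists (tauA : A -> R[i]) (tauB : B -> R[i]),
    [/\ tracial_state tauA, faithful tauA,
        tracial_state tauB, faithful tauB
      & forall d : D, tauA (phiA d) = tauB (phiB d)].
Proof.
split=> [rfd|[tauA [tauB [tA fA tB fB tAB]]]].
  have [[hsA iA] [hsB iB] sigma_phi _ _] := hP.
  exact: (traces_of_rfd hphiA hphiB hA hB hsA iA hsB iB sigma_phi).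
exact: (rfd_of_traces hphiA hphiB hA hB hP tA fA tB fB tAB).
Qed.
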